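(* Let $d\ge1$, let $r\ge 1$ be an integer, let $(X_i)_{i\ge1}$ be an i.i.d. sequence of random variables in $\mathbb{R}^d$, and let $(e_i)_{i\ge1}$ be an i.i.d. sequence of real random variables, independent of $(X_i)_{i\ge1}$. Consider the regression model $Y_i=g(X_i)+\sigma(X_i)e_i$ with unknown functions $g,\sigma:\mathbb{R}^d\to\mathbb{R}$, where the regression function $g$ follows the multiple index model: $g(x)=g_0(\beta^Tx)$ for every $x\in\mathbb{R}^d$, for some $g_0:\mathbb{R}^p\to\mathbb{R}$ and $\beta\in\mathbb{R}^{d\times p}$ with $p\le d$ minimal, the index space $\operatorname{span}(\beta)$ being assumed unique. Let $\psi:\mathbb{R}^d\to\mathbb{R}$ be a smooth function (so that its gradient $\nabla\psi$ exists), let $Q\subset\mathbb{R}^d$ be a compact set, and let $h=h_n>0$ be a bandwidth depending on $n$. Assume: (i) $X_1$ has a bounded density $f$ on $\mathbb{R}^d$ such that its $r$-th order derivatives are bounded; (ii) there is $b>0$ such that $f(x)\ge b$ for every $x\in Q$; (iii) the kernel $K:\mathbb{R}^d\to\mathbb{R}$ is symmetric with order $r\ge s$ for some $s>0$, and $K(x)\le C_1\exp(-C_2\|x\|)$ for every $x\in\mathbb{R}^d$, for some constants $C_1,C_2>0$; (iv) the function $\nabla\psi$ is H\''older on its support $Q$, which is nonempty, bounded and convex; (v) $g$ is H\''older on $Q$ and $\sigma$ is bounded; (vi) $n^{1/2}h^r\to0$ and $n^{1/2}h^d\to+\infty$ as $n\to\infty$. Set $$\beta_\psi=\int g(x)\nabla\psi(x)\,dx,\qquad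 \widehat\beta_\psi=n^{-1}\sum_{i=1}^n\frac{Y_i\nabla\psi(X_i)}{\widehat f^{(i)}(X_i)},$$ with $\widehat f^{(i)}$ the leave-one-out kernel estimator of $f$ defined in the context. Then $$n^{1/2}(\widehat\beta_\psi-\beta_\psi)\ \longrightarrow\ \mathcal{N}(0,v)\quad\text{in distribution},$$ where $v$ is the variance (covariance matrix) of the random vector $\dfrac{Y_1-g(X_1)}{f(X_1)}\,\nabla\psi(X_1)$.
   Context: Leave-one-out kernel density estimator, based on $X_1,\dots,X_n$ with bandwidth $h=h_n$: for $1\le i\le n$ and $x\in\mathbb{R}^d$, $$\widehat f^{(i)}(x)=(nh^d)^{-1}\sum_{1\le j\le n,\ j\ne i}K\big(h^{-1}(X_j-x)\big).$$ Kernel: $K$ is symmetric if $K(-x)=K(x)$ for all $x$. $K$ has order $r$ if $\int K(x)\,dx=1$ and $\int P(x)K(x)\,dx=0$ for every non-constant monomial $P$ of degree at most $r$. A (vector-valued) function is H\''older on a set $Q$ if for some $\alpha\in(0,1]$ and some constant $C$ the difference of its values at $x,y\in Q$ is bounded in norm by $C\|x-y\|^{\alpha}$. The quantity $\nabla\psi(X_1)/f(X_1)$ is read as $0$ when $\nabla\psi(X_1)=0$. In the multiple index model, ''$p$ minimal'' means that $g$ admits no such representation with a smaller number of columns of $\beta$; $\operatorname{span}(\beta)$, the span of the columns of $\beta$, is called the index space.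
   Formalization: The kernel bound in (iii) is taken for |K(x)|, since a one-sided bound on K(x) allows integrable negative singularities that break the claim; ''regression function'' is read as g(X_1)=E[Y_1|X_1], and the vector defining v is assumed to have finite second moments. *)

(* Defs.v *)
From HB Require Import structures.
From mathcomp Require Import all_boot all_order all_algebra.
From mathcomp Require Import all_classical all_reals all_analysis.

Set Implicit Arguments.
Unset Strict Implicit.
Unset Printing Implicit Defensive.

Import Order.TTheory GRing.Theory Num.Theory.
Import numFieldNormedType.Exports.

Local Open Scope classical_set_scope.
Local Open Scope ring_scope.

(* Vectors of R^d are row vectors 'rV[R]_d, so that beta^T x is rendered by
   x *m beta.  The norm `|x| on 'rV[R]_d is the library's sup norm; it only
   occurs below in conditions that hold for one norm iff they hold for all. *)

(* 'rV[R]_d carries the sigma-algebra generated by the coordinates, i.e. the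
   Borel sigma-algebra. *)
Fact row_display : measure_display. Proof. exact: default_measure_display. Qed.

Section measurable_row.
Context {R : realType}.
Variable d : nat.

Let coord (i : 'I_d) (x : 'rV[R]_d) : R := x 0 i.

Let row0 : g_sigma_preimage coord set0.
Proof. exact: sigma_algebra0. Qed.

Let rowC A : g_sigma_preimage coord A -> g_sigma_preimage coord (~` A).
Proof. exact: sigma_algebraC. Qed.

Let row_bigcup (F : (set 'rV[R]_d)^nat) :
  (forall i, g_sigma_preimage coord (F i)) ->
  g_sigma_preimage coord (\bigcup_i (F i)).
Proof. exact: sigma_algebra_bigcup. Qed.

HB.instance Definition _ := @isMeasurable.Build row_display
  'rV[R]_d (g_sigma_preimage coord) row0 rowC row_bigcup.

Lemma measurable_coord (i : 'I_d) :
  measurable_fun [set: 'rV[R]_d] (fun x : 'rV[R]_d => x 0 i).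
Proof.
move=> _ Y mY; rewrite setTI; apply: sub_sigma_algebra => /=.
rewrite -bigcup_seq/=; exists i => /=; first by rewrite mem_index_enum.
by exists Y => //; rewrite setTI.
Qed.

Lemma measurable_row d1 (T : measurableType d1) (f : T -> 'rV[R]_d) :
  (forall i, measurable_fun [set: T] (fun t => f t 0 i)) ->
  measurable_fun [set: T] f.
Proof.
move=> mf; apply: measurability => //.
move=> _ [A + <-]; rewrite -bigcup_seq/= => -[i _ [Y mY <-]].
by rewrite setTI; exact: mf.
Qed.

End measurable_row.

Section lebesgue_row.
Context {R : realType}.

Definition cons_row n (p : R * 'rV[R]_n) : 'rV[R]_n.+1 :=
  \row_i (if unlift ord0 i is Some j then p.2 0 j else p.1).

Definition uncons_row n (x : 'rV[R]_n.+1) : R * 'rV[R]_n :=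
  (x 0 ord0, \row_j x 0 (lift ord0 j)).

Lemma cons_rowK n : cancel (@cons_row n) (@uncons_row n).
Proof.
case=> a x; rewrite /uncons_row /cons_row mxE unlift_none; congr pair.
by apply/rowP => j; rewrite !mxE liftK.
Qed.

Lemma measurable_cons_row n : measurable_fun setT (@cons_row n).
Proof.
apply: measurable_row => i; rewrite /cons_row.
under eq_fun do rewrite mxE.
case: unliftP => [j _|_]; last exact: measurable_fst.
by apply: (measurableT_comp (measurable_coord j)); exact: measurable_snd.
Qed.

Lemma measurable_uncons_row n : measurable_fun setT (@uncons_row n).
Proof.
apply: measurable_fun_pair; first exact: measurable_coord.
apply: measurable_row => i.
under eq_fun do rewrite mxE.
exact: measurable_coord.
Qed.

Section lebesgue_cons.
Variables (n : nat) (mu : {sigma_finite_measure set 'rV[R]_n -> \bar R}).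

Definition lebesgue_cons : set 'rV[R]_n.+1 -> \bar R :=
  pushforward (lebesgue_measure \x mu)%E (@cons_row n).

Let lebesgue_cons0 : lebesgue_cons set0 = 0%E.
Proof. by rewrite /lebesgue_cons /pushforward preimage_set0 measure0. Qed.

Let lebesgue_cons_ge0 A : (0 <= lebesgue_cons A)%E.
Proof. exact: (@measure_ge0 _ _ _ (lebesgue_measure \x mu)%E). Qed.

Let lebesgue_cons_sigma_additive : semi_sigma_additive lebesgue_cons.
Proof.
move=> F mF tF mUF; rewrite /lebesgue_cons /pushforward preimage_bigcup.
have mpre A : measurable A -> measurable (@cons_row n @^-1` A).
  by move=> mA; rewrite -[X in measurable X]setTI; exact: measurable_cons_row.
apply: measure_semi_sigma_additive => [i||].
- exact: mpre.
- apply/trivIsetP => i j _ _ ij; rewrite -preimage_setI.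
  by move/trivIsetP : tF => /(_ _ _ Logic.I Logic.I ij) ->; rewrite preimage_set0.
- by rewrite -preimage_bigcup; exact: mpre.
Qed.

HB.instance Definition _ := isMeasure.Build _ _ _ lebesgue_cons
  lebesgue_cons0 lebesgue_cons_ge0 lebesgue_cons_sigma_additive.

Let lebesgue_cons_sigma_finite : sigma_finite setT lebesgue_cons.
Proof.
pose leb : {sigma_finite_measure set (measurableTypeR R) -> \bar R} :=
  lebesgue_measure.
have /sigma_finiteP[F [FT ndF Foo]] := sigma_finiteT leb.
have /sigma_finiteP[G [GT ndG Goo]] := sigma_finiteT mu.
exists (fun k => @uncons_row n @^-1` (F k `*` G k)).
  apply/seteqP; split => // x _.
  have [i _ Fi] : (\bigcup_i F i) (uncons_row x).1 by rewrite -FT.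
  have [j _ Gj] : (\bigcup_j G j) (uncons_row x).2 by rewrite -GT.
  exists (maxn i j) => //; split.
    by move: Fi; exact/subsetPset/ndF/leq_maxl.
  by move: Gj; exact/subsetPset/ndG/leq_maxr.
move=> k; have [mF Fk] := Foo k; have [mG Gk] := Goo k; split.
  rewrite -[X in measurable X]setTI; apply: measurable_uncons_row => //.
  exact: measurableX.
rewrite /lebesgue_cons /pushforward -comp_preimage.
rewrite (_ : _ \o _ = id); last by apply/funext => p /=; rewrite cons_rowK.
rewrite preimage_id product_measure1E//.
by rewrite lte_mul_pinfty// ge0_fin_numE.
Qed.

HB.instance Definition _ := Measure_isSigmaFinite.Build _ _ _ lebesgue_cons
  lebesgue_cons_sigma_finite.

End lebesgue_cons.

(* Lebesgue measure on R^n, as an iterated product of the one on R;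
   lebesgue_row_box gives its values on products of measurable sets. *)
Fixpoint lebesgue_row n : {sigma_finite_measure set 'rV[R]_n -> \bar R} :=
  if n is m.+1 then lebesgue_cons (lebesgue_row m) else \d_(0 : 'rV[R]_0).

Lemma lebesgue_row_box n (A : 'I_n -> set R) : (forall i, measurable (A i)) ->
  lebesgue_row n [set x : 'rV[R]_n | forall i, A i (x 0 i)] =
  (\prod_(i < n) lebesgue_measure (A i))%E.
Proof.
elim: n A => [|n IHn] A mA.
  by rewrite big_ord0 /= diracE mem_set// => -[].
have mB : measurable [set x : 'rV[R]_n | forall i, A (lift ord0 i) (x 0 i)].
  rewrite (_ : mkset _ = \bigcap_(i in [set: 'I_n])
      ((fun x : 'rV[R]_n => x 0 i) @^-1` A (lift ord0 i))).
    apply: fin_bigcap_measurable => // i _.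
    by rewrite -[X in measurable X]setTI; exact: measurable_coord.
  by apply/seteqP; split => [x xA i _|x xA i]; exact: xA.
rewrite big_ord_recl -IHn//= /lebesgue_cons /pushforward.
rewrite -[RHS](product_measure1E lebesgue_measure (lebesgue_row n) (mA ord0) mB).
congr (product_measure1 _ _ _); apply/seteqP; split => -[a x] /=.
  move=> Aax; split; first by have := Aax ord0; rewrite mxE unlift_none.
  by move=> i; have := Aax (lift ord0 i); rewrite mxE liftK.
case=> Aa Ax i; rewrite mxE; case: unliftP => [j|] -> //; exact: Ax.
Qed.

End lebesgue_row.

Section probability.
Context {R : realType} dO (O : measurableType dO) (P : probability O R).

Definition mutually_independent dT (T : measurableType dT)
    (X : nat -> {RV P >-> T}) :=
  forall s : seq nat, uniq s ->
  forall A : nat -> set T, (forall i, measurable (A i)) ->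
  P (\bigcap_(i in [set` s]) (X i @^-1` A i)) =
  (\prod_(i <- s) P (X i @^-1` A i))%E.

Definition identically_distributed dT (T : measurableType dT)
    (X : nat -> {RV P >-> T}) :=
  forall i A, measurable A -> distribution P (X i) A = distribution P (X 0%N) A.

Definition iid dT (T : measurableType dT) (X : nat -> {RV P >-> T}) :=
  mutually_independent X /\ identically_distributed X.

Definition sigma_of_seq dT (T : measurableType dT) (X : nat -> {RV P >-> T}) :
    set (set O) :=
  <<s \bigcup_i preimage_set_system [set: O] (X i) measurable >>.

Definition independent_seqs d1 (T1 : measurableType d1)
    d2 (T2 : measurableType d2)
    (X : nat -> {RV P >-> T1}) (Y : nat -> {RV P >-> T2}) :=
  forall A B, sigma_of_seq X A -> sigma_of_seq Y B ->
  P (A `&` B) = (P A * P B)%E.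

Variable d : nat.

Definition has_density (X : {RV P >-> 'rV[R]_d}) (f : 'rV[R]_d -> R) :=
  [/\ measurable_fun [set: 'rV[R]_d] f,
      forall x, 0 <= f x &
      forall A, measurable A ->
        distribution P X A = (\int[lebesgue_row d]_(x in A) (f x)%:E)%E].

(* g (X) = E[Y | X], written for the residual Y - g (X) so that neither Y nor
   g (X) needs to be integrable. *)
Definition regression_function (X : {RV P >-> 'rV[R]_d}) (Y : O -> R)
    (g : 'rV[R]_d -> R) :=
  P.-integrable [set: O] (EFin \o (fun w => Y w - g (X w))) /\
  forall B, measurable B -> \int[P]_(w in X @^-1` B) (Y w - g (X w)) = 0.

Definition square_integrable (W : O -> 'rV[R]_d) :=
  forall k, measurable_fun [set: O] (fun w => W w 0 k) /\
    P.-integrable [set: O] (EFin \o (fun w => (W w 0 k) ^+ 2)).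

Definition covariance_mx (W : O -> 'rV[R]_d) : 'M[R]_d :=
  \matrix_(k, l) fine (covariance P (fun w => W w 0 k) (fun w => W w 0 l)).

(* The library's normal_prob m s has standard deviation s and is not meant for
   s = 0; the normal law of variance 0 is the Dirac mass. *)
Definition normal1 (m v : R) (A : set R) : \bar R :=
  if v == 0 then \d_m A else normal_prob m (Num.sqrt v) A.

(* N(m, v) on R^d, v possibly singular: every linear functional u has law
   N(u m, u v u^T). *)
Definition is_normal (N : probability 'rV[R]_d R) (m : 'rV[R]_d)
    (v : 'M[R]_d) :=
  forall (u : 'rV[R]_d) A, measurable A ->
  N [set x : 'rV[R]_d | A ((u *m x^T) 0 0)] =
  normal1 ((u *m m^T) 0 0) ((u *m v *m u^T) 0 0) A.

Definition cvg_in_distribution (Z : nat -> O -> 'rV[R]_d)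
    (N : probability 'rV[R]_d R) :=
  (forall n, measurable_fun [set: O] (Z n)) /\
  forall phi : 'rV[R]_d -> R, continuous phi -> bounded_fun phi ->
  (fun n => \int[P]_w phi (Z n w)) @ \oo --> \int[N]_x phi x.

End probability.

Section calculus.
Context {R : realType} (d : nat).

Definition partial (i : 'I_d) (f : 'rV[R]_d -> R) : 'rV[R]_d -> R :=
  fun x => 'D_(delta_mx 0 i) f x.

Definition gradient (f : 'rV[R]_d -> R) : 'rV[R]_d -> 'rV[R]_d :=
  fun x => \row_i partial i f x.

Definition iter_partial (s : seq 'I_d) (f : 'rV[R]_d -> R) :=
  foldr partial f s.

Definition bounded_order_derivatives (r : nat) (f : 'rV[R]_d -> R) :=
  (forall (s : seq 'I_d) i x, (size s < r)%N ->
     derivable (iter_partial s f) x (delta_mx 0 i)) /\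
  (forall s : seq 'I_d, size s = r -> bounded_fun (iter_partial s f)).

Definition hoelder_on (V W : normedModType R) (F : V -> W) (Q : set V) :=
  exists alpha C : R, [/\ 0 < alpha, alpha <= 1 &
    forall x y, Q x -> Q y -> `|F x - F y| <= C * `|x - y| `^ alpha].

Definition monomial (m : 'I_d -> nat) (x : 'rV[R]_d) : R :=
  \prod_i x 0 i ^+ m i.

Definition kernel_order (r : nat) (K : 'rV[R]_d -> R) :=
  [/\ (lebesgue_row d).-integrable setT (EFin \o K),
      \int[lebesgue_row d]_x K x = 1 &
      forall m : 'I_d -> nat, (0 < \sum_i m i <= r)%N ->
        (lebesgue_row d).-integrable setT
          (EFin \o (fun x => monomial m x * K x)) /\
        \int[lebesgue_row d]_x (monomial m x * K x) = 0].

(* Minimality of p and uniqueness of the index space: the column space of beta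
   is the row space of beta^T. *)
Definition multiple_index (g : 'rV[R]_d -> R) (p : nat)
    (g0 : 'rV[R]_p -> R) (beta : 'M[R]_(d, p)) :=
  [/\ forall x, g x = g0 (x *m beta),
      forall q (g1 : 'rV[R]_q -> R) (b : 'M[R]_(d, q)),
        (forall x, g x = g1 (x *m b)) -> (p <= q)%N &
      forall (g1 : 'rV[R]_p -> R) (b : 'M[R]_(d, p)),
        (forall x, g x = g1 (x *m b)) -> (b^T == beta^T)%MS].

End calculus.

Section estimator.
Context {R : realType} (d : nat) (T : Type).
Variables (X : nat -> T -> 'rV[R]_d) (Y : nat -> T -> R).
Variables (K : 'rV[R]_d -> R) (h : nat -> R) (psi : 'rV[R]_d -> R).

(* The sample (X_1, Y_1), ..., (X_n, Y_n) is indexed by 0, ..., n-1. *)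
Definition loo_kde (n : nat) (i : 'I_n) (x : 'rV[R]_d) (w : T) : R :=
  (n%:R * h n ^+ d)^-1 *
  \sum_(j < n | j != i) K ((h n)^-1 *: (X j w - x)).

(* Division by zero yields 0. *)
Definition beta_hat (n : nat) (w : T) : 'rV[R]_d :=
  n%:R^-1 *: \sum_(i < n)
    (Y i w / loo_kde i (X i w) w) *: gradient psi (X i w).

Definition beta_of (g : 'rV[R]_d -> R) : 'rV[R]_d :=
  \row_k \int[lebesgue_row d]_x (g x * gradient psi x 0 k).

End estimator.

(* Main.v *)
(* Write m_i for the leave-one-out estimate at X_i, psi_k for the k-th partial
   derivative of psi and q = g psi_k / f, which is continuous on R^d because Q
   is convex and psi_k vanishes on its boundary.  Expanding 1 / m_i around f,

     g psi_k / m_i = 2 q - (q / f) m_i + (q / f) (m_i - f)^2 / m_i    at X_i,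

   the average of the first two terms is a U-statistic.  Its degenerate part is
   negligible since n h^d tends to infinity, and its linear part differs from
   the integral of g psi_k by o(n^(-1/2)) because the kernel has order r and the
   X-dependence cancels to first order: 2 q - q - q.  The quadratic term is
   negligible since n^(1/2) h^d tends to infinity, a fourth moment bound making
   the m_i uniformly close to f.  What remains is the average of the centered
   variables sigma(X_i) e_i psi_k(X_i) / f(X_i), plus a noise term weighted by
   1 / m_i - 1 / f, whose conditional variance given X tends to 0.

   The multivariate central limit theorem is proved with characteristic
   functions; their convergence yields weak convergence by Gaussian smoothing
   of bounded Lipschitz functions, general continuous functions being reached
   from below by inf-convolution. *)

Require Import Defs.
From HB Require Import structures.
From mathcomp Require Import all_boot all_order all_algebra.
From mathcomp Require Import all_classical all_reals all_analysis.
From mathcomp Require Import measurable_realfun ring lra.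

Set Implicit Arguments.
Unset Strict Implicit.
Unset Printing Implicit Defensive.

Import Order.TTheory GRing.Theory Num.Theory.
Import numFieldNormedType.Exports.

Local Open Scope classical_set_scope.
Local Open Scope ring_scope.

(** * Bounded measurable functions *)

Section bounded_measurable.
Context {R : realType} d (T : measurableType d).

(** The density, the kernel, [sigma] and, on [Q], [g] are bounded, but neither [e] nor [1 / m_i] is.
    Most expectations are therefore taken of bounded measurable functions ([bmf]), for which Fubini
    and linearity have no side condition, and the two exceptions are treated apart. The inverse
    [1 / m_i] may have no moment, so it is handled on the event where every [m_i] is within [b / 2]
    of [f], and errors vanish in probability only. That event involves [n] points at once: second
    moments, of order [1 / (n h^d)], would add up to [h^(-d)], whereas fourth moments, of order
    [1 / (n h^d)^2], add up to [1 / (n^(1/2) h^d)^2], which the bandwidth condition sends to 0. As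
    for [e], only its products in [W] are square integrable: either the weights of [e] vanish almost
    surely, and the noise with them, or [e] itself is square integrable and centered. Independence
    is expressed on the sample space, with one sub-sigma-algebra per set of indices: the integral of
    [F w w] becomes an iterated integral of [F w w'], which plays the role of conditioning. *)

Definition bmf (f : T -> R) :=
  measurable_fun [set: T] f /\ exists M, forall x, `|f x| <= M.

Lemma bmf_cst a : bmf (cst a).
Proof. by split => //; exists `|a|. Qed.

Lemma bmfD f g : bmf f -> bmf g -> bmf (fun x => f x + g x).
Proof.
move=> [mf [M fM]] [mg [N gN]]; split; first exact: measurable_funD.
by exists (M + N) => x; rewrite (le_trans (ler_normD _ _))// lerD.
Qed.

Lemma bmfN f : bmf f -> bmf (fun x => - f x).
Proof.
move=> [mf [M fM]]; split; first exact: measurableT_comp.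
by exists M => x; rewrite normrN.
Qed.

Lemma bmfB f g : bmf f -> bmf g -> bmf (fun x => f x - g x).
Proof. by move=> bf bg; apply: bmfD => //; exact: bmfN. Qed.

Lemma bmfM f g : bmf f -> bmf g -> bmf (fun x => f x * g x).
Proof.
move=> [mf [M fM]] [mg [N gN]]; split; first exact: measurable_funM.
by exists (M * N) => x; rewrite normrM ler_pM.
Qed.

Lemma bmfX f k : bmf f -> bmf (fun x => f x ^+ k).
Proof.
move=> bf; elim: k => [|k IH]; first exact: (bmf_cst 1).
by under eq_fun do rewrite exprS; exact: bmfM.
Qed.

Lemma bmf_sum (I : Type) (s : seq I) (Q : pred I) (F : I -> T -> R) :
  (forall i, bmf (F i)) -> bmf (fun x => \sum_(i <- s | Q i) F i x).
Proof.
move=> bF; elim: s => [|i s IH].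
  by under eq_fun do rewrite big_nil; exact: bmf_cst.
under eq_fun do rewrite big_cons.
by case: (Q i) => //; exact: bmfD.
Qed.

Lemma bmf_le (f g : T -> R) : measurable_fun setT f ->
  bmf g -> (forall x, `|f x| <= `|g x|) -> bmf f.
Proof.
by move=> mf [_ [M gM]] fg; split => //; exists M => x; exact: le_trans (gM x).
Qed.

End bounded_measurable.

Section precomposition.
Context {R : realType} d1 d2 (T1 : measurableType d1) (T2 : measurableType d2).

Lemma bmf_precomp (f : T2 -> R) (g : T1 -> T2) :
  bmf f -> measurable_fun setT g -> bmf (fun x => f (g x)).
Proof.
move=> [mf [M fM]] mg; split; last by exists M.
exact: (measurableT_comp mf mg).
Qed.

End precomposition.

Section bounded_sections.
Context {R : realType} d1 d2 (T1 : measurableType d1) (T2 : measurableType d2).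

Lemma bmf_pair1 (F : T1 * T2 -> R) x : bmf F -> bmf (fun y => F (x, y)).
Proof. by move=> bF; exact: (bmf_precomp bF (pair1_measurable x)). Qed.

Lemma bmf_pair2 (F : T1 * T2 -> R) y : bmf F -> bmf (fun x => F (x, y)).
Proof. by move=> bF; exact: (bmf_precomp bF (pair2_measurable y)). Qed.

End bounded_sections.

Lemma bmf_integrable_fin {R : realType} d (T : measurableType d)
    (mu : {measure set T -> \bar R}) (f : T -> R) :
  (mu setT < +oo)%E -> bmf f -> mu.-integrable setT (EFin \o f).
Proof.
move=> muT [mf [M fM]]; apply: measurable_bounded_integrable => //.
exists `|M|; split => // N MN x _ /=; rewrite (le_trans (fM x))//.
by rewrite (le_trans (ler_norm _))// ltW.
Qed.

Section bounded_expectation.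
Context {R : realType} d (T : measurableType d) (P : probability T R).

Lemma bmf_integrable (f : T -> R) : bmf f -> P.-integrable setT (EFin \o f).
Proof.
apply: bmf_integrable_fin.
by rewrite (le_lt_trans (probability_le1 P measurableT))// ltry.
Qed.

Lemma expect_cst (a : R) : \int[P]_x a = a.
Proof. by rewrite Rintegral_cst//= (@probability_setT _ _ _ P) mulr1. Qed.

Lemma expectD (f g : T -> R) : bmf f -> bmf g ->
  \int[P]_x (f x + g x) = \int[P]_x f x + \int[P]_x g x.
Proof. by move=> bf bg; rewrite RintegralD//; exact: bmf_integrable. Qed.

Lemma expectB (f g : T -> R) : bmf f -> bmf g ->
  \int[P]_x (f x - g x) = \int[P]_x f x - \int[P]_x g x.
Proof. by move=> bf bg; rewrite RintegralB//; exact: bmf_integrable. Qed.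

Lemma expectZ a (f : T -> R) : bmf f ->
  \int[P]_x (a * f x) = a * \int[P]_x f x.
Proof. by move=> bf; rewrite RintegralZl//; exact: bmf_integrable. Qed.

Lemma expect_sum (I : Type) (s : seq I) (Q : pred I) (F : I -> T -> R) :
  (forall i, bmf (F i)) ->
  \int[P]_x (\sum_(i <- s | Q i) F i x) = \sum_(i <- s | Q i) \int[P]_x F i x.
Proof.
move=> bF; elim: s => [|i s IH].
  by rewrite big_nil; under eq_Rintegral do rewrite big_nil; exact: expect_cst.
rewrite big_cons; under eq_Rintegral do rewrite big_cons.
case: ifP => _ //; rewrite expectD ?IH//; exact: bmf_sum.
Qed.

Lemma expect_le (f g : T -> R) : bmf f -> bmf g -> (forall x, f x <= g x) ->
  \int[P]_x f x <= \int[P]_x g x.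
Proof.
by move=> bf bg fg; apply: le_Rintegral => //; exact: bmf_integrable.
Qed.

Lemma expect_norm_le (f g : T -> R) : bmf f -> bmf g ->
  (forall x, `|f x| <= g x) -> `|\int[P]_x f x| <= \int[P]_x g x.
Proof.
move=> bf bg fg; apply: le_trans (le_normr_Rintegral _ (bmf_integrable bf)) _ => //.
apply: expect_le => //; case: bf => mf [M fM]; split.
  exact: measurableT_comp.
by exists M => x; rewrite normr_id.
Qed.

Lemma expect_normE (f : T -> R) M : measurable_fun setT f ->
  (forall x, `|f x| <= M) -> `|\int[P]_x f x| <= M.
Proof.
move=> mf fM; rewrite -[leRHS](expect_cst M); apply: expect_norm_le => //.
  by split => //; exists M.
exact: bmf_cst.
Qed.

End bounded_expectation.

Lemma EFin_Rintegral {R : realType} d (T : measurableType d)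
    (mu : {measure set T -> \bar R}) (k : T -> R) :
  mu.-integrable setT (EFin \o k) ->
  (\int[mu]_x (k x)%:E)%E = (\int[mu]_x k x)%:E.
Proof. by move=> ik; rewrite /Rintegral fineK// integrable_fin_num. Qed.

Lemma integrableM_bmf {R : realType} d (T : measurableType d)
    (mu : {measure set T -> \bar R}) (u k : T -> R) :
  mu.-integrable setT (EFin \o u) -> bmf k ->
  mu.-integrable setT (EFin \o (fun x => u x * k x)).
Proof.
move=> iu [mk [M kM]]; have /integrableP[/measurable_EFinP mu' _] := iu.
apply: (le_integrable _ _ _ (integrableZl measurableT M iu)) => //.
  by apply/measurable_EFinP; exact: measurable_funM.
move=> x _; rewrite lee_fin normrM normrM mulrC; apply: ler_wpM2r => //.
by rewrite (le_trans (kM x))// ler_norm.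
Qed.

Lemma integrable_of_sqr {R : realType} d (T : measurableType d)
    (P : probability T R) (W : T -> R) : measurable_fun setT W ->
  P.-integrable setT (EFin \o (fun w => W w ^+ 2)) ->
  P.-integrable setT (EFin \o W).
Proof.
move=> mW iW2.
have i1 : P.-integrable setT (EFin \o (fun w => 1 + W w ^+ 2)).
  exact: (integrableD measurableT (bmf_integrable P (bmf_cst _ 1)) iW2).
apply: le_integrable i1 => //; first exact/measurable_EFinP.
move=> w _ /=; rewrite lee_fin [leRHS]ger0_norm; last by rewrite addr_ge0// sqr_ge0.
rewrite -[W w ^+ 2]real_normK ?num_real//.
have : 0 <= (`|W w| - 1) ^+ 2 by exact: sqr_ge0.
by have := normr_ge0 (W w); nra.
Qed.

(** * Independence and moments of sums *)

Section independent_families.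
Context {R : realType} dO (O : measurableType dO) (P : probability O R).

Definition indep_systems (G1 G2 : set (set O)) :=
  forall A B, G1 A -> G2 B -> P (A `&` B) = (P A * P B)%E.

Lemma indep_systems_sym G1 G2 : indep_systems G1 G2 -> indep_systems G2 G1.
Proof. by move=> G12 A B GA GB; rewrite setIC muleC G12. Qed.

(** Dynkin's argument: for fixed [B], the sets [A] with the product formula form a lambda-system
    containing the pi-system [G1]. Applied twice, with the roles exchanged, it gives the two-sided
    version. *)
Lemma indep_systems_sigmal (G1 G2 : set (set O)) : setI_closed G1 ->
  G1 `<=` measurable -> G2 `<=` measurable ->
  indep_systems G1 G2 -> indep_systems <<s G1 >> G2.
Proof.
move=> IG1 mG1 mG2 G12 A B sA GB.
have mB := mG2 _ GB.
have mG1' : <<s G1 >> `<=` @measurable _ O.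
  exact: smallest_sub (@sigma_algebra_measurable _ O) mG1.
pose T := g_sigma_algebraType G1.
apply: (@dynkin_induction _ T G1
  (fun A => P (A `&` B) = (P A * P B)%E)) A sA => //.
- by rewrite setTI probability_setT mul1e.
- by move=> A GA; exact: G12.
- move=> S mS PS; have mS' : measurable (S : set O) by exact: mG1'.
  rewrite probability_setC// muleBl ?fin_num_measure//.
  rewrite mul1e -PS setIC -setDE measureD//; last 1 first.
    by rewrite (le_lt_trans (probability_le1 P mB))// ltry.
  by rewrite (setIC B).
- move=> F mF tF PF; have mF' n : measurable (F n : set O) by apply: mG1'; exact: mF.
  rewrite setI_bigcupl.
  rewrite measure_bigcup//; last first.
    by apply/trivIsetP => i j _ _ ij; rewrite setIACA; move/trivIsetP : tF => ->//;
      rewrite set0I.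
    by move=> i _; exact: measurableI.
  have -> : P (\bigcup_k F k) = (\sum_(0 <= k <oo | k \in setT) P (F k))%E.
    by rewrite measure_bigcup.
  rewrite muleC -(fineK (fin_num_measure P _ mB)) -nneseriesZl//.
  by apply: eq_eseriesr => n _; apply: etrans (PF n) _; rewrite muleC fineK// fin_num_measure.
Qed.

Lemma indep_systems_sigma (G1 G2 : set (set O)) :
  setI_closed G1 -> setI_closed G2 ->
  G1 `<=` measurable -> G2 `<=` measurable ->
  indep_systems G1 G2 -> indep_systems <<s G1 >> <<s G2 >>.
Proof.
move=> I1 I2 m1 m2 G12; apply: indep_systems_sigmal => //.
  exact: smallest_sub (@sigma_algebra_measurable _ O) m2.
by apply/indep_systems_sym/indep_systems_sigmal => //; exact/indep_systems_sym.
Qed.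

Variables (I : choiceType) (xi : I -> set (set O)).

Definition indep_family := forall s : seq I, uniq s ->
  forall A : I -> set O, (forall i, xi i (A i)) ->
  P (\bigcap_(i in [set` s]) A i) = (\prod_(i <- s) P (A i))%E.

Definition family_sigma (J : set I) := <<s \bigcup_(i in J) xi i >>.

(** A union of pi-systems is not a pi-system; these finite intersections form one, with the same
    generated sigma-algebra. *)
Definition family_cylinder (J : set I) : set (set O) :=
  [set C | exists s : seq I, exists A : I -> set O,
    [/\ uniq s, [set` s] `<=` J, forall i, xi i (A i) &
        C = \bigcap_(i in [set` s]) A i]].

Hypotheses (xiT : forall i, xi i setT) (xiI : forall i, setI_closed (xi i))
  (mxi : forall i, xi i `<=` measurable).

Lemma family_cylinder_measurable J : family_cylinder J `<=` measurable.
Proof.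
by move=> _ [s [A [us sJ xA ->]]]; apply: fin_bigcap_measurable => // i _; exact: mxi.
Qed.

Lemma family_cylinderI J : setI_closed (family_cylinder J).
Proof.
move=> _ _ [s [A [us sJ xA ->]]] [t [B [ut tJ xB ->]]].
exists (undup (s ++ t)).
exists (fun i => (if i \in s then A i else setT) `&`
                 (if i \in t then B i else setT)); split.
- exact: undup_uniq.
- move=> i /=; rewrite mem_undup mem_cat => /orP[si|ti]; [exact: sJ|exact: tJ].
- by move=> i; apply: xiI; case: ifP.
apply/seteqP; split => [x [sx tx] i _|x stx] /=.
  by split; case: ifP => // ?; [exact: sx|exact: tx].
split=> i /= ii; have := stx i; rewrite /= mem_undup mem_cat ii ?orbT.
  by case=> //.
by case=> //.
Qed.

Lemma family_sigmaE J : family_sigma J = <<s family_cylinder J >>.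
Proof.
apply/seteqP; split.
  apply: sub_sigma_algebra2 => A [i Ji xA]; exists [:: i].
  exists (fun j => if j == i then A else setT); split => //.
  - by move=> j /=; rewrite inE => /eqP ->.
  - by move=> j; case: eqP => // ->.
  apply/seteqP; split => [x Ax j /=|x /(_ i)/=].
    by rewrite inE => /eqP ->; rewrite eqxx.
  by rewrite inE eqxx; exact.
apply: smallest_sub; first exact: smallest_sigma_algebra.
move=> _ [s [A [us sJ xA ->]]].
have := @fin_bigcap_measurable _ (g_sigma_algebraType (\bigcup_(i in J) xi i)) _
  [set` s] A.
by apply => // i /= si; apply: sub_sigma_algebra; exists i => //; exact: sJ.
Qed.

Lemma family_sigma_measurable J : family_sigma J `<=` measurable.
Proof.
apply: smallest_sub; first exact: sigma_algebra_measurable.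
by move=> A [i _]; exact: mxi.
Qed.

(** Grouping of independent variables. Two cylinders over disjoint index sets intersect in a
    cylinder over the concatenated list, where the product formula is that of the family; the
    passage to sigma-algebras is the pi-lambda argument. *)
Theorem indep_family_sigma J1 J2 : indep_family -> J1 `&` J2 = set0 ->
  indep_systems (family_sigma J1) (family_sigma J2).
Proof.
move=> hxi J12; rewrite !family_sigmaE; apply: indep_systems_sigma.
- exact: family_cylinderI.
- exact: family_cylinderI.
- exact: family_cylinder_measurable.
- exact: family_cylinder_measurable.
move=> _ _ [s [A [us sJ xA ->]]] [t [B [ut tJ xB ->]]].
(* The index lists being disjoint, a single family agrees with [A] on [s] and with [B] on [t]. *)
pose C i := if i \in s then A i else B i.
have st i : i \in s -> i \in t = false.
  move=> si; apply/negP => ti; suff : (J1 `&` J2) i by rewrite J12.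
  by split; [exact: sJ|exact: tJ].
have -> : \bigcap_(i in [set` s]) A i = \bigcap_(i in [set` s]) C i.
  by apply: eq_bigcapr => i /= si; rewrite /C si.
have -> : \bigcap_(i in [set` t]) B i = \bigcap_(i in [set` t]) C i.
  apply: eq_bigcapr => i /= ti; rewrite /C; case: ifPn => // /st.
  by rewrite ti.
have xC i : xi i (C i) by rewrite /C; case: ifP.
rewrite -bigcap_setU.
have -> : [set` s] `|` [set` t] = [set` s ++ t].
  apply/seteqP; split => i /=; rewrite mem_cat.
    by case=> ->; rewrite ?orbT.
  by case/orP; [left|right].
rewrite hxi//; last first.
  rewrite cat_uniq us ut andbT /=; apply/hasPn => i ti; apply/negP => /st.
  by rewrite ti.
by rewrite big_cat/= !hxi.
Qed.

End independent_families.

Lemma product_probability_lty {R : realType} d1 d2 (T1 : measurableType d1)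
    (T2 : measurableType d2) (P1 : probability T1 R) (P2 : probability T2 R) :
  ((P1 \x P2)%E setT < +oo)%E.
Proof.
rewrite -setXTT; apply: (@le_lt_trans _ _ (P1 setT * P2 setT)%E).
  by rewrite product_measure1E.
by rewrite !probability_setT mul1e ltry.
Qed.

Lemma bmf_integral {R : realType} d1 d2 (T1 : measurableType d1)
    (T2 : measurableType d2) (P2 : probability T2 R) (F : T1 * T2 -> R) :
  bmf F -> bmf (fun x => \int[P2]_y F (x, y)).
Proof.
move=> bF; have [mF [M FM]] := bF.
have bFx x : bmf (fun y => F (x, y)) by exact: bmf_pair1.
split; last first.
  by exists M => x; apply: expect_normE => [|w']; [case: (bFx x)|exact: FM].
(* The Dirac mass is an arbitrary choice: some finite measure on the first factor is needed to quote
   the measurability part of Fubini. *)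
have iF : (\d_(point : T1) \x P2)%E.-integrable setT (EFin \o F).
  exact: bmf_integrable_fin (product_probability_lty _ _) bF.
apply/measurable_EFinP.
rewrite (_ : _ \o _ = fubini_F P2 (EFin \o F)).
  exact: measurable_fubini_F iF.
apply/funext => x /=; rewrite /fubini_F /Rintegral fineK//.
by apply: integrable_fin_num => //; exact: bmf_integrable.
Qed.

Lemma bmf_expect {R : realType} dO d1 d2 (O : measurableType dO)
    (P : probability O R) (T1 : measurableType d1) (T2 : measurableType d2)
    (eta : O -> T2) (F : T1 * T2 -> R) :
  measurable_fun setT eta -> bmf F -> bmf (fun x => \int[P]_w F (x, eta w)).
Proof.
move=> meta bF; apply: (bmf_integral P (F := fun z : T1 * O => F (z.1, eta z.2))).
apply: (bmf_precomp bF); apply: measurable_fun_pair => //.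
exact: (measurableT_comp meta).
Qed.

Section independent_expectation.
Context {R : realType} dO (O : measurableType dO) (P : probability O R).
Context d1 d2 (T1 : measurableType d1) (T2 : measurableType d2).
Variables (xi : {mfun O >-> T1}) (eta : {mfun O >-> T2}).
Hypothesis indep : forall A B, measurable A -> measurable B ->
  P (xi @^-1` A `&` eta @^-1` B) = (P (xi @^-1` A) * P (eta @^-1` B))%E.

Let pr (w : O) := (xi w, eta w).

Let mpr : measurable_fun setT pr.
Proof. by apply: measurable_fun_pair. Qed.

HB.instance Definition _ := isMeasurableFun.Build _ _ _ _ pr mpr.

Let pushE A : measurable A -> (distribution P xi \x distribution P eta)%E A =
  pushforward P pr A.
Proof.
by apply: product_measure_unique => B C mB mC; rewrite -indep.
Qed.

Let prT : ((distribution P xi \x distribution P eta)%E setT < +oo)%E.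
Proof. exact: product_probability_lty. Qed.

Lemma indep_integral_ge0 (F : T1 * T2 -> \bar R) : measurable_fun setT F ->
  (forall z, 0 <= F z)%E ->
  (\int[P]_w F (xi w, eta w) = \int[P]_w \int[P]_w' F (xi w, eta w'))%E.
Proof.
move=> mF F0.
transitivity (\int[pushforward P pr]_z F z)%E.
  by rewrite ge0_integral_pushforward// preimage_setT.
transitivity (\int[distribution P xi \x distribution P eta]_z F z)%E.
  by apply: eq_measure_integral => A mA _; exact/esym/pushE.
rewrite fubini_tonelli1// ge0_integral_distribution//; last 2 first.
  exact: measurable_fun_fubini_tonelli_F.
  by move=> x; exact: integral_ge0.
apply: eq_integral => w _ /=; rewrite /fubini_F ge0_integral_distribution//.
exact: measurableT_comp mF (pair1_measurable _).
Qed.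

(** Independence says that the law of the pair is the product of the two laws; Fubini applies there,
    and both integrals are pulled back to the sample space. *)
Lemma indep_expect (F : T1 * T2 -> R) : bmf F ->
  \int[P]_w F (xi w, eta w) = \int[P]_w \int[P]_w' F (xi w, eta w').
Proof.
move=> bF; have [mF _] := bF.
have mF' : measurable_fun setT (EFin \o F) by exact/measurable_EFinP.
congr fine.
have bpr : bmf (F \o pr) by apply: bmf_precomp.
transitivity (\int[pushforward P pr]_z (F z)%:E)%E.
  rewrite integral_pushforward//=; exact: (bmf_integrable _ bpr).
transitivity (\int[distribution P xi \x distribution P eta]_z (F z)%:E)%E.
  by apply: eq_measure_integral => A mA _; exact/esym/pushE.
have iF : (distribution P xi \x distribution P eta)%E.-integrable setT (EFin \o F).
  exact: bmf_integrable_fin prT bF.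
rewrite -integral12_prod_meas1//.
have bFx x : bmf (fun y => F (x, y)) by exact: bmf_pair1.
have E x : (\int[distribution P eta]_y (F (x, y))%:E =
   (\int[P]_w F (x, eta w))%:E)%E.
  have bx : bmf (fun w => F (x, eta w)) by apply: (bmf_precomp (bFx x)).
  rewrite integral_distribution//; last 2 first.
    by apply/measurable_EFinP; case: (bFx x).
    exact: (bmf_integrable _ bx).
  rewrite /Rintegral fineK//; apply: integrable_fin_num => //.
  exact: (bmf_integrable _ bx).
rewrite integral_distribution//; last 2 first.
- exact: (measurable_fubini_F iF).
- rewrite (_ : _ \o _ = EFin \o (fun w => \int[P]_w' F (xi w, eta w'))); last first.
    by apply/funext => w /=; rewrite /fubini_F E.
  apply: bmf_integrable; split.
    apply/measurable_EFinP.
    rewrite (_ : _ \o _ = (fubini_F (distribution P eta) (EFin \o F)) \o xi); last first.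
      by apply/funext => w /=; rewrite /fubini_F E.
    by apply: measurableT_comp => //; exact: measurable_fubini_F iF.
  have [_ [M FM]] := bF; exists M => w.
  apply: expect_normE => [|w']; last exact: FM.
  have [+ _] := bFx (xi w) => m; exact: (measurableT_comp m).
by apply: eq_integral => w _ /=; rewrite /fubini_F E.
Qed.

Lemma indep_expectM (f : T1 -> R) (g : T2 -> R) : bmf f -> bmf g ->
  \int[P]_w (f (xi w) * g (eta w)) =
  \int[P]_w f (xi w) * \int[P]_w g (eta w).
Proof.
move=> bf bg.
rewrite (indep_expect (F := fun z => f z.1 * g z.2)); last first.
  by apply: bmfM; [exact: (bmf_precomp bf)|exact: (bmf_precomp bg)].
transitivity (\int[P]_w (f (xi w) * \int[P]_w' g (eta w'))).
  by apply: eq_Rintegral => w _ /=; rewrite expectZ//; exact: (bmf_precomp bg).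
rewrite RintegralZr//; apply: bmf_integrable; exact: (bmf_precomp bf).
Qed.

End independent_expectation.

Section two_samples.
Context {R : realType} dO (O : measurableType dO) (P : probability O R).
Context d1 d2 (T1 : measurableType d1) (T2 : measurableType d2).
Variables (X : nat -> {RV P >-> T1}) (e : nat -> {RV P >-> T2}).
Hypotheses (hX : iid X) (he : iid e) (hXe : independent_seqs X e).

(* [inl i] is the index of [X i] and [inr i] that of [e i]. *)
Definition sample_system (i : nat + nat) : set (set O) :=
  match i with
  | inl j => preimage_set_system setT (X j) measurable
  | inr j => preimage_set_system setT (e j) measurable
  end.

Let systemT i : sample_system i setT.
Proof. by case: i => j; exists setT => //; rewrite setTI preimage_setT. Qed.

Let systemI i : setI_closed (sample_system i).
Proof.
by case: i => j _ _ [A mA <-] [B mB <-]; exists (A `&` B);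
  rewrite ?setTI ?preimage_setI//; exact: measurableI.
Qed.

Let msystem i : sample_system i `<=` measurable.
Proof. by case: i => j _ [A mA <-]; exact: measurable_funP. Qed.

(** A finite intersection is sorted into its [X] part and its [e] part: independence of the two
    sequences splits these, and independence within each sequence splits them further. *)
Lemma indep_family_sample : indep_family P sample_system.
Proof.
move=> s us A sA.
have /choice[B1 B1P] : forall j, exists B, measurable B /\ A (inl j) = X j @^-1` B.
  by move=> j; have [B mB <-] := sA (inl j); exists B; rewrite setTI.
have /choice[B2 B2P] : forall j, exists B, measurable B /\ A (inr j) = e j @^-1` B.
  by move=> j; have [B mB <-] := sA (inr j); exists B; rewrite setTI.
pose s1 := pmap (fun i : nat + nat => if i is inl j then Some j else None) s.
pose s2 := pmap (fun i : nat + nat => if i is inr j then Some j else None) s.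
have s1E j : (j \in s1) = (inl j \in s).
  rewrite mem_pmap; apply/mapP/idP => [[[k|k] ks//= [->]]//|js].
  by exists (inl j).
have s2E j : (j \in s2) = (inr j \in s).
  rewrite mem_pmap; apply/mapP/idP => [[[k|k] ks//= [->]]//|js].
  by exists (inr j).
have us1 : uniq s1.
  by apply: (pmap_uniq (g := inl)) us => -[].
have us2 : uniq s2.
  by apply: (pmap_uniq (g := inr)) us => -[].
have -> : \bigcap_(i in [set` s]) A i =
  (\bigcap_(j in [set` s1]) X j @^-1` B1 j) `&`
  (\bigcap_(j in [set` s2]) e j @^-1` B2 j).
  apply/seteqP; split => [w Aw|w [w1 w2] [j|j] /= js].
  - split=> j /=; rewrite ?s1E ?s2E => js.
      by have [_ E] := B1P j; have := Aw _ js; rewrite E.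
    by have [_ E] := B2P j; have := Aw _ js; rewrite E.
  - by rewrite (proj2 (B1P j)); apply: w1; rewrite /= s1E.
  - by rewrite (proj2 (B2P j)); apply: w2; rewrite /= s2E.
have sX j B : measurable B -> sigma_of_seq X (X j @^-1` B).
  move=> mB; apply: sub_sigma_algebra; exists j => //; exists B => //.
  by rewrite setTI.
have se j B : measurable B -> sigma_of_seq e (e j @^-1` B).
  move=> mB; apply: sub_sigma_algebra; exists j => //; exists B => //.
  by rewrite setTI.
have mB1 j : measurable (B1 j) by case: (B1P j).
have mB2 j : measurable (B2 j) by case: (B2P j).
rewrite hXe.
- rewrite (proj1 hX)// (proj1 he)// /s1 /s2.
  clear s1E s2E us1 us2 s1 s2; move: {sA us} s; elim=> [|[j|j] s IH]; rewrite ?big_nil ?mule1//= !big_cons -IH.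
    by rewrite -(proj2 (B1P j)) muleA.
  by rewrite -(proj2 (B2P j)) muleCA.
- apply: (@fin_bigcap_measurable _ (g_sigma_algebraType
    (\bigcup_i preimage_set_system setT (X i) measurable)) _ [set` s1]) => // j _.
  exact: sX.
- apply: (@fin_bigcap_measurable _ (g_sigma_algebraType
    (\bigcup_i preimage_set_system setT (e i) measurable)) _ [set` s2]) => // j _.
  exact: se.
Qed.

(* [O] with the sigma-algebra generated by the variables indexed by [J]. *)
Definition subsample (J : set (nat + nat)) :=
  g_sigma_algebraType (\bigcup_(i in J) sample_system i).

(** As a random variable with values in [subsample J], the identity generates that
    sub-sigma-algebra, so that independence of two groups of variables becomes independence of two
    variables. *)
Definition to_subsample J : O -> subsample J := id.

Lemma measurable_to_subsample J : measurable_fun setT (@to_subsample J).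
Proof.
move=> _ A mA; rewrite setTI.
by apply: (family_sigma_measurable msystem (J := J)).
Qed.

HB.instance Definition _ J := isMeasurableFun.Build _ _ _ _
  (@to_subsample J) (@measurable_to_subsample J).

Lemma subsample_X (J : set (nat + nat)) i : J (inl i) ->
  measurable_fun setT (X i : subsample J -> T1).
Proof.
move=> Ji _ A mA; apply: sub_sigma_algebra; exists (inl i) => //.
by exists A.
Qed.

Lemma subsample_e (J : set (nat + nat)) i : J (inr i) ->
  measurable_fun setT (e i : subsample J -> T2).
Proof.
move=> Ji _ A mA; apply: sub_sigma_algebra; exists (inr i) => //.
by exists A.
Qed.

Section disjoint_subsamples.
Variables J1 J2 : set (nat + nat).
Hypothesis J12 : J1 `&` J2 = set0.

Let indep A B : measurable A -> measurable B ->
  P (@to_subsample J1 @^-1` A `&` @to_subsample J2 @^-1` B) =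
  (P (@to_subsample J1 @^-1` A) * P (@to_subsample J2 @^-1` B))%E.
Proof.
move=> mA mB.
exact: (indep_family_sigma systemT systemI msystem indep_family_sample J12).
Qed.

(** Decoupling: each of the two occurrences of the sample point only sees its own group of
    variables, so the second one may be redrawn independently. *)
Lemma subsample_expect (F : O -> O -> R) :
  bmf (fun z : subsample J1 * subsample J2 => F z.1 z.2) ->
  \int[P]_w F w w = \int[P]_w \int[P]_w' F w w'.
Proof. by move=> bF; exact: (indep_expect indep bF). Qed.

Lemma subsample_expectM (U V : O -> R) :
  bmf (U : subsample J1 -> R) -> bmf (V : subsample J2 -> R) ->
  \int[P]_w (U w * V w) = \int[P]_w U w * \int[P]_w V w.
Proof. by move=> bU bV; exact: (indep_expectM indep bU bV). Qed.

Lemma subsample_integral_ge0 (F : O -> O -> \bar R) :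
  measurable_fun setT (fun z : subsample J1 * subsample J2 => F z.1 z.2) ->
  (forall w w', 0 <= F w w')%E ->
  (\int[P]_w F w w = \int[P]_w \int[P]_w' F w w')%E.
Proof.
move=> mF F0; have := indep_integral_ge0 indep mF.
by apply => -[w w']; exact: F0.
Qed.

End disjoint_subsamples.

(** The function [k] may be unbounded or not integrable: both sides are computed from the positive
    and negative parts, whose integrals depend on the law alone. *)
Lemma expect_X i (k : T1 -> R) : measurable_fun setT k ->
  \int[P]_w k (X i w) = \int[P]_w k (X 0%N w).
Proof.
move=> mk.
have mk' : measurable_fun setT (fun x => (k x)%:E) by exact/measurable_EFinP.
have E : (\int[distribution P (X i)]_x (k x)%:E =
          \int[distribution P (X 0%N)]_x (k x)%:E)%E.
  by apply: eq_measure_integral => A mA _; exact: (proj2 hX).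
have ge0 (l : T1 -> \bar R) : measurable_fun setT l -> (forall x, 0 <= l x)%E ->
    (\int[P]_w l (X i w) = \int[P]_w l (X 0%N w))%E.
  move=> ml l0; rewrite -[LHS](@ge0_integral_distribution _ _ _ _ _ P (X i))//.
  rewrite -[RHS](@ge0_integral_distribution _ _ _ _ _ P (X 0%N))//.
  by apply: eq_measure_integral => A mA _; exact: (proj2 hX).
congr fine; rewrite integralE [RHS]integralE.
set F := fun x => (k x)%:E in mk' *.
rewrite -[fun w => (k (X i w))%:E]/(F \o X i) -[fun w => (k (X 0%N w))%:E]/(F \o X 0%N).
rewrite (funepos_comp F (X i)) (funepos_comp F (X 0%N)).
rewrite (funeneg_comp F (X i)) (funeneg_comp F (X 0%N)).
congr (_ - _)%E.
  by apply: (ge0 (funepos F)) => //; exact: measurable_funepos.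
by apply: (ge0 (funeneg F)) => //; exact: measurable_funeneg.
Qed.

End two_samples.

Section iid_moments.
Context {R : realType} dO (O : measurableType dO) (P : probability O R).
Context d1 d2 (T1 : measurableType d1) (T2 : measurableType d2).
Variables (X : nat -> {RV P >-> T1}) (e : nat -> {RV P >-> T2}).
Hypotheses (hX : iid X) (he : iid e) (hXe : independent_seqs X e).

Let SX (J : set nat) := subsample X e [set z | if z is inl j then J j else False].

Let disjX i (J : set nat) : ~ J i ->
  [set z : nat + nat | if z is inl j then [set i] j else False] `&`
  [set z | if z is inl j then J j else False] = set0.
Proof.
by move=> Ji; rewrite -subset0 => -[j|j] []//= ->.
Qed.

Let bmfSX (k : T1 -> R) (J : set nat) i : bmf k -> J i ->
  bmf (fun w : SX J => k (X i w)).
Proof. by move=> bk Ji; apply: bmf_precomp => //; exact: subsample_X. Qed.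

Lemma bmf_rv (k : T1 -> R) i : bmf k -> bmf (fun w => k (X i w)).
Proof. by move=> bk; apply: bmf_precomp. Qed.

Variable k : T1 -> R.
Hypotheses (bk : bmf k) (k0 : \int[P]_w k (X 0%N w) = 0).

Let S (s : seq nat) w := \sum_(j <- s) k (X j w).

Let bS s (J : set nat) : [set` s] `<=` J -> bmf (S s : SX J -> R).
Proof.
elim: s => [|i s IH] sJ.
  rewrite (_ : S [::] = cst 0); first exact: bmf_cst.
  by apply/funext => w; rewrite /S big_nil.
rewrite (_ : S (i :: s) = fun w => k (X i w) + S s w); last first.
  by apply/funext => w; rewrite /S big_cons.
apply: bmfD; first by apply: bmfSX => //; apply: sJ; rewrite /= mem_head.
by apply: IH => j js; apply: sJ; rewrite /= inE [_ \in s]js orbT.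
Qed.

Let bS' s : bmf (S s : O -> R).
Proof. by apply: bmf_sum => i; exact: bmf_rv. Qed.

Let prodE i s a b : i \notin s ->
  \int[P]_w (k (X i w) ^+ a * S s w ^+ b) =
  \int[P]_w (k (X 0%N w) ^+ a) * \int[P]_w (S s w ^+ b).
Proof.
move=> si.
have dis := @disjX i [set` s] (negP si).
rewrite (subsample_expectM hX he hXe dis (U := fun w => k (X i w) ^+ a)
  (V := fun w => S s w ^+ b)); last 2 first.
- by apply: bmfX; exact: bmfSX.
- by apply: bmfX; exact: bS.
congr (_ * _); apply: (expect_X hX i (k := fun x => k x ^+ a)).
by apply: measurable_funX; case: bk.
Qed.

Lemma sum_moment1 s : \int[P]_w S s w = 0.
Proof.
rewrite /S expect_sum => [|i]; last exact: bmf_rv.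
by rewrite big1// => i _; rewrite (expect_X hX)//; case: bk.
Qed.

Lemma sum_moment2 s : uniq s -> \int[P]_w (S s w ^+ 2) =
  (size s)%:R * \int[P]_w (k (X 0%N w) ^+ 2).
Proof.
elim: s => [_|i s IH /= /andP[si us]].
  by rewrite mul0r /S; under eq_Rintegral do rewrite big_nil expr0n/=;
    exact: expect_cst.
have -> : \int[P]_w (S (i :: s) w ^+ 2) =
  \int[P]_w (k (X i w) ^+ 2 * S s w ^+ 0 + 2 * (k (X i w) ^+ 1 * S s w ^+ 1)
    + k (X i w) ^+ 0 * S s w ^+ 2).
  by apply: eq_Rintegral => w _; rewrite {1}/S big_cons -/(S s w); ring.
have bki a b : bmf (fun w => k (X i w) ^+ a * S s w ^+ b).
  by apply: bmfM; [apply: bmfX; exact: bmf_rv|apply: bmfX].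
rewrite expectD//; last by apply: bmfD => //; apply: bmfM => //; exact: bmf_cst.
rewrite expectD//; last by apply: bmfM => //; exact: bmf_cst.
rewrite expectZ// !prodE// IH//.
under [\int[P]_w (S s w ^+ 0)]eq_Rintegral do rewrite expr0.
under [\int[P]_w (k _ ^+ 1)]eq_Rintegral do rewrite expr1.
by rewrite k0 expect_cst -natr1; ring.
Qed.

(** In the binomial expansion for one more summand, the terms with a first power of either factor
    vanish by centering. The remaining cross term [6 m2 (N m2)] is absorbed in passing from
    [3 (N m2)^2] to [3 ((N + 1) m2)^2]. *)
Lemma sum_moment4 s : uniq s -> \int[P]_w (S s w ^+ 4) <=
  (size s)%:R * \int[P]_w (k (X 0%N w) ^+ 4) +
  3 * ((size s)%:R * \int[P]_w (k (X 0%N w) ^+ 2)) ^+ 2.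
Proof.
set m2 := \int[P]_w (k (X 0%N w) ^+ 2); set m4 := \int[P]_w (k (X 0%N w) ^+ 4).
elim: s => [_|i s IH /= /andP[si us]].
  rewrite !mul0r expr0n/= mulr0 addr0 /S.
  by under eq_Rintegral do rewrite big_nil expr0n/=; rewrite expect_cst.
have -> : \int[P]_w (S (i :: s) w ^+ 4) =
  \int[P]_w (k (X i w) ^+ 4 * S s w ^+ 0 + 4 * (k (X i w) ^+ 3 * S s w ^+ 1)
    + 6 * (k (X i w) ^+ 2 * S s w ^+ 2) + 4 * (k (X i w) ^+ 1 * S s w ^+ 3)
    + k (X i w) ^+ 0 * S s w ^+ 4).
  by apply: eq_Rintegral => w _; rewrite {1}/S big_cons -/(S s w); ring.
have bki a b : bmf (fun w => k (X i w) ^+ a * S s w ^+ b).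
  by apply: bmfM; [apply: bmfX; exact: bmf_rv|apply: bmfX].
have bkz c a b : bmf (fun w => c * (k (X i w) ^+ a * S s w ^+ b)).
  by apply: bmfM => //; exact: bmf_cst.
rewrite expectD//; last by do ?[apply: bmfD => //].
rewrite expectD//; last by do ?[apply: bmfD => //].
rewrite expectD//; last by do ?[apply: bmfD => //].
rewrite expectD//.
rewrite !(expectZ _ 4)// (expectZ _ 6)// !prodE//.
under [\int[P]_w (S s w ^+ 0)]eq_Rintegral do rewrite expr0.
under [\int[P]_w (S s w ^+ 1)]eq_Rintegral do rewrite expr1.
under [\int[P]_w (k _ ^+ 1)]eq_Rintegral do rewrite expr1.
rewrite k0 sum_moment1 !expect_cst sum_moment2// -/m2 -/m4.
have m20 : 0 <= m2 by apply: Rintegral_ge0 => w _; exact: sqr_ge0.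
have := IH us; rewrite -natr1.
have : 0 <= m2 ^+ 2 by exact: sqr_ge0.
set N := (size s)%:R : R; set A := \int[P]_w _.
by nra.
Qed.

End iid_moments.

(** * Second moment of a degenerate U-statistic *)

Section degenerate_ustatistic.
Context {R : realType} dO (O : measurableType dO) (P : probability O R).
Context d1 d2 (T1 : measurableType d1) (T2 : measurableType d2).
Variables (X : nat -> {RV P >-> T1}) (e : nat -> {RV P >-> T2}).
Hypotheses (hX : iid X) (he : iid e) (hXe : independent_seqs X e).
Variable s : T1 * T1 -> R.
Hypotheses (bs : bmf s)
  (s1 : forall x, \int[P]_w s (x, X 0%N w) = 0)
  (s2 : forall y, \int[P]_w s (X 0%N w, y) = 0).

Let D n w := \sum_(0 <= i < n) \sum_(0 <= j < i) s (X i w, X j w).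

Let lt_index n : set (nat + nat) := [set z | if z is inl j then (j < n)%N else False].
Let eq_index n : set (nat + nat) := [set z | if z is inl j then j = n else False].

Let disj n : eq_index n `&` lt_index n = set0.
Proof. by rewrite -subset0 => -[j|j] []//= ->; rewrite ltnn. Qed.

Let bsX i j : bmf (fun w => s (X i w, X j w)).
Proof. by apply: bmf_precomp => //; apply: measurable_fun_pair. Qed.

Let bD n : bmf (D n).
Proof. by apply: bmf_sum => i; apply: bmf_sum => j. Qed.

Let bD' n : bmf (D n : subsample X e (lt_index n) -> R).
Proof.
have -> : D n = fun w => \sum_(i < n) \sum_(j < i) s (X i w, X j w).
  by apply/funext => w; rewrite /D big_mkord; apply: eq_bigr => i _; rewrite big_mkord.
apply: bmf_sum => i; apply: bmf_sum => j.
apply: (bmf_precomp (g := fun w : subsample X e (lt_index n) => (X i w, X j w))) => //.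
apply: measurable_fun_pair; apply: subsample_X => //=.
by rewrite (ltn_trans (ltn_ord j)).
Qed.

Let bL n : bmf (fun z : subsample X e (eq_index n) * subsample X e (lt_index n) =>
  \sum_(0 <= j < n) s (X n z.1, X j z.2)).
Proof.
have -> : (fun z => \sum_(0 <= j < n) s (X n z.1, X j z.2)) =
    (fun z : O * O => \sum_(j < n) s (X n z.1, X j z.2)).
  by apply/funext => w; rewrite big_mkord.
apply: bmf_sum => j.
apply: (bmf_precomp (g := fun z : subsample X e (eq_index n) *
  subsample X e (lt_index n) => (X n z.1, X j z.2))) => //.
apply: measurable_fun_pair.
  exact: (measurableT_comp (subsample_X (X := X) (e := e) (J := eq_index n)
    (i := n) erefl) measurable_fst).
exact: (measurableT_comp (subsample_X (X := X) (e := e) (J := lt_index n)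
  (i := j) (ltn_ord j)) measurable_snd).
Qed.

(** A martingale computation: the increment [L n] due to the new point [X n] has mean zero when the
    earlier points are frozen ([s2]), which kills the cross term; when [X n] is frozen it is a sum
    of [n] i.i.d. centered variables ([s1]), of variance proportional to [n]. *)
Lemma degenerate_ustat_moment2 n : \int[P]_w (D n w ^+ 2) <=
  n%:R ^+ 2 * \int[P]_w \int[P]_w' (s (X 0%N w, X 0%N w') ^+ 2).
Proof.
set t := \int[P]_w \int[P]_w' _.
have bs2 : bmf (fun z => s z ^+ 2) by exact: bmfX.
have t0 : 0 <= t.
  by apply: Rintegral_ge0 => w _ /=; apply: Rintegral_ge0 => w' _ /=; exact: sqr_ge0.
suff -> : \int[P]_w (D n w ^+ 2) = (\sum_(0 <= i < n) i%:R) * t.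
  apply: ler_wpM2r => //; rewrite -natr_sum -natrX ler_nat.
  rewrite big_mkord (leq_trans (n := \sum_(i < n) n))//.
    by apply: leq_sum => i _; exact: ltnW.
  by rewrite sum_nat_const card_ord.
pose L n w := \sum_(0 <= j < n) s (X n w, X j w).
have bLO m : bmf (L m) by apply: bmf_sum => j.
elim: n => [|n IH].
  rewrite big_geq// mul0r (_ : (fun w => D 0 w ^+ 2) = cst 0) ?expect_cst//.
  by apply/funext => w; rewrite /D big_geq// expr0n.
have -> : \int[P]_w (D n.+1 w ^+ 2) =
    \int[P]_w (D n w ^+ 2 + 2 * (D n w * L n w) + L n w ^+ 2).
  by apply: eq_Rintegral => w _; rewrite /D big_nat_recr//= -/(D n w) -/(L n w); ring.
have bDL : bmf (fun w => D n w * L n w) by exact: bmfM.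
have b2DL : bmf (fun w => 2 * (D n w * L n w)) by apply: bmfM => //; exact: bmf_cst.
have bD2 : bmf (fun w => D n w ^+ 2) by exact: bmfX.
rewrite expectD//; [|exact: bmfD|exact: bmfX].
rewrite expectD// expectZ// IH.
have -> : \int[P]_w (D n w * L n w) = 0.
  have disj' : lt_index n `&` eq_index n = set0 by rewrite setIC disj.
  pose F w w' := D n w * \sum_(0 <= j < n) s (X n w', X j w).
  rewrite (subsample_expect hX he hXe disj' (F := F)).
    transitivity (\int[P]_w (0 : R)); last by rewrite expect_cst.
    apply: eq_Rintegral => w _; rewrite /F.
    have bsw j : bmf (fun w' => s (X n w', X j w)).
      by apply: bmf_precomp => //; exact: measurable_fun_pair.
    rewrite expectZ; last exact: bmf_sum.
    rewrite expect_sum// big1 ?mulr0// => j _.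
    rewrite (expect_X hX n (k := fun x => s (x, X j w)))//.
    by case: (bmf_pair2 (X j w) bs).
  apply: bmfM.
    exact: (bmf_precomp (bD' n) measurable_fst).
  apply: (bmf_precomp (bL n) (g := fun z => (z.2, z.1))).
  exact: measurable_fun_pair.
have -> : \int[P]_w (L n w ^+ 2) = n%:R * t.
  pose F w w' := (\sum_(0 <= j < n) s (X n w, X j w')) ^+ 2.
  rewrite (subsample_expect hX he hXe (disj n) (F := F)); last first.
    by apply: bmfX; exact: bL.
  pose kappa x := \int[P]_w' (s (x, X 0%N w') ^+ 2).
  have bkappa : bmf kappa by apply: (bmf_expect P (eta := X 0%N) (F := fun z => s z ^+ 2)).
  transitivity (\int[P]_w (n%:R * kappa (X n w))).
    apply: eq_Rintegral => w _; rewrite /F /kappa.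
    rewrite (sum_moment2 hX he hXe (bmf_pair1 (X n w) bs))// ?size_iota ?subn0//.
    exact: iota_uniq.
  rewrite expectZ; last exact: bmf_precomp.
  by rewrite (expect_X hX n (k := kappa))//; case: bkappa.
by rewrite big_nat_recr//=; ring.
Qed.

End degenerate_ustatistic.

(** * Lebesgue measure on row vectors, densities *)

Section row_norm.
Context {R : realType} (d : nat).
Implicit Types x : 'rV[R]_d.

Lemma row_norm_le x (c : R) : 0 <= c -> (forall i, `|x 0 i| <= c) -> `|x| <= c.
Proof.
move=> c0 xc; rewrite -[`|x|]/(mx_norm x) mx_normrE.
by apply: bigmax_le => // -[i j] _ /=; rewrite ord1; exact: xc.
Qed.

Lemma coord_le_norm x i : `|x 0 i| <= `|x|.
Proof.
rewrite -[`|x|]/(mx_norm x) mx_normrE.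
by rewrite (le_bigmax _ (fun ij : 'I_1 * 'I_d => `|x ij.1 ij.2|) (0, i)).
Qed.

Lemma row_norm_cvg (T : Type) (F : set_system T) (FF : Filter F)
    (u : T -> 'rV[R]_d) (x : 'rV[R]_d) :
  (forall i, (fun t => u t 0 i) @ F --> x 0 i) -> u @ F --> x.
Proof.
move=> ux; apply/cvgrPdist_le => e e0.
have : \forall t \near F, forall i, `|x 0 i - u t 0 i| <= e.
  apply: filter_forall => i; move: e e0; apply/cvgrPdist_le; exact: ux.
apply: filterS => t ut; apply: row_norm_le; first exact: ltW.
by move=> i; rewrite !mxE; exact: ut.
Qed.

End row_norm.

Section continuous_measurable_row.
Context {R : realType} (d : nat).

Let grid (k : nat) (x : 'rV[R]_d) : {ffun 'I_d -> int} :=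
  [ffun i => Num.floor (k.+1%:R * x 0 i)].

Let node (k : nat) (z : {ffun 'I_d -> int}) : 'rV[R]_d :=
  \row_i ((z i)%:~R / k.+1%:R).

Let grid_cvg x : (fun k => node k (grid k x)) @ \oo --> x.
Proof.
apply: row_norm_cvg => i.
apply/cvgrPdist_le => e e0; near=> k.
rewrite !mxE ffunE.
have /andP[] := floor_itv (k.+1%:R * x 0 i).
set z := (Num.floor _)%:~R; rewrite intrD -/z => z1 z2.
have k0 : (0 : R) < k.+1%:R by rewrite ltr0n.
have -> : x 0 i - z / k.+1%:R = (k.+1%:R * x 0 i - z) / k.+1%:R.
  by field; rewrite addrC natr1 pnatr_eq0.
rewrite normrM [`|(k.+1%:R)^-1|]ger0_norm ?invr_ge0 ?(ltW k0)// ler_pdivrMr//.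
apply: (@le_trans _ _ 1).
  rewrite ger0_norm ?subr_ge0// lerBlDl; apply: ltW; exact: z2.
rewrite -ler_pdivrMl// mulr1.
near: k; have [N _ HN] := near_infty_natSinv_lt (PosNum e0).
exists N => // k /HN /= H; rewrite -[leRHS]invrK lef_pV2 ?posrE ?invr_gt0//.
by rewrite ltW.
Unshelve. all: by end_near. Qed.

(** The sigma-algebra is generated by the coordinates, so open sets are not measurable by
    definition. Rounding the coordinates down to a grid of mesh [1 / (k + 1)] gives measurable
    functions with countably many cells, and [phi] is the pointwise limit of its values at the
    nodes. *)
Lemma continuous_measurable_row (phi : 'rV[R]_d -> R) : continuous phi ->
  measurable_fun [set: 'rV[R]_d] phi.
Proof.
move=> cphi.
apply: (measurable_fun_cvg (h := fun k x => phi (node k (grid k x)))); last first.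
  by move=> x _; apply: continuous_cvg; [exact: cphi|exact: grid_cvg].
move=> k _ A mA; rewrite setTI.
have -> : (fun x => phi (node k (grid k x))) @^-1` A =
    \bigcup_z (if phi (node k z) \in A then grid k @^-1` [set z] else set0).
  apply/seteqP; split => [x Ax|x [z _]] /=.
    by exists (grid k x) => //; rewrite mem_set.
  by case: ifPn => // /set_mem Az xz; rewrite xz.
apply: countable_bigcupT_measurable => [|z]; first exact: countableP.
case: ifPn => // _.
have -> : grid k @^-1` [set z] = \bigcap_(i in [set: 'I_d])
    ((fun x : 'rV[R]_d => k.+1%:R * x 0 i) @^-1` `[(z i)%:~R, (z i + 1)%:~R[).
  apply/seteqP; split => [x <- i _|x xz] /=.
    by rewrite in_itv/= /grid ffunE; exact: floor_itv.
  apply/ffunP => i; rewrite ffunE; apply/eqP; rewrite floor_eq.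
  by have := xz i Logic.I; rewrite /= in_itv.
apply: fin_bigcap_measurable => // i _.
rewrite -[X in measurable X]setTI.
have : measurable_fun setT (fun x : 'rV[R]_d => k.+1%:R * x 0 i).
  by apply: measurable_funM => //; exact: measurable_coord.
by apply => //; exact: measurable_itv.
Qed.

Lemma measurable_mulmx p (M : 'M[R]_(d, p)) :
  measurable_fun [set: 'rV[R]_d] (fun x => x *m M).
Proof.
apply: measurable_row => i; under eq_fun do rewrite mxE.
by apply: measurable_sum => j; apply: measurable_funM => //; exact: measurable_coord.
Qed.

Lemma measurable_row_lin (x : 'rV[R]_d) (a : R) :
  measurable_fun [set: 'rV[R]_d] (fun u => x + a *: u).
Proof.
apply: measurable_row => i; under eq_fun do rewrite !mxE.
apply: measurable_funD => //; apply: measurable_funM => //.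
exact: measurable_coord.
Qed.

End continuous_measurable_row.

Section lebesgue_row_integral.
Context {R : realType}.

Lemma ge0_integral_lebesgue_rowS n (G : 'rV[R]_n.+1 -> \bar R) :
  measurable_fun setT G -> (forall x, 0 <= G x)%E ->
  (\int[lebesgue_row n.+1]_x G x =
   \int[lebesgue_measure]_a \int[lebesgue_row n]_v G (cons_row (a, v)))%E.
Proof.
move=> mG G0.
have mc : measurable_fun [set: measurableTypeR R * 'rV[R]_n] (@cons_row R n).
  exact: measurable_cons_row.
rewrite -(fubini_tonelli1 (m1 := @lebesgue_measure R) (m2 := lebesgue_row n)
  (G \o @cons_row R n)); last 2 first.
- exact: measurableT_comp.
- by move=> z; exact: G0.
have := @ge0_integral_pushforward _ _ _ _ R _ mc
  (lebesgue_measure \x lebesgue_row n)%E setT G measurableT.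
by rewrite preimage_setT; apply => // x _; exact: G0.
Qed.

(** The rescaled image of Lebesgue measure has the right value on half-open intervals, hence is
    Lebesgue measure by uniqueness. *)
Lemma ge0_integral_affine1 (G : R -> \bar R) (x h : R) : 0 < h ->
  measurable_fun [set: measurableTypeR R] G -> (forall x, 0 <= G x)%E ->
  (\int[lebesgue_measure]_y G y =
   h%:E * \int[lebesgue_measure]_u G (x + h * u)%R)%E.
Proof.
move=> h0 mG G0.
have mphi : measurable_fun [set: measurableTypeR R]
    (fun u : measurableTypeR R => x + h * u : measurableTypeR R).
  by apply: measurable_funD => //; apply: measurable_funM.
set phi := (X in measurable_fun _ X) in mphi.
pose m1 := measure_function_pushforward__canonical__measure_function_Measure
  (@lebesgue_measure R) mphi.
pose m2 := mscale (NngNum (ltW h0)) m1.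
have E A : measurable A -> lebesgue_measure A = m2 A.
  apply: lebesgue_measure_unique => _ [[a b] _ <-] /=.
  rewrite /m2 /mscale /m1 /= /pushforward.
  have -> : phi @^-1` [set` `]a, b]] = `](a - x) / h, (b - x) / h]%classic.
    apply/seteqP; split => u /=; rewrite !in_itv/= ltr_pdivrMr// ler_pdivlMr//;
      by rewrite ltrBlDl lerBrDl (mulrC u).
  rewrite !lebesgue_measure_itv/= !lte_fin ltr_pM2r ?invr_gt0// ltrD2r.
  case: ifP => _; last by rewrite mule0.
  rewrite -!EFinB -EFinM; congr EFin; field; exact: lt0r_neq0.
transitivity (\int[m2]_y G y)%E.
  by apply: eq_measure_integral => A mA _; exact: E.
by rewrite ge0_integral_mscale//= ge0_integral_pushforward// preimage_setT.
Qed.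

Lemma ge0_integral_affine n (G : 'rV[R]_n -> \bar R) x (h : R) : 0 < h ->
  measurable_fun setT G -> (forall x, 0 <= G x)%E ->
  (\int[lebesgue_row n]_y G y =
   (h ^+ n)%:E * \int[lebesgue_row n]_u G (x + h *: u)%R)%E.
Proof.
move=> h0; elim: n G x => [|n IH] G x mG G0.
  rewrite expr0 mul1e; apply: eq_integral => y _; congr G.
  by apply/rowP => -[].
have mGl (a : R) (b : 'rV[R]_n.+1) :
    measurable_fun setT (fun u : 'rV[R]_n.+1 => G (b + a *: u)).
  by apply: measurableT_comp => //; exact: measurable_row_lin.
rewrite ge0_integral_lebesgue_rowS// [X in (_ * X)%E]ge0_integral_lebesgue_rowS//.
have mGc (G' : 'rV[R]_n.+1 -> \bar R) : measurable_fun setT G' ->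
    measurable_fun setT (fun p : measurableTypeR R * 'rV[R]_n => G' (cons_row p)).
  by move=> mG'; apply: measurableT_comp => //; exact: measurable_cons_row.
have mGc1 (a : measurableTypeR R) :
    measurable_fun setT (fun v : 'rV[R]_n => G (cons_row (a, v))).
  exact: (measurableT_comp (mGc _ mG) (pair1_measurable a)).
have mF (G' : 'rV[R]_n.+1 -> \bar R) : measurable_fun setT G' ->
    (forall z, 0 <= G' z)%E ->
    measurable_fun [set: measurableTypeR R]
    (fun a => \int[lebesgue_row n]_v G' (cons_row (a, v)))%E.
  move=> mG' G'0.
  apply: (@measurable_fun_fubini_tonelli_F _ _ _ _ _ (lebesgue_row n) _ (mGc _ mG')).
  by move=> z; exact: G'0.
rewrite (ge0_integral_affine1 (x 0 ord0) h0); last 2 first.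
- exact: mF.
- by move=> a; exact: integral_ge0.
rewrite exprS EFinM -muleA; congr (_ * _)%E.
rewrite -ge0_integralZl//; last 3 first.
- exact: (mF (fun u => G (x + h *: u))).
- by move=> a _; exact: integral_ge0.
- by rewrite lee_fin exprn_ge0// ltW.
apply: eq_integral => a _.
rewrite (IH _ (\row_j x 0 (lift ord0 j)))//; congr (_ * _)%E.
apply: eq_integral => v _; congr G.
by apply/rowP => i; rewrite !mxE; case: unliftP => [j|] ->; rewrite ?mxE.
Qed.

Lemma ge0_integral_row_prod n (g : R -> R) :
  measurable_fun [set: R] g -> (forall x, 0 <= g x) ->
  (\int[lebesgue_row n]_x (\prod_(i < n) g (x 0 i))%:E =
   (\int[lebesgue_measure]_a (g a)%:E) ^+ n)%E.
Proof.
move=> mg g0.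
have mgp m : measurable_fun setT (fun x : 'rV[R]_m => \prod_(i < m) g (x 0 i)).
  by apply: measurable_prod => i _; apply: measurableT_comp => //; exact: measurable_coord.
elim: n => [|n IH].
  under eq_integral do rewrite big_ord0.
  by rewrite integral_cst//= diracT mule1.
rewrite ge0_integral_lebesgue_rowS//; last 2 first.
- by apply/measurable_EFinP; exact: mgp.
- by move=> x; rewrite lee_fin prodr_ge0.
rewrite expeS muleC -IH -ge0_integralZl//; last 3 first.
- exact/measurable_EFinP.
- by move=> x _; rewrite lee_fin.
- by apply: integral_ge0 => x _; rewrite lee_fin prodr_ge0.
apply: eq_integral => a _; rewrite muleC -ge0_integralZl//; last 3 first.
- by apply/measurable_EFinP; exact: mgp.
- by move=> x _; rewrite lee_fin prodr_ge0.
- by rewrite lee_fin.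
apply: eq_integral => v _; rewrite big_ord_recl EFinM !mxE unlift_none /=; congr (_ * _%:E)%E.
by apply: eq_bigr => i _; rewrite !mxE liftK.
Qed.

Lemma integral_affine n (G : 'rV[R]_n -> R) x (h : R) : 0 < h ->
  measurable_fun setT G ->
  (lebesgue_row n).-integrable setT (fun u => (G (x + h *: u))%:E) ->
  (lebesgue_row n).-integrable setT (EFin \o G) /\
  \int[lebesgue_row n]_y G y = h ^+ n * \int[lebesgue_row n]_u G (x + h *: u).
Proof.
move=> h0 mG iG.
have mG' : measurable_fun setT (EFin \o G) by exact/measurable_EFinP.
have iG' : (lebesgue_row n).-integrable setT (EFin \o G).
  apply/integrableP; split=> //.
  rewrite (ge0_integral_affine x h0)//=; last first.
    by apply/measurable_EFinP; exact: measurableT_comp.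
  by rewrite lte_mul_pinfty ?lee_fin ?exprn_ge0 ?(ltW h0)//;
    case/integrableP : iG.
have E (H : R -> R) : measurable_fun setT H -> (forall x, 0 <= H x) ->
    (forall x, H x <= `|x|) ->
    \int[lebesgue_row n]_y H (G y) =
    h ^+ n * \int[lebesgue_row n]_u H (G (x + h *: u)).
  move=> mH H0 Hle; rewrite /Rintegral (ge0_integral_affine x h0); last 2 first.
  - by apply/measurable_EFinP; exact: measurableT_comp.
  - by move=> y; rewrite lee_fin.
  rewrite fineM//; apply: (@integrable_fin_num _ _ _ (lebesgue_row n)) => //.
  apply: le_integrable iG => //.
    apply/measurable_EFinP; apply: measurableT_comp => //.
    by apply: measurableT_comp => //; exact: measurable_row_lin.
  by move=> u _; rewrite /= lee_fin ger0_norm.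
split=> //.
pose H1 (a : R) := Num.max a 0; pose H2 (a : R) := Num.max (- a) 0.
have mH1 : measurable_fun setT H1 by exact: measurable_maxr.
have mH2 : measurable_fun setT H2 by exact: measurable_maxr.
have H10 a : 0 <= H1 a by rewrite le_max lexx orbT.
have H20 a : 0 <= H2 a by rewrite le_max lexx orbT.
have H1le a : H1 a <= `|a| by rewrite ge_max ler_norm normr_ge0.
have H2le a : H2 a <= `|a| by rewrite ge_max -normrN ler_norm normr_ge0.
have HE a : a = H1 a - H2 a.
  rewrite /H1 /H2; case: (leP a 0) => a0; case: (leP (- a) 0) => a1; lra.
have iH (G1 : 'rV[R]_n -> R) (H : R -> R) :
    (lebesgue_row n).-integrable setT (EFin \o G1) ->
    measurable_fun setT H -> (forall x, 0 <= H x) -> (forall x, H x <= `|x|) ->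
    (lebesgue_row n).-integrable setT (EFin \o (H \o G1)).
  move=> iG1 mH H0 Hle; have [mG1 _] := integrableP _ _ _ iG1.
  apply: le_integrable iG1 => //.
    apply/measurable_EFinP; apply: measurableT_comp => //.
    exact/measurable_EFinP.
  by move=> u _; rewrite /= lee_fin ger0_norm.
have RE (G1 : 'rV[R]_n -> R) : (lebesgue_row n).-integrable setT (EFin \o G1) ->
    \int[lebesgue_row n]_y G1 y =
    \int[lebesgue_row n]_y H1 (G1 y) - \int[lebesgue_row n]_y H2 (G1 y).
  move=> iG1; rewrite -RintegralB//; [|exact: iH|exact: iH].
  by apply: eq_Rintegral => y _; exact: HE.
by rewrite (RE _ iG') (RE _ iG) mulrBr (E H1)// (E H2).
Qed.

End lebesgue_row_integral.

(** * Integration against a measure given by a density *)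

Section density.
Context {R : realType} d (T : measurableType d).
Variables (mu nu : {measure set T -> \bar R}) (f : T -> R).
Hypotheses (mf : measurable_fun setT f) (f0 : forall x, 0 <= f x).
Hypothesis nuE : forall A, measurable A -> nu A = (\int[mu]_(x in A) (f x)%:E)%E.

Let mEf : measurable_fun setT (EFin \o f). Proof. exact/measurable_EFinP. Qed.

Import HBNNSimple.

Let density_nnsfun (g : {nnsfun T >-> R}) :
  (\int[nu]_x (g x)%:E = \int[mu]_x ((g x)%:E * (f x)%:E))%E.
Proof.
under [LHS]eq_integral do rewrite fimfunE -fsumEFin//.
rewrite [LHS]ge0_integral_fsum//; last 2 first.
  - by move=> r; exact/measurable_EFinP/measurableT_comp.
  - by move=> n x _; rewrite EFinM nnfun_muleindic_ge0.
transitivity (\int[mu]_x (\sum_(r \in range g)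
    ((r * \1_(g @^-1` [set r]) x)%:E * (f x)%:E)))%E; last first.
  apply: eq_integral => x _; rewrite -ge0_mule_fsuml//.
    by rewrite fsumEFin// -fimfunE.
  by move=> r; rewrite EFinM nnfun_muleindic_ge0.
rewrite [RHS]ge0_integral_fsum//; last 2 first.
  - move=> r; apply: emeasurable_funM => //.
    by apply/measurable_EFinP; apply: measurable_funM.
  - by move=> r x _; rewrite mule_ge0 ?(lee_fin _ (f x))//;
      rewrite EFinM nnfun_muleindic_ge0.
apply: eq_fsbigr => r /set_mem[z _ rz].
have r0 : 0 <= r by rewrite -rz.
under eq_integral do rewrite EFinM.
rewrite ge0_integralZl//; last by apply/measurable_EFinP.
rewrite integral_indic// setIT.
under [RHS]eq_integral do rewrite EFinM -muleA.
rewrite ge0_integralZl//; last 2 first.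
  - by apply: emeasurable_funM => //; exact/measurable_EFinP.
  - by move=> x _; rewrite mule_ge0 ?lee_fin.
congr (_ * _)%E; rewrite nuE// integral_mkcond.
apply: eq_integral => x _; rewrite patchE indicE.
by case: ifP => _; rewrite ?mul1e ?mul0e.
Qed.

Lemma ge0_integral_density (g : T -> \bar R) : measurable_fun setT g ->
  (forall x, 0 <= g x)%E -> (\int[nu]_x g x = \int[mu]_x (g x * (f x)%:E))%E.
Proof.
move=> mg g0.
pose g_ := nnsfun_approx measurableT mg.
transitivity (limn (fun n => \int[nu]_x (g_ n x)%:E)%E).
  rewrite -monotone_convergence//=.
  - apply: eq_integral => x _; apply/esym/cvg_lim => //=.
    exact: cvg_nnsfun_approx.
  - by move=> n; exact/measurable_EFinP/measurable_funTS.
  - by move=> n ? _; rewrite lee_fin.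
  - by move=> ? _ ? ? mn; rewrite lee_fin; exact/lefP/nd_nnsfun_approx.
transitivity (limn (fun n => \int[mu]_x ((g_ n x)%:E * (f x)%:E))%E).
  by apply: congr_lim; apply/funext => n; exact: density_nnsfun.
rewrite -monotone_convergence//=.
- apply: eq_integral => x _; apply/cvg_lim => //.
  apply: cvgeZr => //; exact: cvg_nnsfun_approx.
- move=> n; apply: emeasurable_funM => //.
  exact/measurable_EFinP/measurable_funTS.
- by move=> n x _; rewrite mule_ge0 ?lee_fin.
- move=> x _ m n mn; rewrite lee_wpmul2r ?lee_fin//.
  exact/lefP/nd_nnsfun_approx.
Qed.

Lemma integrable_density (g : T -> R) : measurable_fun setT g ->
  nu.-integrable setT (EFin \o g) ->
  mu.-integrable setT (fun x => (g x * f x)%:E) /\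
  \int[nu]_x g x = \int[mu]_x (g x * f x).
Proof.
move=> mg ig.
have mEg : measurable_fun setT (EFin \o g) by exact/measurable_EFinP.
have igf : mu.-integrable setT (fun x => (g x * f x)%:E).
  apply/integrableP; split.
    by apply/measurable_EFinP; exact: measurable_funM.
  have /integrableP[_] := ig; rewrite ge0_integral_density//.
    under eq_integral do rewrite /= -[X in (_ * X)%E]gee0_abs ?lee_fin//.
    by under eq_integral do rewrite -[`|g _|%:E]/(`|(g _)%:E|)%E -abseM.
  exact: measurableT_comp.
split=> //; rewrite /Rintegral; congr fine.
rewrite [LHS]integralE [RHS]integralE.
congr (_ - _)%E.
  rewrite ge0_integral_density//; last exact: measurable_funepos.
  apply: eq_integral => x _; rewrite !funeposE.
  have [g0|/ltW g0] := leP 0 (g x).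
    by rewrite max_l ?lee_fin// max_l ?lee_fin ?mulr_ge0.
  by rewrite max_r ?lee_fin// mul0e max_r// lee_fin mulr_le0_ge0.
rewrite ge0_integral_density//; last exact: measurable_funeneg.
apply: eq_integral => x _; rewrite !funenegE.
have [g0|/ltW g0] := leP 0 (g x).
  by rewrite max_r ?lee_fin ?oppr_le0// mul0e max_r// lee_fin oppr_le0 mulr_ge0.
rewrite max_l ?lee_fin ?oppr_ge0// max_l ?lee_fin ?oppr_ge0 ?mulr_le0_ge0//.
by rewrite -EFinN -EFinM mulNr.
Qed.

End density.

(** * Gaussian laws *)

Section gauss_law.
Context {R : realType}.
Notation leb := (@lebesgue_measure R).

(** Here [v] is the variance, and the value 0 is allowed: scaling and convolution then hold without
    excluding degenerate directions of a singular covariance. *)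
Definition gauss_law (v : R) : probability (measurableTypeR R) R :=
  if v == 0 then (\d_(0 : measurableTypeR R) : probability (measurableTypeR R) R)
  else (normal_prob 0 (Num.sqrt v) : probability (measurableTypeR R) R).

Lemma normal1E v A : normal1 0 v A = gauss_law v A.
Proof. by rewrite /normal1 /gauss_law; case: ifP. Qed.

Lemma integral_gauss_law0 (G : measurableTypeR R -> \bar R) :
  measurable_fun setT G -> (\int[gauss_law 0]_x G x)%E = G (0 : R).
Proof.
move=> mG; rewrite /gauss_law eqxx.
by rewrite (@integral_dirac _ (measurableTypeR R) 0)// diracT mul1e.
Qed.

Definition gauss_pdf (v x : R) := normal_pdf 0 (Num.sqrt v) x.

Lemma gauss_pdf_ge0 v x : 0 <= gauss_pdf v x.
Proof. exact: normal_pdf_ge0. Qed.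

Lemma measurable_gauss_pdf v : measurable_fun [set: measurableTypeR R] (gauss_pdf v).
Proof. exact: measurable_normal_pdf. Qed.

Lemma gauss_pdfE v x : 0 < v ->
  gauss_pdf v x = (Num.sqrt (pi *+ 2) * Num.sqrt v)^-1 * expR (- (x ^+ 2 / (v *+ 2))).
Proof.
move=> v0; rewrite /gauss_pdf normal_pdfE ?gt_eqF ?sqrtr_gt0//.
rewrite /normal_peak /normal_fun sqr_sqrtr ?ltW// subr0 mulNr; congr (_^-1 * _).
by rewrite -mulrnAr mulrC sqrtrM// mulrn_wge0// pi_ge0.
Qed.

Lemma ge0_integral_gauss_law v (G : measurableTypeR R -> \bar R) : 0 < v ->
  measurable_fun setT G -> (forall x, 0 <= G x)%E ->
  (\int[gauss_law v]_x G x = \int[leb]_x (G x * (gauss_pdf v x)%:E))%E.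
Proof.
move=> v0 mG G0; apply: (ge0_integral_density (measurable_gauss_pdf v)) => //.
  exact: gauss_pdf_ge0.
by move=> A mA; rewrite /gauss_law gt_eqF.
Qed.

Lemma integral_gauss_pdf v : (\int[leb]_x (gauss_pdf v x)%:E = 1)%E.
Proof. exact: integral_normal_pdf. Qed.

Lemma gauss_pdfN v x : 0 < v -> gauss_pdf v (- x) = gauss_pdf v x.
Proof. by move=> v0; rewrite !gauss_pdfE// sqrrN. Qed.

Lemma ge0_integral_opp (G : measurableTypeR R -> \bar R) :
  measurable_fun setT G -> (forall x, 0 <= G x)%E ->
  (\int[leb]_x G x = \int[leb]_x G (- x)%R)%E.
Proof.
move=> mG G0; rewrite -[LHS](_ : \int[pushforward leb (-%R : _ -> measurableTypeR R)]_x G x = _)%E.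
  by rewrite ge0_integral_pushforward// preimage_setT.
apply: eq_measure_integral => A mA _; exact: lebesgue_measureN.
Qed.

Lemma gauss_law_scale v c (G : measurableTypeR R -> \bar R) : 0 <= v ->
  measurable_fun setT G -> (forall x, 0 <= G x)%E ->
  (\int[gauss_law v]_x G (c * x)%R = \int[gauss_law (c ^+ 2 * v)]_x G x)%E.
Proof.
move=> v0 mG G0.
have mGc a : measurable_fun setT (fun x : measurableTypeR R => G (a * x)%R).
  apply: measurableT_comp => //; exact: measurable_funM.
have [->|vn0] := eqVneq v 0.
  rewrite (mulr0 (c ^+ 2)); apply: etrans (integral_gauss_law0 (mGc c)) _.
  by apply: etrans (esym (integral_gauss_law0 mG)); congr G; exact: mulr0.
have [->|cn0] := eqVneq c 0.
  have e0 : 0 ^+ 2 * v = 0 by rewrite expr0n mul0r.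
  transitivity (G (0 : R)); last by rewrite e0; exact/esym/integral_gauss_law0.
  transitivity (\int[gauss_law v]_x (cst (G (0%R : R)) x))%E.
    by apply: eq_integral => x _; rewrite mul0r.
  rewrite integral_cst//; apply: etrans (congr1 _ (probability_setT _)) _.
  exact: mule1.
have vp : 0 < v by rewrite lt_def vn0.
have pos c' : 0 < c' -> (\int[gauss_law v]_x G (c' * x)%R =
   \int[gauss_law (c' ^+ 2 * v)]_x G x)%E.
  move=> c0; have cv0 : 0 < c' ^+ 2 * v by rewrite mulr_gt0// exprn_gt0.
  apply: etrans (ge0_integral_gauss_law vp (mGc c') (fun x => G0 (c' * x)%R)) _.
  apply: etrans _ (esym (ge0_integral_gauss_law cv0 mG G0)).
  rewrite [RHS](ge0_integral_affine1 0 c0); last 2 first.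
  - apply: emeasurable_funM => //; apply/measurable_EFinP.
    exact: measurable_gauss_pdf.
  - by move=> x; rewrite mule_ge0// lee_fin gauss_pdf_ge0.
  rewrite -ge0_integralZl//; last 3 first.
  - apply: emeasurable_funM => //.
      apply: measurableT_comp => //.
      by apply: measurable_funD => //; exact: measurable_funM.
    apply/measurable_EFinP; apply: measurableT_comp; first exact: measurable_gauss_pdf.
    by apply: measurable_funD => //; exact: measurable_funM.
  - by move=> x _; rewrite mule_ge0// lee_fin gauss_pdf_ge0.
  - by rewrite lee_fin ltW.
  apply: eq_integral => x _; rewrite add0r muleCA; congr (_ * _)%E.
  rewrite -EFinM; congr EFin; rewrite !gauss_pdfE//.
  rewrite sqrtrM ?sqr_ge0// sqrtr_sqr ger0_norm ?ltW// mulrA.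
  have -> : (c' * x) ^+ 2 / (c' ^+ 2 * v *+ 2) = x ^+ 2 / (v *+ 2).
    by field; rewrite vn0 gt_eqF.
  rewrite [RHS]mulrA; congr (_ * _).
  by field; rewrite !gt_eqF// sqrtr_gt0// pmulrn_lgt0// pi_gt0.
have /orP[c0|c0] : (0 < c) || (c < 0) by rewrite orbC -neq_lt.
  exact: pos c0.
have cN0 : 0 < - c by rewrite oppr_gt0.
rewrite -(sqrrN c); apply: etrans _ (pos _ cN0).
apply: etrans (ge0_integral_gauss_law vp (mGc c) (fun x => G0 (c * x)%R)) _.
apply: etrans _ (esym (ge0_integral_gauss_law vp (mGc (- c)) (fun x => G0 (- c * x)%R))).
rewrite [LHS]ge0_integral_opp; last 2 first.
- apply: emeasurable_funM => //; apply/measurable_EFinP; exact: measurable_gauss_pdf.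
- by move=> x; rewrite mule_ge0// lee_fin gauss_pdf_ge0.
by apply: eq_integral => x _; rewrite gauss_pdfN// mulrN mulNr.
Qed.

(** Completing the square: the joint density of the second summand and the sum is the density of the
    sum times the conditional density of the summand given the sum, which is again normal. *)
Lemma gauss_pdf_conv a b z y : 0 < a -> 0 < b ->
  gauss_pdf a (z - y) * gauss_pdf b y =
  gauss_pdf (a + b) z * normal_pdf (b * z / (a + b)) (Num.sqrt (a * b / (a + b))) y.
Proof.
move=> a0 b0; have ab0 : 0 < a + b by rewrite addr_gt0.
have c0 : 0 < a * b / (a + b) by rewrite divr_gt0// mulr_gt0.
rewrite !gauss_pdfE// normal_pdfE ?gt_eqF ?sqrtr_gt0//.
rewrite /normal_peak /normal_fun sqr_sqrtr ?(ltW c0)//.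
have -> : Num.sqrt (a * b / (a + b) * pi *+ 2) =
    Num.sqrt (pi *+ 2) * (Num.sqrt a * Num.sqrt b / Num.sqrt (a + b)).
  rewrite (_ : _ *+ 2 = (pi *+ 2) * (a * b / (a + b))); last first.
    by rewrite -mulrnAr mulrC.
  have pi2 : 0 <= (pi : R) *+ 2 by rewrite mulrn_wge0// pi_ge0.
  rewrite (sqrtrM _ pi2); congr (_ * _).
  by rewrite sqrtrM ?mulr_ge0 ?ltW// sqrtrM ?ltW// sqrtrV ?ltW.
rewrite mulrACA -expRD [RHS]mulrACA -expRD; congr (_ * _).
  by field; rewrite !gt_eqF ?sqrtr_gt0// pmulrn_lgt0// pi_gt0.
congr expR; rewrite mulNr; field.
by rewrite !gt_eqF.
Qed.

Lemma gauss_law_conv a b (G : measurableTypeR R -> \bar R) : 0 <= a -> 0 <= b ->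
  measurable_fun setT G -> (forall x, 0 <= G x)%E ->
  (\int[gauss_law a]_x \int[gauss_law b]_y G (x + y)%R =
   \int[gauss_law (a + b)]_z G z)%E.
Proof.
move=> a0 b0 mG G0.
have mGp : measurable_fun setT
    (fun z : measurableTypeR R * measurableTypeR R => G (z.1 + z.2)%R).
  apply: measurableT_comp => //; apply: measurable_funD => //.
have mGx x : measurable_fun setT (fun y : measurableTypeR R => G (x + y)%R).
  exact: (measurableT_comp mGp (pair1_measurable x)).
have mF (nu : {sigma_finite_measure set (measurableTypeR R) -> \bar R}) :
    measurable_fun setT (fun x : measurableTypeR R => \int[nu]_y G (x + y)%R)%E.
  apply: (@measurable_fun_fubini_tonelli_F _ _ _ _ _ nu _ mGp).
  by move=> z; exact: G0.
have [->|an0] := eqVneq a 0.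
  apply: etrans (integral_gauss_law0 (mF (gauss_law b))) _.
  rewrite (add0r b); apply: eq_integral => y _; congr G; exact: add0r.
have [->|bn0] := eqVneq b 0.
  rewrite (addr0 a); apply: eq_integral => x _.
  by apply: etrans (integral_gauss_law0 (mGx x)) _; congr G; exact: addr0.
have {an0}a0 : 0 < a by rewrite lt_def an0.
have {bn0}b0 : 0 < b by rewrite lt_def bn0.
have ab0 : 0 < a + b by rewrite addr_gt0.
have mpdf v : measurable_fun [set: measurableTypeR R] (fun x => (gauss_pdf v x)%:E).
  by apply/measurable_EFinP; exact: measurable_gauss_pdf.
have F0 x : (0 <= \int[gauss_law b]_y G (x + y)%R)%E by exact: integral_ge0.
apply: etrans (ge0_integral_gauss_law a0 (mF (gauss_law b)) F0) _.
apply: etrans _ (esym (ge0_integral_gauss_law ab0 mG G0)).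
pose H (z : measurableTypeR R * measurableTypeR R) :=
  (G (z.1 + z.2)%R * (gauss_pdf b z.2)%:E * (gauss_pdf a z.1)%:E)%E.
have H0 z : (0 <= H z)%E by rewrite !mule_ge0// lee_fin gauss_pdf_ge0.
have mH : measurable_fun setT H.
  apply: emeasurable_funM; first apply: emeasurable_funM => //.
    exact: (measurableT_comp (mpdf b)).
  exact: (measurableT_comp (mpdf a)).
transitivity (\int[leb]_x \int[leb]_y H (x, y))%E.
  apply: eq_integral => x _.
  rewrite (ge0_integral_gauss_law b0 (mGx x) (fun y => G0 (x + y)%R)).
  rewrite -ge0_integralZr//; last 3 first.
  - exact: emeasurable_funM.
  - by move=> y _; rewrite mule_ge0// lee_fin gauss_pdf_ge0.
  - by rewrite lee_fin gauss_pdf_ge0.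
rewrite (fubini_tonelli (m1 := leb) (m2 := leb) H)//.
(* The substitution [x = z - y] makes the sum a variable of integration; the conditional density in
   [y] then integrates to 1. *)
pose H' (z : measurableTypeR R * measurableTypeR R) := H (z.2 - z.1, z.1)%R.
have mH' : measurable_fun setT H'.
  apply: measurableT_comp => //; apply: measurable_fun_pair => //.
  by apply: measurable_funB.
transitivity (\int[leb]_y \int[leb]_z H' (y, z))%E.
  apply: eq_integral => y _.
  rewrite [LHS](ge0_integral_affine1 (- y) ltr01); last 2 first.
  - exact: (measurableT_comp mH (pair2_measurable y)).
  - by move=> x; exact: H0.
  rewrite mul1e; apply: eq_integral => z _.
  by rewrite /H' /= mul1r addrC.
rewrite (fubini_tonelli (m1 := leb) (m2 := leb) H')//; last by move=> z; exact: H0.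
apply: eq_integral => z _.
transitivity (\int[leb]_y ((G z * (gauss_pdf (a + b) z)%:E) *
    (normal_pdf (b * z / (a + b)) (Num.sqrt (a * b / (a + b))) y)%:E))%E.
  apply: eq_integral => y _; rewrite /H' /H /= subrK -!muleA; congr (_ * _)%E.
  by rewrite -!EFinM mulrC gauss_pdf_conv.
rewrite ge0_integralZl//; last 3 first.
- by apply/measurable_EFinP; exact: measurable_normal_pdf.
- by move=> y _; rewrite lee_fin normal_pdf_ge0.
- by rewrite mule_ge0// lee_fin gauss_pdf_ge0.
by rewrite integral_normal_pdf mule1.
Qed.

End gauss_law.

(** * Second-order expansion of characteristic functions *)

Section real_dominated_convergence.
Context {R : realType} d (T : measurableType d).
Variable mu : {measure set T -> \bar R}.

Lemma Rdominated_cvg (f_ : nat -> T -> R) (f g : T -> R) :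
  (forall n, measurable_fun setT (f_ n)) -> measurable_fun setT f ->
  mu.-integrable setT (EFin \o g) ->
  (forall n x, `|f_ n x| <= g x) -> (forall x, f_ ^~ x @ \oo --> f x) ->
  mu.-integrable setT (EFin \o f) /\
  (fun n => \int[mu]_x f_ n x) @ \oo --> \int[mu]_x f x.
Proof.
move=> mf_ mf ig fg ff.
have [|||||if_ _ cvg] := @dominated_convergence _ T R mu setT measurableT
  (fun n x => (f_ n x)%:E) (fun x => (f x)%:E) (fun x => (g x)%:E).
- by move=> n; exact/measurable_EFinP.
- exact/measurable_EFinP.
- by apply: aeW => x _; apply: cvg_EFin; [exact: nearW|exact: ff].
- exact: ig.
- by apply: aeW => x n _; rewrite lee_fin.
split=> //; apply: fine_cvg; rewrite fineK//.
exact: integrable_fin_num.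
Qed.

End real_dominated_convergence.

Section trigonometric_bounds.
Context {R : realType}.
Implicit Types x y : R.

(** The alternating bounds on sine and cosine are derived from [cos y <= 1] by repeated use of this
    lemma: each difference vanishes at 0 and its derivative is the preceding one. *)
Lemma ge0_of_is_derive (f df : R -> R) x : (forall y, is_derive y 1 f (df y)) ->
  (forall y, 0 <= y -> 0 <= df y) -> f 0 = 0 -> 0 <= x -> 0 <= f x.
Proof.
move=> fdf df0 f0; rewrite le_eqVlt => /predU1P[<-|x0]; first by rewrite f0.
have cf : {within `[0, x], continuous f}.
  apply: continuous_subspaceT => y; apply/differentiable_continuous/derivable1_diffP.
  by case: (fdf y).
have [c] := MVT x0 (fun y _ => fdf y) cf.
rewrite in_itv/= f0 subr0 => /andP[c0 _] ->; rewrite subr0 mulr_ge0 ?(ltW x0)//.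
by rewrite df0 ?(ltW c0).
Qed.

Let der_ext (f df df' : R -> R) : (forall y, is_derive y 1 f (df' y)) ->
  (forall y, df' y = df y) -> forall y, is_derive y 1 f (df y).
Proof. by move=> fdf e y; rewrite -e. Qed.

Lemma sin_le x : 0 <= x -> sin x <= x.
Proof.
move=> x0; rewrite -subr_ge0.
apply: (@ge0_of_is_derive (fun y => y - sin y) (fun y => 1 - cos y)) x0.
- by move=> y _; rewrite subr_ge0 cos_le1.
- by rewrite sin0 subr0.
Qed.

Lemma cos_ge x : 1 - x ^+ 2 / 2 <= cos x.
Proof.
wlog x0 : x / 0 <= x.
  move=> H; case: (leP 0 x) => [|x0]; first exact: H.
  by rewrite -cosN -sqrrN H// oppr_ge0 ltW.
rewrite -subr_ge0.
apply: (@ge0_of_is_derive (fun y => cos y - (1 - y ^+ 2 / 2)) (fun y => y - sin y)) x0.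
- by apply: der_ext => y /=; rewrite /GRing.scale/=; field.
- by move=> y y0; rewrite subr_ge0 sin_le.
- by rewrite cos0 expr0n/= mul0r subr0 subrr.
Qed.

Lemma sin_ge x : 0 <= x -> x - x ^+ 3 / 6 <= sin x.
Proof.
move=> x0; rewrite -subr_ge0.
apply: (@ge0_of_is_derive (fun y => sin y - (y - y ^+ 3 / 6))
  (fun y => cos y - (1 - y ^+ 2 / 2))) x0.
- by apply: der_ext => y /=; rewrite /GRing.scale/=; field.
- by move=> y y0; rewrite subr_ge0 cos_ge.
- by rewrite sin0 expr0n/= mul0r !subr0.
Qed.

Lemma cos_le x : cos x <= 1 - x ^+ 2 / 2 + x ^+ 4 / 24.
Proof.
wlog x0 : x / 0 <= x.
  move=> H; case: (leP 0 x) => [|x0]; first exact: H.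
  rewrite -cosN -sqrrN (_ : x ^+ 4 = (- x) ^+ 4); last by ring.
  by rewrite H// oppr_ge0 ltW.
rewrite -subr_ge0.
apply: (@ge0_of_is_derive (fun y => (1 - y ^+ 2 / 2 + y ^+ 4 / 24) - cos y)
  (fun y => sin y - (y - y ^+ 3 / 6))) x0.
- by apply: der_ext => y /=; rewrite /GRing.scale/=; field.
- by move=> y y0; rewrite subr_ge0 sin_ge.
- by rewrite cos0 !expr0n/= !mul0r subr0 addr0 subrr.
Qed.

Lemma normr_sin_sub_le3 x : `|sin x - x| <= `|x| ^+ 3 / 6.
Proof.
wlog x0 : x / 0 <= x.
  move=> H; case: (leP 0 x) => [|x0]; first exact: H.
  by have := H (- x); rewrite sinN -opprD !normrN; apply; rewrite oppr_ge0 ltW.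
have := sin_le x0; have := sin_ge x0.
by rewrite distrC (ger0_norm x0) => h1 h2; rewrite ger0_norm; lra.
Qed.

(** The cubic bound is used for [|x| <= 2] and [1 + |x|] beyond. A quadratic bound is wanted because
    only a second moment is available for domination. *)
Lemma normr_sin_sub_le2 x : `|sin x - x| <= x ^+ 2.
Proof.
have h := normr_sin_sub_le3 x.
have s := sin_max x.
have := ler_normB (sin x) x.
have n0 := normr_ge0 x; rewrite -[x ^+ 2]real_normK ?num_real//.
move: (`|x|) n0 h s => a a0 h s h'.
have [a2|a2] := leP a 2.
  apply: le_trans h _.
  have : a ^+ 2 * a <= a ^+ 2 * 2 by apply: ler_wpM2l => //; exact: sqr_ge0.
  have := sqr_ge0 a; rewrite (exprSr a 2); lra.
have : 2 * a <= a ^+ 2 by rewrite expr2 ler_pM2r ?ltW//; lra.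
lra.
Qed.

Lemma onem_cos_bounds x : 0 <= 1 - cos x <= x ^+ 2 / 2.
Proof. by rewrite subr_ge0 cos_le1/=; have := cos_ge x; lra. Qed.

Lemma onem_expN_bounds x : 0 <= x -> x - x ^+ 2 <= 1 - expR (- x) <= x.
Proof.
move=> x0; apply/andP; split; last by have := expR_ge1Dx (- x); lra.
have h := expR_ge1Dx x.
have e0 : 0 < expR x by exact: expR_gt0.
rewrite expRN lerBrDl -lerBrDr -[_^-1]mul1r ler_pdivrMr//.
have : 0 <= x ^+ 2 by exact: sqr_ge0.
have : (1 - x + x ^+ 2) * (1 + x) <= (1 - x + x ^+ 2) * expR x.
  by rewrite ler_wpM2l//; nra.
have : 0 <= x ^+ 3 by rewrite exprn_ge0.
nra.
Qed.

End trigonometric_bounds.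

Section second_order_expansion.
Context {R : realType} d (T : measurableType d) (P : probability T R).
Variable (W : T -> R).
Hypotheses (mW : measurable_fun setT W)
  (iW2 : P.-integrable setT (EFin \o (fun w => W w ^+ 2)))
  (W0 : \int[P]_w W w = 0).

(** The normalization of a sum of [n + 1] terms; the shift avoids a division by 0. *)
Let c n : R := (Num.sqrt n.+1%:R)^-1.
Let v := \int[P]_w (W w ^+ 2).

Let c2 n : c n ^+ 2 = n.+1%:R^-1.
Proof. by rewrite /c exprVn sqr_sqrtr. Qed.

Let c_ge0 n : 0 <= c n. Proof. by rewrite /c invr_ge0 sqrtr_ge0. Qed.

Let n1 n : n.+1%:R * c n ^+ 2 = 1.
Proof. by rewrite c2 divff// pnatr_eq0. Qed.

Let cvg_c2 : (fun n => c n ^+ 2) @ \oo --> (0 : R).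
Proof. by under eq_fun do rewrite c2; exact: cvg_harmonic. Qed.

Let cvg_c : c @ \oo --> (0 : R).
Proof.
have := cvg_comp _ _ cvg_c2 (@sqrt_continuous R 0).
rewrite sqrtr0 /comp; under eq_fun do rewrite sqrtr_sqr ger0_norm//.
exact.
Qed.

Let iW : P.-integrable setT (EFin \o W).
Proof. exact: integrable_of_sqr. Qed.

Let bcos n : bmf (fun w => cos (c n * W w)).
Proof.
split; last by exists 1 => w; exact: cos_max.
apply: (measurableT_comp (f := @cos R)).
  by apply: continuous_measurable_fun; exact: continuous_cos.
exact: measurable_funM.
Qed.

Let bsin n : bmf (fun w => sin (c n * W w)).
Proof.
split; last by exists 1 => w; exact: sin_max.
apply: (measurableT_comp (f := @sin R)).
  by apply: continuous_measurable_fun; exact: continuous_sin.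
exact: measurable_funM.
Qed.

(** The integrand converges to [W^2 / 2] and is dominated by it, so that a second moment
    suffices. *)
Lemma cvg_expect_cos :
  (fun n => n.+1%:R * (1 - \int[P]_w cos (c n * W w))) @ \oo --> v / 2.
Proof.
have [|||||_] := @Rdominated_cvg _ _ _ P
  (fun n w => n.+1%:R * (1 - cos (c n * W w)))
  (fun w => 2^-1 * W w ^+ 2) (fun w => 2^-1 * W w ^+ 2).
- move=> n; apply: measurable_funM => //; apply: measurable_funB => //.
  by case: (bcos n).
- by apply: measurable_funM => //; exact: measurable_funX.
- exact: (integrableZl measurableT 2^-1 iW2).
- move=> n w; have /andP[h1 h2] := onem_cos_bounds (c n * W w).
  rewrite ger0_norm ?mulr_ge0//.
  apply: le_trans (ler_wpM2l _ h2) _ => //.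
  have -> : n.+1%:R * ((c n * W w) ^+ 2 / 2) =
      n.+1%:R * c n ^+ 2 * (2^-1 * W w ^+ 2) by rewrite exprMn; ring.
  by rewrite n1 mul1r.
- move=> w; apply/cvgrPdist_le => e e0.
  have : (fun n => W w ^+ 4 / 24 * c n ^+ 2) @ \oo --> W w ^+ 4 / 24 * 0.
    by apply: cvgMr; exact: cvg_c2.
  rewrite mulr0 => /cvgrPdist_le /(_ e e0); apply: filterS => n.
  rewrite sub0r normrN ger0_norm; last first.
    by rewrite mulr_ge0 ?sqr_ge0// divr_ge0// exprn_even_ge0.
  apply: le_trans.
  have := cos_ge (c n * W w); have := cos_le (c n * W w).
  set C := cos _ => h1 h2.
  have N0 : (0 : R) <= n.+1%:R by [].
  have := ler_wpM2l N0 h1; have := ler_wpM2l N0 h2; rewrite !exprMn.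
  have -> : c n ^+ 4 = c n ^+ 2 * c n ^+ 2 by rewrite -exprD.
  have e1 := n1 n.
  set N := n.+1%:R; rewrite -/N in e1 *; move: (c n ^+ 2) e1 => a e1 k1 k2.
  move: k1 k2; set A := W w ^+ 2; set B := W w ^+ 4.
  rewrite (_ : N * (1 - a * A / 2) = N - (N * a) * A / 2); last by ring.
  rewrite (_ : N * (1 - a * A / 2 + a * a * B / 24) =
    N - (N * a) * A / 2 + (N * a) * a * B / 24); last by ring.
  rewrite e1 !mul1r => k1 k2; rewrite ler_norml; apply/andP; split; lra.
rewrite RintegralZl// -/v mulrC => h.
suff -> : (fun n => n.+1%:R * (1 - \int[P]_w cos (c n * W w))) =
  (fun n => \int[P]_w (n.+1%:R * (1 - cos (c n * W w)))) by [].
apply/funext => n; rewrite expectZ; last by apply: bmfB => //; exact: bmf_cst.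
by rewrite expectB//; [rewrite expect_cst|exact: bmf_cst].
Qed.

(** As [W] is centered, [c n * W] may be subtracted from the sine. The difference is dominated by
    [W^2] and is of order [c n] at each point. *)
Lemma cvg_expect_sin :
  (fun n => n.+1%:R * \int[P]_w sin (c n * W w)) @ \oo --> (0 : R).
Proof.
have [|||||_] := @Rdominated_cvg _ _ _ P
  (fun n w => n.+1%:R * (sin (c n * W w) - c n * W w))
  (fun w => 0) (fun w => W w ^+ 2).
- move=> n; apply: measurable_funM => //; apply: measurable_funB.
    by case: (bsin n).
  exact: measurable_funM.
- by [].
- exact: iW2.
- move=> n w; rewrite normrM ger0_norm//.
  apply: le_trans (ler_wpM2l _ (normr_sin_sub_le2 _)) _ => //.
  by rewrite exprMn mulrA n1 mul1r.
- move=> w; apply/cvgrPdist_le => e e0.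
  have : (fun n => `|W w| ^+ 3 / 6 * c n) @ \oo --> `|W w| ^+ 3 / 6 * 0.
    by apply: cvgMr; exact: cvg_c.
  rewrite mulr0 => /cvgrPdist_le /(_ e e0); apply: filterS => n.
  rewrite !sub0r !normrN ger0_norm; last by rewrite !mulr_ge0// exprn_ge0.
  apply: le_trans; rewrite normrM ger0_norm//.
  apply: le_trans (ler_wpM2l _ (normr_sin_sub_le3 _)) _ => //.
  rewrite normrM exprMn (ger0_norm (c_ge0 n)) exprS.
  have e1 := n1 n; set N := n.+1%:R; rewrite -/N in e1 *.
  rewrite (_ : _ * _ = (N * c n ^+ 2) * (`|W w| ^+ 3 / 6 * c n)); last by ring.
  by rewrite e1 mul1r.
rewrite expect_cst => h.
suff -> : (fun n => n.+1%:R * \int[P]_w sin (c n * W w)) =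
  (fun n => \int[P]_w (n.+1%:R * (sin (c n * W w) - c n * W w))) by [].
have icW n : P.-integrable setT (EFin \o (fun w => c n * W w)).
  exact: (integrableZl measurableT (c n) iW).
have isn n : P.-integrable setT (EFin \o (fun w => sin (c n * W w))).
  exact: bmf_integrable.
apply/funext => n; rewrite RintegralZl//; last first.
  exact: (integrableB measurableT (isn n) (icW n)).
by rewrite RintegralB// (RintegralZl _ _ iW)// W0 mulr0 subr0.
Qed.

(** Both [1 - E cos] and [1 - exp] equal [v / 2] times [1 / (n + 1)] up to a smaller error, so
    replacing one by the other in each of the [n + 1] steps costs nothing in the limit. *)
Lemma cvg_cos_sub_exp :
  (fun n => n.+1%:R * `|\int[P]_w cos (c n * W w) - expR (- (v / 2 * c n ^+ 2))|)
    @ \oo --> (0 : R).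
Proof.
have v0 : 0 <= v by apply: Rintegral_ge0 => w _; exact: sqr_ge0.
have hE : (fun n => n.+1%:R * (1 - expR (- (v / 2 * c n ^+ 2)))) @ \oo --> v / 2.
  have h0 : (fun n => v / 2 - (v / 2) ^+ 2 * c n ^+ 2) @ \oo --> v / 2.
    rewrite -[X in _ --> X]subr0 -(mulr0 ((v / 2) ^+ 2)).
    by apply: cvgB; [exact: cvg_cst|apply: cvgMr; exact: cvg_c2].
  apply: squeeze_cvgr h0 (cvg_cst _).
  apply: nearW => n.
  have x0 : 0 <= v / 2 * c n ^+ 2 by rewrite !mulr_ge0// sqr_ge0.
  have /andP[h1 h2] := onem_expN_bounds x0.
  have N0 : (0 : R) <= n.+1%:R by [].
  have := ler_wpM2l N0 h1; have := ler_wpM2l N0 h2.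
  have e1 := n1 n; set N := n.+1%:R; rewrite -/N in e1 *.
  rewrite (_ : N * (v / 2 * c n ^+ 2) = v / 2 * (N * c n ^+ 2)); last by ring.
  rewrite (_ : N * (v / 2 * c n ^+ 2 - _) = v / 2 * (N * c n ^+ 2) -
    (v / 2) ^+ 2 * c n ^+ 2 * (N * c n ^+ 2)); last by ring.
  by rewrite e1 !mulr1 => -> ->.
have hC := cvg_expect_cos.
have h1 : (fun n => `|n.+1%:R * (1 - expR (- (v / 2 * c n ^+ 2))) -
    n.+1%:R * (1 - \int[P]_w cos (c n * W w))|) @ \oo --> (0 : R).
  rewrite -[X in _ --> X](@normr0 _ R).
  by apply: cvg_norm; rewrite -[X in _ --> X](subrr (v / 2)); exact: cvgB.
suff -> : (fun n => n.+1%:R * `|\int[P]_w cos (c n * W w) -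
     expR (- (v / 2 * c n ^+ 2))|) =
  (fun n => `|n.+1%:R * (1 - expR (- (v / 2 * c n ^+ 2))) -
    n.+1%:R * (1 - \int[P]_w cos (c n * W w))|) by [].
apply/funext => n; rewrite -mulrBr normrM [`|n.+1%:R|]ger0_norm//.
by congr (_ * `|_|); ring.
Qed.

End second_order_expansion.

(** * The characteristic function of the normal law *)

Section gauss_characteristic_function.
Context {R : realType}.

(** Adding a large constant transfers to bounded functions the identities proved for nonnegative
    ones. *)
Lemma fine_ge0_eq d1 d2 (T1 : measurableType d1) (T2 : measurableType d2)
    (P1 : probability T1 R) (P2 : probability T2 R) (F1 : T1 -> R) (F2 : T2 -> R) :
  bmf F1 -> bmf F2 ->
  (forall M, (forall x, 0 <= F1 x + M) -> (forall x, 0 <= F2 x + M) ->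
    (\int[P1]_x (F1 x + M)%:E = \int[P2]_x (F2 x + M)%:E)%E) ->
  \int[P1]_x F1 x = \int[P2]_x F2 x.
Proof.
move=> bF1 bF2 h; have [_ [M1 M1P]] := bF1; have [_ [M2 M2P]] := bF2.
pose M := `|M1| + `|M2|.
have p1 x : 0 <= F1 x + M.
  have := M1P x; rewrite ler_norml => /andP[+ _].
  by have := ler_norm M1; have := normr_ge0 M2; rewrite /M; lra.
have p2 x : 0 <= F2 x + M.
  have := M2P x; rewrite ler_norml => /andP[+ _].
  by have := ler_norm M2; have := normr_ge0 M1; rewrite /M; lra.
have := congr1 fine (h M p1 p2); rewrite -!/(Rintegral _ _ _).
have bM d (T : measurableType d) : bmf (fun x : T => M) by exact: bmf_cst.
rewrite (expectD P1 bF1 (bM _ _)) (expectD P2 bF2 (bM _ _)) !expect_cst.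
by move/addIr.
Qed.

Lemma gauss_scale v c (G : measurableTypeR R -> R) : 0 <= v -> bmf G ->
  \int[gauss_law v]_x G (c * x) = \int[gauss_law (c ^+ 2 * v)]_x G x.
Proof.
move=> v0 bG.
have bGc : bmf (fun x : measurableTypeR R => G (c * x)).
  by apply: (bmf_precomp bG); exact: measurable_funM.
apply: (fine_ge0_eq bGc bG) => M _ G0.
have mGM : measurable_fun setT (fun x => (G x + M)%:E).
  by apply/measurable_EFinP; apply: measurable_funD => //; case: bG.
exact: (gauss_law_scale c v0 mGM G0).
Qed.

Lemma gauss_conv a b (G : measurableTypeR R -> R) : 0 <= a -> 0 <= b -> bmf G ->
  \int[gauss_law a]_x \int[gauss_law b]_y G (x + y) = \int[gauss_law (a + b)]_z G z.
Proof.
move=> a0 b0 bG.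
have bGxy : bmf (fun z : measurableTypeR R * measurableTypeR R => G (z.1 + z.2)).
  by apply: (bmf_precomp bG); exact: measurable_funD.
have bGx (x : measurableTypeR R) : bmf (fun y : measurableTypeR R => G (x + y)).
  exact: bmf_pair1 bGxy.
apply: (fine_ge0_eq (bmf_integral (gauss_law b) bGxy) bG) => M _ G0.
have mGM : measurable_fun setT (fun x => (G x + M)%:E).
  by apply/measurable_EFinP; apply: measurable_funD => //; case: bG.
apply: etrans (gauss_law_conv a0 b0 mGM G0).
apply: eq_integral => x _.
have bM : bmf (fun y : measurableTypeR R => M) by exact: bmf_cst.
transitivity (\int[gauss_law b]_y (G (x + y) + M))%:E.
  by rewrite expectD// expect_cst.
rewrite /Rintegral fineK//; apply: (integrable_fin_num (mu := gauss_law b)) => //.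
by apply: bmf_integrable; exact: bmfD.
Qed.

Lemma bmf_cos d (T : measurableType d) (f : T -> R) : measurable_fun setT f ->
  bmf (fun x => cos (f x)).
Proof.
move=> mf; split; last by exists 1 => w; exact: cos_max.
apply: (measurableT_comp (f := @cos R)) => //.
by apply: continuous_measurable_fun; exact: continuous_cos.
Qed.

Lemma bmf_sin d (T : measurableType d) (f : T -> R) : measurable_fun setT f ->
  bmf (fun x => sin (f x)).
Proof.
move=> mf; split; last by exists 1 => w; exact: sin_max.
apply: (measurableT_comp (f := @sin R)) => //.
by apply: continuous_measurable_fun; exact: continuous_sin.
Qed.

Let mid : measurable_fun setT (fun x : measurableTypeR R => x : R).
Proof. exact: measurable_id. Qed.

(** The sine term of the addition formula has integral 0 because the law is symmetric, which is the
    scaling identity with factor -1. *)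
Lemma gauss_cosD v th : 0 <= v ->
  \int[gauss_law v]_x cos (th + x) = cos th * \int[gauss_law v]_x cos x :> R.
Proof.
move=> v0; have bs := bmf_sin mid; have bc := bmf_cos mid.
have s0 : \int[gauss_law v]_x sin x = 0 :> R.
  have := gauss_scale (-1) v0 bs; rewrite sqrrN expr1n mul1r.
  have -> : \int[gauss_law v]_x sin (-1 * x) = - \int[gauss_law v]_x sin x.
    transitivity (\int[gauss_law v]_x (-1 * sin x)); last by rewrite expectZ// mulN1r.
    by apply: eq_Rintegral => x _; rewrite !mulN1r sinN.
  by move=> h; lra.
transitivity (\int[gauss_law v]_x (cos th * cos x - sin th * sin x)).
  by apply: eq_Rintegral => x _; rewrite cosD.
have b1 : bmf (fun x : measurableTypeR R => cos th * cos x).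
  by apply: bmfM => //; exact: bmf_cst.
have b2 : bmf (fun x : measurableTypeR R => sin th * sin x).
  by apply: bmfM => //; exact: bmf_cst.
by rewrite expectB// !expectZ// s0 mulr0 subr0.
Qed.

Let C v : R := \int[gauss_law v]_x cos x.

Let CD a b : 0 <= a -> 0 <= b -> C (a + b) = C a * C b.
Proof.
move=> a0 b0; have bc := bmf_cos mid.
have h1 := gauss_conv a0 b0 bc.
have h2 := RintegralZr (C b) measurableT (bmf_integrable (gauss_law a) bc).
apply: etrans (esym h1) _; apply: etrans _ h2.
by apply: eq_Rintegral => x _; rewrite gauss_cosD// mulrC.
Qed.

Let C_pow v n : 0 <= v -> C (n%:R * v) = C v ^+ n.
Proof.
move=> v0; elim: n => [|n IH].
  rewrite mul0r expr0 /C /Rintegral (integral_gauss_law0 (G := fun x => (cos x)%:E)).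
    by rewrite cos0.
  by apply/measurable_EFinP; case: (bmf_cos mid).
by rewrite -natr1 mulrDl mul1r CD ?mulr_ge0// IH exprSr.
Qed.

(** The exponential factor turns the standard normal density into a multiple of the normal density
    of variance [1 / (1 - s)]. *)
Lemma integral_gauss_expR s : s < 1 ->
  (\int[gauss_law (1 : R)]_x (expR (s * x ^+ 2 / 2))%:E =
   ((Num.sqrt (1 - s))^-1)%:E)%E.
Proof.
move=> s1; have s10 : 0 < 1 - s by rewrite subr_gt0.
have mE : measurable_fun setT (fun x : measurableTypeR R => (expR (s * x ^+ 2 / 2))%:E).
  apply/measurable_EFinP; apply: measurableT_comp => //.
  by apply: measurable_funM => //; exact: measurable_funM.
apply: etrans (ge0_integral_gauss_law ltr01 mE _) _.
  by move=> x; rewrite lee_fin expR_ge0.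
transitivity (\int[lebesgue_measure]_x (((Num.sqrt (1 - s))^-1)%:E *
    (gauss_pdf (1 - s)^-1 x)%:E))%E.
  apply: eq_integral => x _; rewrite -!EFinM !gauss_pdfE ?invr_gt0//.
  congr EFin; rewrite mulrCA -expRD [RHS]mulrA sqrtr1 mulr1; congr (_ * expR _).
    rewrite sqrtrV ?(ltW s10)//; field.
    by rewrite !gt_eqF// sqrtr_gt0// pmulrn_lgt0// pi_gt0.
  by field; rewrite gt_eqF.
rewrite ge0_integralZl//.
- by rewrite integral_gauss_pdf mule1.
- by apply/measurable_EFinP; exact: measurable_gauss_pdf.
- by move=> x _; rewrite lee_fin gauss_pdf_ge0.
Qed.

(** Half the second moment is the derivative at 0 of [s |-> (1 - s)^(-1/2)], taken along
    [s = - c n]. Integrability of the square comes from the value of the same integral at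
    [s = 1 / 2]. *)
Lemma gauss_moment2 :
  (gauss_law (1 : R)).-integrable setT (fun x => (x ^+ 2)%:E) /\
  \int[gauss_law (1 : R)]_x (x ^+ 2) = 1.
Proof.
have mexp s : measurable_fun setT (fun x : measurableTypeR R => expR (s * x ^+ 2 / 2)).
  apply: measurableT_comp => //; apply: measurable_funM => //.
  exact: measurable_funM.
have iexp : (gauss_law (1 : R)).-integrable setT
    (fun x => (4 * expR (2^-1 * x ^+ 2 / 2))%:E).
  apply/integrableP; split.
    by apply/measurable_EFinP; apply: measurable_funM.
  rewrite (eq_integral (fun x : measurableTypeR R =>
    4%:E * (expR (2^-1 * x ^+ 2 / 2))%:E)%E); last first.
    by move=> x _; rewrite gee0_abs ?EFinM// lee_fin mulr_ge0// expR_ge0.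
  rewrite ge0_integralZl//.
  - by rewrite integral_gauss_expR ?ltry//; lra.
  - exact/measurable_EFinP.
have sqle (x : R) : x ^+ 2 <= 4 * expR (2^-1 * x ^+ 2 / 2).
  by have := expR_ge1Dx (2^-1 * x ^+ 2 / 2); lra.
have isq : (gauss_law (1 : R)).-integrable setT (fun x => (x ^+ 2)%:E).
  apply: le_integrable iexp => //; first exact/measurable_EFinP.
  move=> x _; rewrite /= lee_fin [leLHS]ger0_norm ?sqr_ge0//.
  by rewrite [leRHS]ger0_norm// mulr_ge0// expR_ge0.
split=> //.
pose c n : R := n.+1%:R^-1.
have cE n : n.+1%:R * c n = 1 by rewrite /c divff// pnatr_eq0.
have c0 n : 0 <= c n by rewrite /c invr_ge0.
have cx0 n (x : R) : 0 <= c n * x ^+ 2 / 2.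
  by rewrite divr_ge0// mulr_ge0// sqr_ge0.
have cxE n (x : R) : n.+1%:R * (c n * x ^+ 2 / 2) = 2^-1 * x ^+ 2.
  by transitivity (n.+1%:R * c n * (2^-1 * x ^+ 2)); [ring|rewrite cE mul1r].
have cN n (x : R) : - c n * x ^+ 2 / 2 = - (c n * x ^+ 2 / 2) by rewrite !mulNr.
have cc : c @ \oo --> (0 : R) by exact: cvg_harmonic.
have [|||||_ cv] := @Rdominated_cvg _ _ _ (gauss_law (1 : R))
  (fun n x => n.+1%:R * (1 - expR (- c n * x ^+ 2 / 2)))
  (fun x => 2^-1 * x ^+ 2) (fun x => 2^-1 * x ^+ 2).
- by move=> n; apply: measurable_funM => //; exact: measurable_funB.
- exact: measurable_funM.
- exact: (integrableZl measurableT 2^-1 isq).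
- move=> n x.
  have x0 := cx0 n x.
  have e0 : 0 <= 1 - expR (- c n * x ^+ 2 / 2).
    by rewrite subr_ge0 -[leRHS]expR0 ler_expR !mulNr oppr_le0.
  rewrite ger0_norm ?mulr_ge0//.
  have /andP[_] := onem_expN_bounds x0; rewrite -cN => h.
  apply: le_trans (ler_wpM2l _ h) _ => //.
  by rewrite cxE.
- move=> x; apply/cvgrPdist_le => e e0.
  have : (fun n => (x ^+ 2 / 2) ^+ 2 * c n) @ \oo --> (x ^+ 2 / 2) ^+ 2 * 0.
    exact: cvgMr.
  rewrite mulr0 => /cvgrPdist_le /(_ e e0); apply: filterS => n.
  rewrite sub0r normrN ger0_norm; last by rewrite mulr_ge0 ?sqr_ge0.
  apply: le_trans.
  have x0 := cx0 n x.
  have /andP[] := onem_expN_bounds x0; rewrite cN.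
  set C' := expR _ => h1 h2.
  have N0 : (0 : R) <= n.+1%:R by [].
  have := ler_wpM2l N0 h1; have := ler_wpM2l N0 h2.
  have e1 := cE n; set N := n.+1%:R; rewrite -/N in e1 *.
  set A := x ^+ 2.
  rewrite (_ : N * (c n * A / 2) = (N * c n) * A / 2); last by ring.
  rewrite (_ : N * (c n * A / 2 - (c n * A / 2) ^+ 2) =
    (N * c n) * A / 2 - (N * c n) * ((A / 2) ^+ 2 * c n)); last by ring.
  by rewrite e1 !mul1r => k1 k2; rewrite ler_norml; apply/andP; split; lra.
(* With [q] the square root of [1 + c n], the quotient is [(1 - 1 / q) / (q^2 - 1)]; cancelling
   [q - 1] leaves a form without singularity at [q = 1]. *)
have E n : \int[gauss_law (1 : R)]_x (n.+1%:R * (1 - expR (- c n * x ^+ 2 / 2))) =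
    (1 + c n)^-1 / (1 + (Num.sqrt (1 + c n))^-1).
  have bex : bmf (fun x : measurableTypeR R => expR (- c n * x ^+ 2 / 2)).
    split => //; exists 1 => x; rewrite ger0_norm ?expR_ge0//.
    by rewrite -[leRHS]expR0 ler_expR !mulNr oppr_le0.
  rewrite expectZ; last by apply: bmfB => //; exact: bmf_cst.
  rewrite expectB//; last exact: bmf_cst.
  rewrite expect_cst.
  have -> : \int[gauss_law (1 : R)]_x expR (- c n * x ^+ 2 / 2) =
      (Num.sqrt (1 + c n))^-1.
    rewrite /Rintegral; have := @integral_gauss_expR (- c n).
    rewrite opprK => -> //; have := c0 n; lra.
  have sq0 : 0 < 1 + c n by have := c0 n; lra.
  set q := Num.sqrt (1 + c n).
  have q0 : 0 < q by rewrite sqrtr_gt0.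
  have qE : q ^+ 2 = 1 + c n by rewrite sqr_sqrtr// ltW.
  have N0 : n.+1%:R = (c n)^-1 :> R by rewrite /c invrK.
  have cp : 0 < c n by rewrite /c invr_gt0.
  have cq : c n = q ^+ 2 - 1 by rewrite qE; ring.
  rewrite N0 -qE cq; field.
  by rewrite -cq !gt_eqF// addr_gt0.
have h1 : (fun n => (1 + c n)^-1 / (1 + (Num.sqrt (1 + c n))^-1)) @ \oo --> (2^-1 : R).
  have d1 : (fun n => 1 + c n) @ \oo --> (1 : R).
    by rewrite -[X in _ --> X]addr0; apply: cvgD => //; exact: cvg_cst.
  have d2 : (fun n => Num.sqrt (1 + c n)) @ \oo --> (1 : R).
    rewrite -[X in _ --> X]sqrtr1.
    exact: (cvg_comp _ _ d1 (@sqrt_continuous R 1)).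
  have -> : 2^-1 = 1^-1 / (1 + 1^-1) :> R by field.
  apply: cvgM; first by apply: cvgV => //; exact: oner_neq0.
  have n2 : (1 + 1^-1 : R) != 0 by rewrite invr1 gt_eqF// addr_gt0.
  apply: cvgV => //.
  by apply: cvgD; [exact: cvg_cst|apply: cvgV => //; exact: oner_neq0].
have h2 : \int[gauss_law (1 : R)]_x (2^-1 * x ^+ 2) = 2^-1.
  by move: cv; under eq_fun do rewrite E; move=> cv; exact: (cvg_unique _ cv h1).
move: h2; rewrite RintegralZl// => h2.
by apply: (@mulfI _ 2^-1) => //; rewrite h2 mulr1.
Qed.

Lemma normrX_sub_le (a b : R) n : `|a| <= 1 -> `|b| <= 1 ->
  `|a ^+ n - b ^+ n| <= n%:R * `|a - b|.
Proof.
move=> a1 b1; elim: n => [|n IH]; first by rewrite !expr0 subrr normr0 mul0r.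
rewrite !exprS (_ : _ - _ = a * (a ^+ n - b ^+ n) + (a - b) * b ^+ n); last by ring.
apply: le_trans (ler_normD _ _) _; rewrite !normrM -natr1 mulrDl mul1r lerD//.
  by apply: le_trans IH; rewrite ler_piMl.
by rewrite ler_piMr// normrX exprn_ile1.
Qed.

(** Stability under convolution gives [C v = C (v / n) ^ n]. The second moment gives
    [C (v / n) = exp (- v / (2 n))] up to [o (1 / n)], and taking [n]-th powers multiplies that
    error by at most [n]. *)
Lemma gauss_cf v th : 0 <= v ->
  \int[gauss_law v]_x cos (th + x) = expR (- (v / 2)) * cos th :> R.
Proof.
move=> v0; rewrite gauss_cosD// mulrC; congr (_ * _); rewrite -/(C v).
have [isq sq1] := gauss_moment2.
pose W (x : measurableTypeR R) := Num.sqrt v * x.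
have mW : measurable_fun setT W by exact: measurable_funM.
have W2E x : W x ^+ 2 = v * x ^+ 2 by rewrite exprMn sqr_sqrtr.
have iW2 : (gauss_law (1 : R)).-integrable setT (EFin \o (fun x => W x ^+ 2)).
  under [X in _.-integrable _ X]eq_fun do rewrite /= W2E.
  exact: (integrableZl measurableT v isq).
have vE : \int[gauss_law (1 : R)]_x (W x ^+ 2) = v.
  by under eq_Rintegral do rewrite W2E; rewrite RintegralZl// sq1 mulr1.
pose c n : R := (Num.sqrt n.+1%:R)^-1.
have : (fun n => n.+1%:R * `|\int[gauss_law (1 : R)]_w cos (c n * W w) -
    expR (- (v / 2 * c n ^+ 2))|) @ \oo --> (0 : R).
  by have := cvg_cos_sub_exp mW iW2; rewrite vE.
have c2 n : c n ^+ 2 = n.+1%:R^-1 by rewrite /c exprVn sqr_sqrtr.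
have CE n : \int[gauss_law (1 : R)]_x cos (c n * W x) = C (v / n.+1%:R).
  rewrite /C -[v / _](_ : (c n * Num.sqrt v) ^+ 2 * 1 = _); last first.
    by rewrite exprMn c2 sqr_sqrtr// mulr1 mulrC.
  apply: etrans _ (gauss_scale (c n * Num.sqrt v) ler01 (bmf_cos mid)).
  by apply: eq_Rintegral => x _; rewrite /W mulrA.
under eq_fun do rewrite CE.
move=> h; apply/eqP; rewrite -subr_eq0 -normr_le0; apply/ler_addgt0Pl => e e0.
rewrite addr0; move/cvgrPdist_le : h => /(_ e e0)[N _ /(_ N (leqnn N))] /=.
rewrite sub0r normrN ger0_norm; last by rewrite mulr_ge0.
apply: le_trans.
have Nn0 : N.+1%:R != 0 :> R by rewrite pnatr_eq0.
have -> : C v = C (v / N.+1%:R) ^+ N.+1.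
  have vN : 0 <= v / N.+1%:R by rewrite divr_ge0.
  apply: etrans (C_pow N.+1 vN); congr C.
  by rewrite mulrC divfK.
have -> : expR (- (v / 2)) = expR (- (v / 2 * c N ^+ 2)) ^+ N.+1.
  rewrite -expRM_natl c2; congr expR; field.
  by rewrite addrC natr1.
apply: normrX_sub_le.
  by apply: expect_normE => [|x]; [case: (bmf_cos mid)|exact: cos_max].
rewrite ger0_norm ?expR_ge0// -[leRHS]expR0 ler_expR oppr_le0.
by rewrite c2 mulr_ge0 ?divr_ge0.
Qed.

End gauss_characteristic_function.

(** * Normal laws with a prescribed, possibly singular covariance *)

Section cholesky.
Context {R : realType}.

Definition psd_mx n (v : 'M[R]_n) :=
  v^T = v /\ forall u : 'rV[R]_n, 0 <= (u *m v *m u^T) 0 0.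

(** Cholesky factorization by induction on the Schur complement of the first entry. A zero pivot is
    possible; the rest of its row is then zero. *)
Lemma psd_mx_factor n (v : 'M[R]_n) : psd_mx v -> exists B : 'M[R]_n, v = B *m B^T.
Proof.
elim: n v => [|n IH] v [vT v0].
  by exists 0; apply/matrixP => -[].
pose v' : 'M[R]_(1 + n) := v.
have v0' (u : 'rV[R]_(1 + n)) : 0 <= (u *m v' *m u^T) 0 0 by exact: v0.
suff [B BE] : exists B : 'M[R]_(1 + n), v' = B *m B^T by exists B.
have vE : v' = block_mx (ulsubmx v') (ursubmx v') (dlsubmx v') (drsubmx v').
  by rewrite submxK.
set A := ulsubmx v' in vE; set w := ursubmx v' in vE; set D := drsubmx v' in vE.
have wT : dlsubmx v' = w^T.
  by rewrite /w trmx_ursub; congr dlsubmx; exact/esym/vT.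
have DT : D^T = D by rewrite /D trmx_drsub; congr drsubmx; exact: vT.
rewrite wT in vE.
pose a := A 0 0.
have AE : A = a%:M by rewrite [A]mx11_scalar.
have q (s : R) (y : 'rV[R]_n) : 0 <= s ^+ 2 * a + 2 * s * (y *m w^T) 0 0 +
    (y *m D *m y^T) 0 0.
  have := v0' (row_mx (s%:M : 'rV[R]_1) y); rewrite {1}vE AE.
  rewrite tr_row_mx tr_scalar_mx mul_row_block mul_row_col !mulmxDl.
  have -> : s%:M *m w *m y^T = s%:M *m (y *m w^T)^T :> 'M[R]_1.
    by rewrite trmx_mul trmxK mulmxA.
  move: (y *m D *m y^T) => Z; rewrite [y *m w^T]mx11_scalar.
  move: ((y *m w^T) 0 0) => m; rewrite tr_scalar_mx -!scalar_mxM !mxE eqxx !mulr1n.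
  by move=> h; apply: le_trans h _; rewrite le_eqVlt; apply/orP; left; apply/eqP; ring.
have a0 : 0 <= a.
  by have := q 1 0; rewrite !mul0mx !mxE mulr0 !addr0 expr1n mul1r.
have [az|an0] := eqVneq a 0.
  have w0 : w = 0.
    apply/rowP => j; rewrite [RHS]mxE; apply/eqP; apply: contraT => wj.
    pose y : 'rV[R]_n := delta_mx 0 j.
    have yw : (y *m w^T) 0 0 = w 0 j.
      by rewrite -rowE !mxE.
    (* With a zero pivot the form is affine in [s]; this value of [s] makes it equal to -1. *)
    have := q (- ((y *m D *m y^T) 0 0 + 1) / (2 * w 0 j)) y.
    rewrite az mulr0 add0r yw; move: (w 0 j) wj => k k0.
    rewrite (_ : 2 * _ * k = - ((y *m D *m y^T) 0 0 + 1)); last by field.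
    lra.
  have [|B BE] := IH D.
    split=> // u; have := q 0 u.
    by rewrite expr0n mul0r mulr0 mul0r !add0r.
  exists (block_mx 0 0 0 B : 'M[R]_(1 + n)).
  rewrite vE AE az w0 trmx0 (raddf0 (@scalar_mx _ 1)) (tr_block_mx 0 0 0 B).
  by rewrite mulmx_block !trmx0 !mulmx0 !mul0mx !addr0 BE add0r.
have ap : 0 < a by rewrite lt_def an0.
pose t := Num.sqrt a.
have tt : t ^+ 2 = a by rewrite sqr_sqrtr.
have t0 : t != 0 by rewrite gt_eqF// sqrtr_gt0.
have [|B BE] := IH (D - a^-1 *: (w^T *m w)).
  split.
    by rewrite linearB linearZ/= trmx_mul trmxK DT.
  move=> u; pose m := (u *m w^T) 0 0.
  (* The minimum of the form over [s] is the quadratic form of the Schur complement. *)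
  have := q (- m / a) u; rewrite -/m.
  have -> : (u *m (D - a^-1 *: (w^T *m w)) *m u^T) 0 0 =
      (u *m D *m u^T) 0 0 - a^-1 * m ^+ 2.
    rewrite mulmxBr mulmxBl -scalemxAr -scalemxAl.
    have -> : u *m (w^T *m w) *m u^T = (u *m w^T) *m (u *m w^T)^T.
      by rewrite trmx_mul trmxK !mulmxA.
    rewrite [u *m w^T]mx11_scalar -/m tr_scalar_mx -scalar_mxM.
    by rewrite !mxE eqxx mulr1n expr2.
  move=> h; apply: le_trans h _; rewrite le_eqVlt; apply/orP; left; apply/eqP.
  by field.
exists (block_mx (t%:M : 'M[R]_1) 0 (t^-1 *: w^T) B : 'M[R]_(1 + n)).
rewrite (tr_block_mx (t%:M : 'M[R]_1) 0 (t^-1 *: w^T) B) mulmx_block.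
rewrite !trmx0 !mulmx0 !mul0mx !addr0 tr_scalar_mx linearZ/= trmxK -BE vE AE.
congr block_mx.
- by rewrite -scalar_mxM -expr2 tt.
- by rewrite mul_scalar_mx scalerA divff// scale1r.
- by rewrite mul_mx_scalar scalerA divff// scale1r.
- rewrite -scalemxAr -scalemxAl scalerA -invfM -expr2 tt.
  by rewrite addrC subrK.
Qed.

End cholesky.

Section standard_normal_row.
Context {R : realType}.

Section gauss_cons.
Variables (n : nat) (mu : probability 'rV[R]_n R).

Definition gauss_cons : set 'rV[R]_n.+1 -> \bar R :=
  pushforward (gauss_law 1 \x mu)%E (@cons_row R n).

Let mcons : measurable_fun [set: measurableTypeR R * 'rV[R]_n] (@cons_row R n).
Proof. exact: measurable_cons_row. Qed.

Let pre (A : set 'rV[R]_n.+1) : measurable A ->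
  measurable ((@cons_row R n @^-1` A) : set (measurableTypeR R * 'rV[R]_n)).
Proof. by move=> mA; rewrite -[X in measurable X]setTI; exact: mcons. Qed.

Let gauss_cons0 : gauss_cons set0 = 0%E.
Proof. by rewrite /gauss_cons /pushforward preimage_set0 measure0. Qed.

Let gauss_cons_ge0 A : (0 <= gauss_cons A)%E.
Proof. exact: (@measure_ge0 _ _ _ (gauss_law 1 \x mu)%E). Qed.

Let gauss_cons_sigma_additive : semi_sigma_additive gauss_cons.
Proof.
move=> F mF tF mUF; rewrite /gauss_cons /pushforward preimage_bigcup.
apply: measure_semi_sigma_additive => [i||].
- exact: pre.
- apply/trivIsetP => i j _ _ ij; rewrite -preimage_setI.
  by move/trivIsetP : tF => /(_ _ _ Logic.I Logic.I ij) ->; rewrite preimage_set0.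
- by rewrite -preimage_bigcup; exact: pre.
Qed.

HB.instance Definition _ := isMeasure.Build _ _ _ gauss_cons
  gauss_cons0 gauss_cons_ge0 gauss_cons_sigma_additive.

Let gauss_consT : gauss_cons setT = 1%E.
Proof.
rewrite /gauss_cons /pushforward preimage_setT -setXTT.
rewrite (product_measure1E (gauss_law 1) mu measurableT measurableT).
have e1 : gauss_law (1 : R) setT = 1%E by exact: probability_setT.
have e2 : mu setT = 1%E by exact: probability_setT.
by apply: etrans (congr2 _ e1 e2) _; exact: mule1.
Qed.

HB.instance Definition _ := Measure_isProbability.Build _ _ _ gauss_cons gauss_consT.

Lemma ge0_integral_gauss_cons (G : 'rV[R]_n.+1 -> \bar R) :
  measurable_fun setT G -> (forall x, 0 <= G x)%E ->
  (\int[gauss_cons]_x G x =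
   \int[gauss_law 1]_a \int[mu]_v G (cons_row (a, v)))%E.
Proof.
move=> mG G0.
have mGc : measurable_fun setT (G \o @cons_row R n : measurableTypeR R * 'rV[R]_n -> \bar R).
  exact: measurableT_comp.
rewrite -(fubini_tonelli1 (m1 := gauss_law 1) (m2 := mu) (G \o @cons_row R n)); last 2 first.
- exact: mGc.
- by move=> z; exact: G0.
have := @ge0_integral_pushforward _ _ _ _ R _ mcons
  (gauss_law 1 \x mu)%E setT G measurableT.
by rewrite preimage_setT; apply => // x _; exact: G0.
Qed.

End gauss_cons.

Fixpoint std_normal n : probability 'rV[R]_n R :=
  if n is m.+1 then (gauss_cons (std_normal m) : probability 'rV[R]_m.+1 R)
  else (\d_(0 : 'rV[R]_0) : probability 'rV[R]_0 R).

(** By induction, scaling treats the first coordinate and convolution adds it to the remaining ones,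
    so variances add up. *)
Lemma ge0_integral_std_normal n (u : 'rV[R]_n) (G : measurableTypeR R -> \bar R) :
  measurable_fun setT G -> (forall x, 0 <= G x)%E ->
  (\int[std_normal n]_x G (\sum_i u 0 i * x 0 i)%R =
   \int[gauss_law (\sum_i (u 0 i) ^+ 2)]_z G z)%E.
Proof.
elim: n u G => [|n IH] u G mG G0.
  rewrite big_ord0; apply: etrans (esym (integral_gauss_law0 mG)).
  rewrite (@integral_dirac _ 'rV[R]_0 0)//.
    by rewrite diracT mul1e big_ord0.
  apply: measurableT_comp => //.
  by apply: measurable_sum => i; apply: measurable_funM => //; exact: measurable_coord.
have mGl : measurable_fun setT (fun x : 'rV[R]_n.+1 => G (\sum_i u 0 i * x 0 i)%R).
  apply: measurableT_comp => //.
  by apply: measurable_sum => i; apply: measurable_funM => //; exact: measurable_coord.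
apply: etrans (ge0_integral_gauss_cons _ mGl (fun x => G0 _)) _.
pose u' : 'rV[R]_n := \row_j u 0 (lift ord0 j).
pose s := \sum_i (u' 0 i) ^+ 2.
have s0 : 0 <= s by apply: sumr_ge0 => i _; exact: sqr_ge0.
have mGp : measurable_fun setT
    (fun z : measurableTypeR R * measurableTypeR R => G (z.1 + z.2)%R).
  by apply: measurableT_comp => //; exact: measurable_funD.
have mGx (x : measurableTypeR R) : measurable_fun setT (fun y : measurableTypeR R => G (x + y)%R).
  exact: (measurableT_comp mGp (pair1_measurable x)).
have mF : measurable_fun setT
    (fun x : measurableTypeR R => \int[gauss_law s]_y G (x + y)%R)%E.
  apply: (@measurable_fun_fubini_tonelli_F _ _ _ _ _ (gauss_law s) _ mGp).
  by move=> z; exact: G0.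
transitivity (\int[gauss_law 1]_a \int[gauss_law s]_z G (u 0 ord0 * a + z)%R)%E.
  apply: eq_integral => a _.
  apply: etrans (IH u' (fun y => G (u 0 ord0 * a + y)%R) (mGx _) (fun y => G0 _)).
  apply: eq_integral => v _; congr G.
  rewrite big_ord_recl !mxE unlift_none /=; congr (_ + _).
  by apply: eq_bigr => i _; rewrite !mxE liftK.
have F0 (x : measurableTypeR R) : (0 <= \int[gauss_law s]_y G (x + y)%R)%E.
  exact: integral_ge0.
apply: etrans (gauss_law_scale (u 0 ord0) ler01 mF F0) _.
apply: etrans (gauss_law_conv _ s0 mG G0) _.
  by rewrite mulr1 sqr_ge0.
rewrite big_ord_recl mulr1; congr (\int[gauss_law (_ + _)]_z G z)%E.
by apply: eq_bigr => i _; rewrite !mxE.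
Qed.

Lemma row_mulmx_tr n (u x : 'rV[R]_n) : (u *m x^T) 0 0 = \sum_i u 0 i * x 0 i.
Proof. by rewrite mxE; apply: eq_bigr => i _; rewrite mxE. Qed.

Lemma integral_indicT d (T : measurableType d) (mu : {measure set T -> \bar R}) A :
  measurable A -> (\int[mu]_x (\1_A x)%:E = mu A)%E.
Proof. by move=> mA; rewrite integral_indic// setIT. Qed.

(** The law is the image of the standard normal row under a factor of [v], which need not be
    invertible. *)
Lemma normal_exists n (v : 'M[R]_n) : psd_mx v ->
  exists N : probability 'rV[R]_n R, is_normal N 0 v.
Proof.
move=> /psd_mx_factor[B ->].
have mB : measurable_fun setT (fun x : 'rV[R]_n => x *m B^T) by exact: measurable_mulmx.
pose phi : {mfun 'rV[R]_n >-> 'rV[R]_n} :=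
  HB.pack (fun x : 'rV[R]_n => x *m B^T) (isMeasurableFun.Build _ _ _ _ _ mB).
exists (distribution (std_normal n) phi) => u A mA.
rewrite trmx0 mulmx0 mxE normal1E.
have mI : measurable_fun setT (fun z : measurableTypeR R => (\1_A z)%:E : \bar R).
  by apply/measurable_EFinP; exact: measurable_indic.
have I0 z : (0 <= (\1_A z)%:E :> \bar R)%E by rewrite lee_fin.
have := ge0_integral_std_normal (u *m B) mI I0.
have -> : \sum_i (u *m B) 0 i ^+ 2 = (u *m (B *m B^T) *m u^T) 0 0.
  rewrite mulmxA -mulmxA -trmx_mul row_mulmx_tr.
  by apply: eq_bigr => i _; rewrite expr2.
move=> h; apply: (etrans _ (integral_indicT (gauss_law _) mA)).
apply: (etrans _ h).
rewrite /distribution /pushforward.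
pose D := [set x : 'rV[R]_n | A (\sum_i (u *m B) 0 i * x 0 i)].
have mD : measurable D.
  have : measurable_fun setT (fun x : 'rV[R]_n => \sum_i (u *m B) 0 i * x 0 i).
    by apply: measurable_sum => i; apply: measurable_funM => //; exact: measurable_coord.
  by move=> /(_ measurableT _ mA); rewrite setTI.
transitivity (std_normal n D).
  congr (std_normal n _); apply/seteqP; split => x /=;
    by rewrite /D /= -row_mulmx_tr trmx_mul trmxK mulmxA.
apply: etrans (esym (integral_indicT _ mD)) _.
by apply: eq_integral => x _; rewrite !indicE.
Qed.

Lemma is_normal_cf n (N : probability 'rV[R]_n R) (v : 'M[R]_n)
    (u : 'rV[R]_n) th :
  is_normal N 0 v -> psd_mx v ->
  \int[N]_x cos (th + (u *m x^T) 0 0) =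
  expR (- ((u *m v *m u^T) 0 0 / 2)) * cos th.
Proof.
move=> hN [_ v0]; rewrite -gauss_cf//.
have mL : measurable_fun setT (fun x : 'rV[R]_n => (u *m x^T) 0 0 : measurableTypeR R).
  under eq_fun do rewrite row_mulmx_tr.
  by apply: measurable_sum => i; apply: measurable_funM => //; exact: measurable_coord.
pose L : {mfun 'rV[R]_n >-> measurableTypeR R} :=
  HB.pack (fun x : 'rV[R]_n => (u *m x^T) 0 0 : measurableTypeR R)
    (isMeasurableFun.Build _ _ _ _ _ mL).
have bc : bmf (fun y : measurableTypeR R => cos (th + y)).
  by apply: bmf_cos; exact: measurable_funD.
have E : (\int[distribution N L]_y (cos (th + y))%:E =
          \int[N]_x (cos (th + L x))%:E)%E.
  apply: (@integral_distribution _ _ _ _ _ N L (fun y => (cos (th + y))%:E)).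
    by apply/measurable_EFinP; case: bc.
  apply: (bmf_integrable N (f := fun x => cos (th + L x))).
  exact: (bmf_precomp bc mL).
rewrite /Rintegral -[in LHS]E; congr fine.
apply: eq_measure_integral => A mA _; rewrite /distribution /pushforward.
have := hN u A mA; rewrite trmx0 mulmx0 mxE normal1E => h.
exact: h.
Qed.

End standard_normal_row.

(** * From characteristic functions to weak convergence *)

Lemma cvg_minr {R : realType} (u : nat -> R) (a l : R) : u @ \oo --> l ->
  (fun n => Num.min a (u n)) @ \oo --> Num.min a l.
Proof.
move=> ul; apply/cvgrPdist_le => e e0.
move/cvgrPdist_le : ul => /(_ e e0); apply: filterS => n; apply: le_trans.
by rewrite /Num.min; case: ltP => ?; case: ltP => ? //; rewrite ler_norml;
  (apply/andP; split); have := ler_norm (l - u n); have := ler_norm (u n - l);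
  rewrite [`|u n - l|]distrC; have := normr_ge0 (l - u n); lra.
Qed.

Section gaussian_smoothing.
Context {R : realType} (d : nat).
Notation rV := ('rV[R]_d).
Notation leb := (lebesgue_row d : {sigma_finite_measure set rV -> \bar R}).

Definition gauss_row (z : rV) : R := \prod_(i < d) gauss_pdf 1 (z 0 i).

Lemma gauss_row_ge0 z : 0 <= gauss_row z.
Proof. by apply: prodr_ge0 => i _; exact: gauss_pdf_ge0. Qed.

Lemma measurable_gauss_row : measurable_fun setT gauss_row.
Proof.
apply: measurable_prod => i _.
exact: (measurableT_comp (measurable_gauss_pdf 1) (measurable_coord i)).
Qed.

Lemma integral_gauss_row : (\int[leb]_z (gauss_row z)%:E = 1)%E.
Proof.
rewrite (ge0_integral_row_prod d (g := gauss_pdf 1)).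
- by rewrite integral_gauss_pdf; elim: (d) => [|k IH]; rewrite ?expe0// expeS IH mule1.
- exact: measurable_gauss_pdf.
- exact: gauss_pdf_ge0.
Qed.

Lemma psd_mx1 : psd_mx (1%:M : 'M[R]_d).
Proof.
split; first exact: trmx1.
move=> u; rewrite mulmx1 row_mulmx_tr sumr_ge0// => i _.
by rewrite -expr2 sqr_ge0.
Qed.

(** Up to a constant, the Gaussian density is its own Fourier transform. This is the only Fourier
    inversion that the weak convergence proof requires. *)
Lemma gauss_row_cf : exists (k : R) (N : probability rV R), 0 < k /\
  forall z, gauss_row z = k * \int[N]_x cos ((z *m x^T) 0 0).
Proof.
have [N hN] := normal_exists psd_mx1.
have q0 : 0 < Num.sqrt ((pi : R) *+ 2) by rewrite sqrtr_gt0 pmulrn_lgt0// pi_gt0.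
exists ((Num.sqrt (pi *+ 2))^-1 ^+ d), N; split.
  by rewrite exprn_gt0// invr_gt0.
move=> z; have := is_normal_cf z 0 hN psd_mx1.
rewrite cos0 mulr1 mulmx1.
under eq_Rintegral do rewrite add0r.
move=> ->; rewrite /gauss_row.
under eq_bigr do rewrite gauss_pdfE// sqrtr1 mulr1.
rewrite big_split/= prodr_const card_ord; congr (_ * _).
rewrite -expR_sum; congr expR; rewrite row_mulmx_tr mulr_suml -sumrN.
by apply: eq_bigr => i _; rewrite expr2.
Qed.

Section characteristic_functions.
Variables (mu : nat -> probability rV R) (N : probability rV R).
Hypothesis cf : forall (u : rV) (th : R),
  (fun n => \int[mu n]_x cos (th + (u *m x^T) 0 0)) @ \oo -->
  \int[N]_x cos (th + (u *m x^T) 0 0).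

Let mdot (u : rV) : measurable_fun setT (fun x : rV => (u *m x^T) 0 0).
Proof.
under eq_fun do rewrite row_mulmx_tr.
by apply: measurable_sum => i; apply: measurable_funM => //; exact: measurable_coord.
Qed.

Let mdot2 : measurable_fun setT (fun z : rV * rV => (z.1 *m z.2^T) 0 0).
Proof.
under eq_fun do rewrite row_mulmx_tr.
apply: measurable_sum => i; apply: measurable_funM.
  exact: (measurableT_comp (measurable_coord i) measurable_fst).
exact: (measurableT_comp (measurable_coord i) measurable_snd).
Qed.

Let bgauss2 (h : R) : bmf (fun p : rV * rV => gauss_row (h *: (p.1 - p.2))).
Proof.
have [k [G [k0 GE]]] := gauss_row_cf; split.
  apply: (measurableT_comp measurable_gauss_row).
  apply: measurable_row => i; under eq_fun do rewrite !mxE.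
  apply: measurable_funM => //; apply: measurable_funB => //.
    exact: (measurableT_comp (measurable_coord i) measurable_fst).
  exact: (measurableT_comp (measurable_coord i) measurable_snd).
exists k => p; rewrite GE normrM (gtr0_norm k0) ler_piMr ?(ltW k0)//.
apply: expect_normE => [|y]; last exact: cos_max.
by case: (bmf_cos (mdot (h *: (p.1 - p.2)))).
Qed.

(** By Fubini, a Gaussian kernel integrated against [M] is an average of values of the
    characteristic function of [M], taken under a fixed normal law [G]; these values are bounded by
    1. *)
Lemma cvg_gauss_row (h : R) (c : rV) :
  (fun n => \int[mu n]_x gauss_row (h *: (c - x))) @ \oo -->
  \int[N]_x gauss_row (h *: (c - x)).
Proof.
have [k [G [k0 GE]]] := gauss_row_cf.
pose F (z : rV * rV) : R := cos ((h *: (c - z.1) *m z.2^T) 0 0).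
have bF : bmf F.
  have mg : measurable_fun setT
      (fun z : rV * rV => (h *: (c - z.1) : rV, z.2)).
    apply: measurable_fun_pair => //; apply: measurable_row => i.
    under eq_fun do rewrite !mxE.
    apply: measurable_funM => //; apply: measurable_funB => //.
    exact: (measurableT_comp (measurable_coord i) measurable_fst).
  by apply: bmf_cos; exact: (measurableT_comp mdot2 mg).
have E (M : probability rV R) : \int[M]_x gauss_row (h *: (c - x)) =
    k * \int[G]_y \int[M]_x cos (h * (c *m y^T) 0 0 + ((- h *: y) *m x^T) 0 0).
  transitivity (k * \int[M]_x \int[G]_y F (x, y)).
    rewrite -expectZ; last exact: (bmf_integral G bF).
    by apply: eq_Rintegral => x _; rewrite GE.
  congr (_ * _); rewrite /Rintegral.
  have iF : (M \x G)%E.-integrable setT (EFin \o F).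
    exact: bmf_integrable_fin (product_probability_lty _ _) bF.
  have := Fubini iF.
  have -> : (\int[M]_x \int[G]_y (EFin \o F) (x, y) =
      \int[M]_x (\int[G]_y F (x, y))%R%:E)%E.
    apply: eq_integral => x _; rewrite /Rintegral fineK//.
    by apply: integrable_fin_num => //; apply: bmf_integrable; exact: bmf_pair1.
  rewrite /Rintegral => ->; congr fine; apply: eq_integral => y _.
  rewrite fineK; last first.
    apply: integrable_fin_num => //.
    apply: (bmf_integrable M (f := fun x : rV => cos (h * (c *m y^T) 0 0 + ((- h *: y) *m x^T) 0 0))).
    by apply: bmf_cos; apply: measurable_funD.
  apply: eq_integral => x _; rewrite /F /=; congr (cos _)%:E.
  rewrite -!scalemxAl mulmxBl !mxE mulrBr; congr (_ + _).
  rewrite mulNr; congr (- (_ * _)).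
  by apply: eq_bigr => i _; rewrite !mxE mulrC.
rewrite E; under eq_fun do rewrite E.
apply: cvgMr.
pose H (M : probability rV R) (y : rV) : R :=
  \int[M]_x cos (h * (c *m y^T) 0 0 + ((- h *: y) *m x^T) 0 0).
have bH M : bmf (H M).
  apply: (bmf_integral M (F := fun z : rV * rV =>
    cos (h * (c *m z.1^T) 0 0 + ((- h *: z.1) *m z.2^T) 0 0))).
  apply: bmf_cos; apply: measurable_funD.
    apply: measurable_funM => //.
    exact: (measurableT_comp (mdot c) measurable_fst).
  under eq_fun do rewrite -scalemxAl mxE.
  by apply: measurable_funM.
have [|||||//] := @Rdominated_cvg _ _ _ G (fun n => H (mu n)) (H N) (cst 1).
- by move=> n; case: (bH (mu n)).
- by case: (bH N).
- exact: (bmf_integrable G (bmf_cst _ 1)).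
- move=> n y; apply: expect_normE => [|x]; last exact: cos_max.
  by case: (bmf_cos (f := fun x : rV => h * (c *m y^T) 0 0 + ((- h *: y) *m x^T) 0 0))
    => //; exact: measurable_funD.
- by move=> y; exact: cf.
Qed.

Section lipschitz.
Variables (phi : rV -> R) (B L : R).
Hypothesis mphi : measurable_fun setT phi.
Hypothesis phi0 : forall x, 0 <= phi x.
Hypothesis phiB : forall x, phi x <= B.
Hypothesis phiL : forall x y, `|phi x - phi y| <= L * `|x - y|.

Let bphi : bmf phi.
Proof. by split => //; exists B => x; rewrite ger0_norm. Qed.

Let integrable_gauss : leb.-integrable setT (EFin \o gauss_row).
Proof.
apply/integrableP; split; first by apply/measurable_EFinP; exact: measurable_gauss_row.
rewrite (eq_integral (fun z => (gauss_row z)%:E)) ?integral_gauss_row ?ltry//.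
by move=> z _ /=; rewrite ger0_norm// gauss_row_ge0.
Qed.

Let integrable_bmf_gauss (k : rV -> R) : bmf k ->
  leb.-integrable setT (EFin \o (fun z => k z * gauss_row z)).
Proof.
move=> bk; have := integrableM_bmf integrable_gauss bk.
by apply: eq_integrable => // z _ /=; rewrite mulrC.
Qed.

Let Phi t x := \int[leb]_z (phi (x + t *: z) * gauss_row z).

Let bphit (t : R) (x : rV) : bmf (fun z : rV => phi (x + t *: z)).
Proof. exact: bmf_precomp bphi (measurable_row_lin x t). Qed.

Let intPhi (t : R) (x : rV) :
  (\int[leb]_z (phi (x + t *: z) * gauss_row z)%:E = (Phi t x)%:E)%E.
Proof.
rewrite /Phi /Rintegral fineK//.
by apply: integrable_fin_num => //; exact: integrable_bmf_gauss (bphit t x).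
Qed.

Let bPhi t : bmf (Phi t).
Proof.
have m1 : measurable_fun setT (fun p : rV * rV => p.1 + t *: p.2).
  apply: measurable_row => i; under eq_fun do rewrite !mxE.
  apply: measurable_funD.
    exact: (measurableT_comp (measurable_coord i) measurable_fst).
  apply: measurable_funM => //.
  exact: (measurableT_comp (measurable_coord i) measurable_snd).
split.
  have := @measurable_fun_fubini_tonelli_F _ _ _ _ R leb
    (fun p : rV * rV => (phi (p.1 + t *: p.2) * gauss_row p.2)%:E).
  move=> mF; apply/measurable_EFinP.
  rewrite (_ : _ \o _ = fun x => \int[leb]_z
      (phi (x + t *: z) * gauss_row z)%:E)%E; last first.
    by apply/funext => x; rewrite /= intPhi.
  apply: mF => [|p]; last by rewrite lee_fin mulr_ge0// gauss_row_ge0.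
  apply/measurable_EFinP; apply: measurable_funM.
    exact: (measurableT_comp mphi m1).
  exact: (measurableT_comp measurable_gauss_row measurable_snd).
exists B => x; rewrite -lee_fin ger0_norm; last first.
  by apply: Rintegral_ge0 => z _; rewrite mulr_ge0// gauss_row_ge0.
rewrite -intPhi -[leRHS]mule1 -integral_gauss_row -ge0_integralZl//; first last.
- exact: le_trans (phiB 0).
- by move=> z _; rewrite lee_fin gauss_row_ge0.
- by apply/measurable_EFinP; exact: measurable_gauss_row.
apply: ge0_le_integral => //.
- by move=> z _; rewrite lee_fin mulr_ge0// gauss_row_ge0.
- by case/integrableP : (integrable_bmf_gauss (bphit t x)).
- apply/measurable_EFinP; apply: measurable_funM => //; exact: measurable_gauss_row.
- by move=> z _; rewrite -EFinM lee_fin ler_wpM2r// gauss_row_ge0.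
Qed.

(** A bound on the smoothing error that is uniform in the point. The minimum with [B] keeps the
    integrand bounded, so that it tends to 0 without any moment of the Gaussian. *)
Let eps t := \int[leb]_z (Num.min B (L * (t * `|z|)) * gauss_row z).

Let bmin t : 0 < t -> bmf (fun z : rV => Num.min B (L * (t * `|z|))).
Proof.
move=> t0; have B0 : 0 <= B := le_trans (phi0 0) (phiB 0).
have LL (z : rV) : 0 <= L * (t * `|z|).
  have := phiL (t *: z) 0; rewrite subr0 normrZ gtr0_norm//.
  exact: le_trans.
split.
  apply: measurable_minr => //; apply: measurable_funM => //.
  apply: measurable_funM => //.
  by apply: continuous_measurable_row; exact: norm_continuous.
by exists B => z; rewrite ger0_norm ?ge_min ?lexx// le_min B0 LL.
Qed.

Let Phi_close t x : 0 < t -> `|Phi t x - phi x| <= eps t.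
Proof.
move=> t0; have e1 : phi x = \int[leb]_z (phi x * gauss_row z).
  by rewrite RintegralZl// /Rintegral (integral_gauss_row : integral _ _ _ = _) mulr1.
have i1 := integrable_bmf_gauss (bphit t x).
have i2 := integrable_bmf_gauss (bmf_cst _ (phi x)).
rewrite e1 /Phi -RintegralB//.
have i12 := integrable_bmf_gauss (bmfB (bphit t x) (bmf_cst _ (phi x))).
apply: le_trans (le_normr_Rintegral _ _) _ => //.
  by under eq_fun do rewrite /= -mulrBl.
apply: le_Rintegral => //.
- under eq_fun do rewrite /= -mulrBl normrM (ger0_norm (gauss_row_ge0 _)).
  apply: (integrable_bmf_gauss (k := fun z => `|phi (x + t *: z) - phi x|)).
  have [mm [M Mb]] := bmfB (bphit t x) (bmf_cst _ (phi x)).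
  split; first exact: (measurableT_comp (@normr_measurable R setT) mm).
  by exists M => z; rewrite normr_id; exact: Mb.
- exact: integrable_bmf_gauss (bmin t0).
- move=> z _; rewrite -mulrBl normrM (ger0_norm (gauss_row_ge0 _)).
  apply: ler_wpM2r; first exact: gauss_row_ge0.
  rewrite le_min; apply/andP; split.
    by rewrite ler_norml; have := phi0 x; have := phiB x;
      have := phi0 (x + t *: z); have := phiB (x + t *: z); lra.
  by apply: le_trans (phiL _ _) _; rewrite addrAC subrr add0r normrZ gtr0_norm.
Qed.

Let eps_cvg : (fun n => eps n.+1%:R^-1) @ \oo --> (0 : R).
Proof.
have t0 n : (0 : R) < n.+1%:R^-1 by rewrite invr_gt0.
have [|||||_] := @Rdominated_cvg _ _ _ leb
   (fun n z => Num.min B (L * (n.+1%:R^-1 * `|z|)) * gauss_row z) (fun=> 0)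
   (fun z => B * gauss_row z).
- by move=> n; case/integrableP : (integrable_bmf_gauss (bmin (t0 n))) => /measurable_EFinP.
- by [].
- exact: (integrable_bmf_gauss (bmf_cst _ B)).
- move=> n z; have B0 : 0 <= B := le_trans (phi0 0) (phiB 0).
  have LL : 0 <= L * (n.+1%:R^-1 * `|z|).
    have := phiL (n.+1%:R^-1 *: z) 0; rewrite subr0 normrZ gtr0_norm//.
    exact: le_trans.
  rewrite normrM (ger0_norm (gauss_row_ge0 _)) ler_wpM2r ?gauss_row_ge0//.
  by rewrite ger0_norm ?ge_min ?lexx// le_min B0 LL.
- move=> z; rewrite -[X in _ --> X](mul0r (gauss_row z)); apply: cvgMl.
  have B0 : 0 <= B := le_trans (phi0 0) (phiB 0).
  rewrite -[X in _ --> X](min_r B0).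
  have : (fun n : nat => L * (n.+1%:R^-1 * `|z|)) @ \oo --> (0 : R).
    rewrite -[X in _ --> X](mulr0 L); apply: cvgMr.
    by rewrite -[X in _ --> X](mul0r `|z|); apply: cvgMl; exact: cvg_harmonic.
  exact: cvg_minr.
- by rewrite /Rintegral integral0.
Qed.

(** This is [t ^+ d] times the density of [M] convolved with a Gaussian of scale [t]. Smoothing
    provides densities, and these converge pointwise by [cvg_gauss_row]. *)
Let dens (M : probability rV R) t c := \int[M]_x gauss_row (t^-1 *: (c - x)).

Let dens_ge0 M t c : 0 <= dens M t c.
Proof. by apply: Rintegral_ge0 => x _; exact: gauss_row_ge0. Qed.

Let bdens M t : bmf (dens M t).
Proof.
exact: (bmf_integral M (F := fun p : rV * rV => gauss_row (t^-1 *: (p.1 - p.2)))).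
Qed.

Let smoothing (M : probability rV R) t : 0 < t ->
  leb.-integrable setT (EFin \o (fun c => phi c * dens M t c)) /\
  \int[leb]_c (phi c * dens M t c) = t ^+ d * \int[M]_x Phi t x.
Proof.
move=> t0.
have bF : bmf (fun p : rV * rV => phi p.2 * gauss_row (t^-1 *: (p.2 - p.1))).
  apply: bmfM; first exact: (bmf_precomp bphi measurable_snd).
  apply: (bmf_precomp (bgauss2 t^-1) (g := fun p : rV * rV => (p.2, p.1))).
  by apply: measurable_fun_pair.
have E : (\int[leb]_c (phi c * dens M t c)%:E = (t ^+ d * \int[M]_x Phi t x)%:E)%E.
  transitivity (\int[leb]_c \int[M]_x (phi c * gauss_row (t^-1 *: (c - x)))%:E)%E.
    apply: eq_integral => c _; rewrite /dens -expectZ; last first.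
      exact: (bmf_pair1 c (bgauss2 t^-1)).
    rewrite /Rintegral fineK//; apply: integrable_fin_num => //.
    exact: bmf_integrable (bmf_pair2 c bF).
  rewrite -(@fubini_tonelli _ _ _ _ R M leb
     (fun p : rV * rV => (phi p.2 * gauss_row (t^-1 *: (p.2 - p.1)))%:E)); first last.
  - by move=> p; rewrite lee_fin mulr_ge0// gauss_row_ge0.
  - by apply/measurable_EFinP; case: bF.
  transitivity (\int[M]_x ((t ^+ d * Phi t x)%:E))%E.
    apply: eq_integral => x _ /=.
    rewrite (@ge0_integral_affine _ _ _ x t)//; last 2 first.
    - by apply/measurable_EFinP; case: (bmf_pair1 x bF).
    - by move=> z; rewrite lee_fin mulr_ge0// gauss_row_ge0.
    rewrite EFinM -intPhi; congr (_ * _)%E; apply: eq_integral => z _.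
    by rewrite addrAC subrr add0r scalerA mulVf ?gt_eqF// scale1r.
  rewrite -(expectZ M (t ^+ d) (bPhi t)) /Rintegral fineK//; apply: integrable_fin_num => //.
  by apply: bmf_integrable; apply: bmfM; [exact: bmf_cst|exact: bPhi].
split; last by rewrite /Rintegral E.
apply/integrableP; split.
  by apply/measurable_EFinP; apply: measurable_funM => //; case: (bdens M t).
rewrite (eq_integral (fun c => (phi c * dens M t c)%:E)) ?E ?ltry//.
by move=> z _ /=; rewrite ger0_norm// mulr_ge0.
Qed.

(* Replacing the n-th smoothed density by its minimum with the limit one gives
   a lower bound to which dominated convergence applies. *)
Let smooth_lower t e : 0 < t -> 0 < e ->
  \forall n \near \oo, \int[N]_x Phi t x - e <= \int[mu n]_x Phi t x.
Proof.
move=> t0 e0.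
have td : 0 < t ^+ d by rewrite exprn_gt0.
have mdens M : measurable_fun setT (dens M t) by case: (bdens M t).
have [|||||_ cv] := @Rdominated_cvg _ _ _ leb
  (fun n c => phi c * Num.min (dens (mu n) t c) (dens N t c))
  (fun c => phi c * dens N t c) (fun c => phi c * dens N t c).
- by move=> n; apply: measurable_funM => //; exact: measurable_minr.
- exact: measurable_funM.
- by case: (smoothing N t0).
- move=> n c; rewrite ger0_norm ?mulr_ge0 ?le_min ?dens_ge0//.
  by rewrite ler_wpM2l// ge_min lexx orbT.
- move=> c; apply: cvgMr; rewrite -[X in _ --> X](minxx (dens N t c)).
  by under eq_fun do rewrite minC; apply: cvg_minr; exact: cvg_gauss_row.
have /cvgrPdist_le/(_ _ (mulr_gt0 td e0)) := cv.
apply: filterS => n /(le_trans (ler_norm _)).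
have [iN EN] := smoothing N t0; have [iM EM] := smoothing (mu n) t0.
have le1 : \int[leb]_c (phi c * Num.min (dens (mu n) t c) (dens N t c)) <=
    \int[leb]_c (phi c * dens (mu n) t c).
  apply: le_Rintegral => //.
    apply: (le_integrable _ _ _ iM) => //.
      apply/measurable_EFinP; apply: measurable_funM => //.
      exact: measurable_minr.
    move=> c _; rewrite lee_fin !ger0_norm ?mulr_ge0 ?le_min ?dens_ge0//.
    by rewrite ler_wpM2l// ge_min lexx.
  by move=> c _; rewrite ler_wpM2l// ge_min lexx.
move: le1; rewrite EN EM => le1 le2.
rewrite -(ler_pM2l td) mulrBr; lra.
Qed.

(** One-sided, because pointwise convergence of densities directly yields a bound from below; the
    upper bound will come from the lower one for [M - phi]. *)
Lemma lipschitz_lower e : 0 < e ->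
  \forall n \near \oo, \int[N]_x phi x - e <= \int[mu n]_x phi x.
Proof.
move=> e0; have e3 : 0 < e / 3 by rewrite divr_gt0.
have /cvgrPdist_le/(_ _ e3) [m _ /(_ m (leqnn m))] := eps_cvg.
set t := m.+1%:R^-1; have t0 : 0 < t by rewrite invr_gt0.
rewrite /= sub0r normrN => /(le_trans (ler_norm _)) epst.
have close (M : probability rV R) :
    `|\int[M]_x Phi t x - \int[M]_x phi x| <= e / 3.
  rewrite -expectB//; apply: expect_normE => [|x].
    by case: (bmfB (bPhi t) bphi).
  exact: le_trans (Phi_close _ t0) _.
apply: filterS (smooth_lower t0 e3) => n.
have := close N; have := close (mu n).
rewrite !ler_norml => /andP[a1 a2] /andP[a3 a4] a5; lra.
Qed.

End lipschitz.

End characteristic_functions.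

End gaussian_smoothing.

(** * Approximation of continuous functions from below by Lipschitz ones *)

Section inf_convolution.
Context {R : realType} (d : nat).
Notation rV := ('rV[R]_d).
Variables (phi : rV -> R) (B : R).
Hypothesis cphi : continuous phi.
Hypothesis phi0 : forall x, 0 <= phi x.
Hypothesis phiB : forall x, phi x <= B.

(** The Pasch-Hausdorff envelope: the largest [k]-Lipschitz minorant of [phi]. *)
Definition inf_convolution (k : nat) (x : rV) : R :=
  inf [set phi y + k%:R * `|x - y| | y in [set: rV]].

Let nempty k (x : rV) : [set phi y + k%:R * `|x - y| | y in [set: rV]] !=set0.
Proof. by exists (phi x + k%:R * `|x - x|); exists x. Qed.

Let lb k (x : rV) : lbound [set phi y + k%:R * `|x - y| | y in [set: rV]] 0.
Proof. by move=> _ [y _ <-]; rewrite addr_ge0// mulr_ge0. Qed.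

Let inf_convolution_le k (x y : rV) : inf_convolution k x <= phi y + k%:R * `|x - y|.
Proof. by apply: ge_inf; [exists 0; exact: lb|exists y]. Qed.

Let inf_convolution_ge0 k x : 0 <= inf_convolution k x.
Proof. by apply: lb_le_inf => //; exact: lb. Qed.

Let inf_convolution_le_id k x : inf_convolution k x <= phi x.
Proof. by apply: le_trans (inf_convolution_le k x x) _; rewrite subrr normr0 mulr0 addr0. Qed.

Let inf_convolution_lip k x y :
  `|inf_convolution k x - inf_convolution k y| <= k%:R * `|x - y|.
Proof.
have h a b : inf_convolution k a - k%:R * `|a - b| <= inf_convolution k b.
  apply: lb_le_inf => // _ [z _ <-].
  rewrite lerBlDr; apply: le_trans (inf_convolution_le k a z) _.
  by rewrite -addrA -mulrDr lerD2l ler_wpM2l// [leRHS]addrC ler_distD.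
rewrite ler_norml; have := h x y; have := h y x; rewrite distrC; lra.
Qed.

Let inf_convolution_cvg x : inf_convolution ^~ x @ \oo --> phi x.
Proof.
apply/cvgrPdist_le => e e0.
have /cvgrPdist_le/(_ e e0)/nbhs_ballP[dl dl0 near_x] := @cphi x.
have B0 : 0 <= B := le_trans (phi0 0) (phiB 0).
near=> k.
(* Beyond distance [dl] the penalty alone exceeds [B], hence [phi x]; only points close to [x]
   compete in the infimum. *)
have kB : B <= k%:R * dl.
  by rewrite -ler_pdivrMr//; near: k; exact: nbhs_infty_ger.
rewrite ger0_norm ?subr_ge0// lerBlDr -lerBlDl; apply: lb_le_inf => // _ [y _ <-].
have [xy|xy] := ltP `|x - y| dl.
  have := near_x y; rewrite -ball_normE => /(_ xy) /(le_trans (ler_norm _)) h.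
  have : 0 <= k%:R * `|x - y| by rewrite mulr_ge0.
  lra.
have : k%:R * dl <= k%:R * `|x - y| by rewrite ler_wpM2l.
have := phi0 y; have := phiB x; lra.
Unshelve. all: by end_near. Qed.

Lemma lipschitz_approximation (N : probability rV R) (e : R) : 0 < e ->
  exists (phi' : rV -> R) (L : R), [/\ measurable_fun setT phi',
    forall x, 0 <= phi' x <= phi x,
    0 <= L, forall x y, `|phi' x - phi' y| <= L * `|x - y| &
    \int[N]_x phi x - e <= \int[N]_x phi' x].
Proof.
move=> e0.
have mic k : measurable_fun setT (inf_convolution k).
  apply: continuous_measurable_row => x.
  apply/(@cvgrPdist_le _ _ _ _ (@nbhs_filter rV x)) => a a0.
  have k1 : 0 < k%:R + 1 :> R by rewrite ltr_wpDl.
  have h : nbhs x (ball x (a / (k%:R + 1))) by apply: nbhsx_ballx; exact: divr_gt0.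
  apply: filterS h => y; rewrite -ball_normE /= => /ltW.
  rewrite ler_pdivlMr// => xy; apply: le_trans (inf_convolution_lip k x y) _.
  have := normr_ge0 (x - y); nra.
have [|||||_] := @Rdominated_cvg _ _ _ N inf_convolution phi (cst B).
- exact: mic.
- exact: continuous_measurable_row.
- exact: (bmf_integrable N (bmf_cst _ B)).
- by move=> k x; rewrite ger0_norm//; exact: le_trans (phiB x).
- exact: inf_convolution_cvg.
move/cvgrPdist_le => /(_ e e0) [k _ /(_ k (leqnn k))] /(le_trans (ler_norm _)) h.
exists (inf_convolution k), k%:R; split => //.
- by move=> x; rewrite inf_convolution_ge0 inf_convolution_le_id.
- by rewrite lerBlDl -lerBlDr.
Qed.

End inf_convolution.

(** * Weak convergence up to an error vanishing in probability *)

Section slutsky.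
Context {R : realType} dO (O : measurableType dO) (P : probability O R) (d : nat).
Notation rV := ('rV[R]_d).
Variables (V Z : nat -> O -> rV) (N : probability rV R).
Hypothesis mV : forall n, measurable_fun setT (V n).
Hypothesis mZ : forall n, measurable_fun setT (Z n).
Hypothesis cf : forall (u : rV) (th : R),
  (fun n => \int[P]_w cos (th + (u *m (V n w)^T) 0 0)) @ \oo -->
  \int[N]_x cos (th + (u *m x^T) 0 0).
Hypothesis VZ : forall dl e : R, 0 < dl -> 0 < e ->
  \forall n \near \oo, (P [set w | (dl < `|Z n w - V n w|)%R] <= e%:E)%E.

Let lawV n : {RV P >-> rV} :=
  HB.pack (V n) (isMeasurableFun.Build _ _ _ _ _ (mV n)).

Let integral_law n (k : rV -> R) : bmf k ->
  \int[distribution P (lawV n)]_x k x = \int[P]_w k (V n w).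
Proof.
move=> bk; rewrite /Rintegral; congr fine.
rewrite integral_distribution//.
  by apply/measurable_EFinP; case: bk.
by apply: (bmf_integrable P (f := fun w => k (V n w))); exact: bmf_precomp bk (mV n).
Qed.

Let lipschitz_lowerZ (phi : rV -> R) (B L e : R) : measurable_fun setT phi ->
  (forall x, 0 <= phi x <= B) -> 0 <= L ->
  (forall x y, `|phi x - phi y| <= L * `|x - y|) -> 0 < e ->
  \forall n \near \oo, \int[N]_x phi x - e <= \int[P]_w phi (Z n w).
Proof.
move=> mphi phiB L0 phiL e0.
have phi0 x : 0 <= phi x by case/andP : (phiB x).
have phiB' x : phi x <= B by case/andP : (phiB x).
have B0 : 0 <= B := le_trans (phi0 0) (phiB' 0).
have bphi : bmf phi by split => //; exists B => x; rewrite ger0_norm.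
have e3 : 0 < e / 3 by rewrite divr_gt0.
(* One third of [e] each for the smoothing, for the Lipschitz error and for the exceptional event;
   adding 1 to [L] and [B] covers the case where they vanish. *)
have dl0 : 0 < e / 3 / (L + 1) by rewrite divr_gt0// ltr_wpDl.
have p0 : 0 < e / 3 / (B + 1) by rewrite divr_gt0// ltr_wpDl.
have cf' (u : rV) (th : R) :
    (fun n => \int[distribution P (lawV n)]_x cos (th + (u *m x^T) 0 0)) @ \oo -->
    \int[N]_x cos (th + (u *m x^T) 0 0).
  rewrite (_ : (fun n => _) = fun n =>
      \int[P]_w cos (th + (u *m (V n w)^T) 0 0)); first exact: cf.
  apply/funext => n; apply: (integral_law n (k := fun x : rV => cos (th + (u *m x^T) 0 0))).
  apply: bmf_cos; apply: measurable_funD => //.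
  under eq_fun do rewrite row_mulmx_tr.
  by apply: measurable_sum => i; apply: measurable_funM => //; exact: measurable_coord.
apply: filterS2 (lipschitz_lower cf' mphi phi0 phiB' phiL e3) (VZ dl0 p0) => n.
rewrite integral_law// => h1 h2.
set dl := e / 3 / (L + 1) in dl0 h2; set A := [set w | _] in h2.
have mA : measurable A.
  have : measurable_fun setT (fun w => `|Z n w - V n w|).
    apply: measurableT_comp.
      by apply: continuous_measurable_row; exact: norm_continuous.
    apply: measurable_row => i; under eq_fun do rewrite !mxE.
    by apply: measurable_funB; exact: (measurableT_comp (measurable_coord i)).
  move=> mD; rewrite /A -[X in measurable X]setTI.
  by have := measurable_fun_ltr (measurable_cst dl) mD measurableT; exact.
have bV : bmf (fun w => phi (V n w)) by exact: bmf_precomp bphi (mV n).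
have bZ : bmf (fun w => phi (Z n w)) by exact: bmf_precomp bphi (mZ n).
have bA : bmf (\1_A : O -> R).
  split; first exact: measurable_indic.
  by exists 1 => w; rewrite ger0_norm// indicE; case: (_ \in _).
(* Off [A] the two values of [phi] differ by at most [L * dl]; on [A] by at most the range [B]. *)
have h3 : \int[P]_w phi (V n w) <=
    \int[P]_w (phi (Z n w) + (L * dl + B * \1_A w)).
  apply: expect_le => //.
    by apply: bmfD => //; apply: bmfD; [exact: bmf_cst|apply: bmfM => //; exact: bmf_cst].
  move=> w; rewrite indicE; case: (boolP (w \in A)) => [_|].
    rewrite mulr1; have := phi0 (Z n w); have := phiB' (V n w).
    have : 0 <= L * dl by rewrite mulr_ge0// ltW.
    lra.
  rewrite notin_setE /A /= => /negP; rewrite -leNgt mulr0 addr0 => h4.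
  have := phiL (Z n w) (V n w); rewrite ler_norml => /andP[h5 _].
  have : L * `|Z n w - V n w| <= L * dl by rewrite ler_wpM2l.
  lra.
move: h3; rewrite expectD//; last first.
  by apply: bmfD; [exact: bmf_cst|apply: bmfM => //; exact: bmf_cst].
rewrite expectD//; [|exact: bmf_cst|by apply: bmfM => //; exact: bmf_cst].
rewrite expect_cst expectZ//.
have : \int[P]_w \1_A w <= e / 3 / (B + 1).
  by rewrite /Rintegral integral_indic// setIT -lee_fin fineK ?fin_num_measure.
have h5 : L * dl <= e / 3.
  rewrite /dl mulrCA ler_piMr ?(ltW e3)// ler_pdivrMr ?ltr_wpDl// mul1r; lra.
have h6 : B * (e / 3 / (B + 1)) <= e / 3.
  rewrite mulrCA ler_piMr ?(ltW e3)// ler_pdivrMr ?ltr_wpDl// mul1r; lra.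
move=> h7 h8; have := ler_wpM2l B0 h7; lra.
Qed.

Let continuous_lowerZ (phi : rV -> R) (B e : R) : continuous phi ->
  (forall x, 0 <= phi x <= B) -> 0 < e ->
  \forall n \near \oo, \int[N]_x phi x - e <= \int[P]_w phi (Z n w).
Proof.
move=> cphi phiB e0.
have phi0 x : 0 <= phi x by case/andP : (phiB x).
have phiB' x : phi x <= B by case/andP : (phiB x).
have e2 : 0 < e / 2 by rewrite divr_gt0.
have [psi [L [mpsi psi_phi L0 psiL hN]]] := lipschitz_approximation cphi phi0 phiB' N e2.
have psiB x : 0 <= psi x <= B.
  by case/andP : (psi_phi x) => -> h; exact: le_trans h (phiB' x).
apply: filterS (lipschitz_lowerZ mpsi psiB L0 psiL e2) => n h.
have : \int[P]_w psi (Z n w) <= \int[P]_w phi (Z n w).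
  apply: expect_le => [||w]; last by case/andP : (psi_phi (Z n w)).
    apply: bmf_precomp (mZ n); split => //.
    by exists B => x; rewrite ger0_norm; case/andP : (psiB x).
  apply: bmf_precomp (mZ n); split; first exact: continuous_measurable_row.
  by exists B => x; rewrite ger0_norm.
lra.
Qed.

Lemma slutsky_cvg (phi : rV -> R) : continuous phi -> bounded_fun phi ->
  (fun n => \int[P]_w phi (Z n w)) @ \oo --> \int[N]_x phi x.
Proof.
move=> cphi [M0 [_ phiM0]]; pose M := M0 + 1.
have phiM x : `|phi x| <= M by apply: phiM0; rewrite // ltrDl.
have bphi : bmf phi by split; [exact: continuous_measurable_row|exists M].
have bZ n : bmf (fun w => phi (Z n w)) by exact: bmf_precomp bphi (mZ n).
(* The lower bound applied to both [M + phi] and [M - phi] gives the two sides of the limit. *)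
have b1 x : 0 <= M + phi x <= 2 * M by have := phiM x; rewrite ler_norml; lra.
have b2 x : 0 <= M - phi x <= 2 * M by have := phiM x; rewrite ler_norml; lra.
have c1 : continuous (fun x => M + phi x).
  move=> x; apply: (@continuous_comp _ _ _ phi (fun r : R => M + r)); first exact: cphi.
  by apply: cvgD; [exact: cvg_cst|exact: cvg_id].
have c2 : continuous (fun x => M - phi x).
  move=> x; apply: (@continuous_comp _ _ _ phi (fun r : R => M - r)); first exact: cphi.
  by apply: cvgB; [exact: cvg_cst|exact: cvg_id].
apply/cvgrPdist_le => e e0.
apply: filterS2 (continuous_lowerZ c1 b1 e0) (continuous_lowerZ c2 b2 e0) => n.
rewrite !expectB ?expectD ?expect_cst//; try exact: bmf_cst.
rewrite ler_norml; lra.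
Qed.

End slutsky.

(** * The central limit theorem for characteristic functions *)

Section central_limit.
Context {R : realType} dO (O : measurableType dO) (P : probability O R).
Context d1 d2 (T1 : measurableType d1) (T2 : measurableType d2).
Variables (X : nat -> {RV P >-> T1}) (e : nat -> {RV P >-> T2}).
Hypotheses (hX : iid X) (he : iid e) (hXe : independent_seqs X e).

Let pair_index (i : nat) : set (nat + nat) :=
  [set z | match z with inl j => j = i | inr j => j = i end].

Let initial_indices (m : nat) : set (nat + nat) :=
  [set z | match z with inl j => (j < m)%N | inr j => (j < m)%N end].

Let disjoint_indices m : pair_index m `&` initial_indices m = set0.
Proof. by rewrite -subset0 => -[j|j] /= [->]; rewrite ltnn. Qed.

(** Equality of the marginal laws extends to the pairs because, by independence, each coordinate can
    be integrated separately. *)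
Lemma expect_pair (k : T1 * T2 -> R) i : bmf k ->
  \int[P]_w k (X i w, e i w) = \int[P]_w k (X 0%N w, e 0%N w).
Proof.
move=> bk.
have E j : \int[P]_w k (X j w, e j w) =
    \int[P]_w \int[P]_w' k (X j w, e j w').
  have dis : [set (inl j : nat + nat)] `&` [set (inr j : nat + nat)] = set0.
    by rewrite -subset0 => z [/= ->].
  rewrite (subsample_expect hX he hXe dis (F := fun w w' => k (X j w, e j w')))//.
  have mX := subsample_X (X := X) (e := e) (J := [set inl j]) (erefl (inl j)).
  have me := subsample_e (X := X) (e := e) (J := [set inr j]) (erefl (inr j)).
  apply: (bmf_precomp bk); apply: measurable_fun_pair.
    exact: (measurableT_comp mX).
  exact: (measurableT_comp me).
rewrite (E i) (E 0%N).
under eq_Rintegral => w _.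
  rewrite (expect_X he i (k := fun y => k (X i w, y))); last first.
    by case: (bmf_pair1 (X i w) bk).
  over.
rewrite (expect_X hX i (k := fun x => \int[P]_w' k (x, e 0%N w')))//.
by case: (bmf_expect P (eta := e 0%N) (measurable_funPT _) bk).
Qed.

Variable omega : T1 * T2 -> R.
Hypotheses (momega : measurable_fun setT omega)
  (iomega2 : P.-integrable setT
     (EFin \o (fun w => omega (X 0%N w, e 0%N w) ^+ 2)))
  (omega0 : \int[P]_w omega (X 0%N w, e 0%N w) = 0).

Let W i w := omega (X i w, e i w).

Let mW (J : set (nat + nat)) i : J (inl i) -> J (inr i) ->
  measurable_fun setT (W i : subsample X e J -> R).
Proof.
move=> Ji Ji'; apply: (measurableT_comp momega); apply: measurable_fun_pair.
  exact: (subsample_X (J := J)).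
exact: (subsample_e (J := J)).
Qed.

Let mW' i : measurable_fun setT (W i : O -> R).
Proof.
by apply: (measurableT_comp momega); apply: measurable_fun_pair; exact: measurable_funPT.
Qed.

Let v := \int[P]_w (W 0%N w ^+ 2).

Section step.
Variables (c rho th : R).
Hypothesis rho1 : 0 <= rho <= 1.

Let S (m : nat) w := \sum_(i < m) c * W i w.

Let mS m : measurable_fun setT (fun w : subsample X e (initial_indices m) => th + S m w).
Proof.
apply: measurable_funD => //; apply: measurable_sum => i.
by apply: measurable_funM => //; apply: mW => /=.
Qed.

Let mS' m : measurable_fun setT (fun w : O => th + S m w).
Proof.
apply: measurable_funD => //; apply: measurable_sum => i.
exact: measurable_funM.
Qed.

Let mcW m : measurable_fun setT (fun w : subsample X e (pair_index m) => c * W m w).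
Proof. by apply: measurable_funM => //; apply: mW. Qed.

Let mcW' m : measurable_fun setT (fun w : O => c * W m w).
Proof. exact: measurable_funM. Qed.

Let a := `|\int[P]_w cos (c * W 0%N w) - rho|.
Let b := `|\int[P]_w sin (c * W 0%N w)|.

Let mcomega : measurable_fun setT (fun z => c * omega z).
Proof. exact: measurable_funM. Qed.

(** The addition formula separates the last summand, which is independent of the others: its cosine
    has mean within [a] of [rho] and its sine contributes at most [b]. *)
Let expect_step m :
  `|\int[P]_w cos (th + S m.+1 w) - rho * \int[P]_w cos (th + S m w)| <= a + b.
Proof.
have -> : \int[P]_w cos (th + S m.+1 w) =
    \int[P]_w (cos (c * W m w) * cos (th + S m w) -
               sin (c * W m w) * sin (th + S m w)).
  by apply: eq_Rintegral => w _; rewrite -cosD /S big_ord_recr/=; congr cos; ring.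
rewrite expectB; last 2 first.
- by apply: bmfM; exact: bmf_cos.
- by apply: bmfM; exact: bmf_sin.
rewrite (subsample_expectM hX he hXe (disjoint_indices m)
  (U := fun w => cos (c * W m w)) (V := fun w => cos (th + S m w)));
  [|exact: bmf_cos|exact: bmf_cos].
rewrite (subsample_expectM hX he hXe (disjoint_indices m)
  (U := fun w => sin (c * W m w)) (V := fun w => sin (th + S m w)));
  [|exact: bmf_sin|exact: bmf_sin].
rewrite (expect_pair (k := fun z => cos (c * omega z)) m (bmf_cos mcomega)).
rewrite (expect_pair (k := fun z => sin (c * omega z)) m (bmf_sin mcomega)).
set A := \int[P]_w _; set B := \int[P]_w _; set C := \int[P]_w _; set D := \int[P]_w _.
have B1 : `|B| <= 1.
  by apply: expect_normE => [|w]; [case: (bmf_cos (mS' m))|exact: cos_max].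
have D1 : `|D| <= 1.
  by apply: expect_normE => [|w]; [case: (bmf_sin (mS' m))|exact: sin_max].
rewrite (_ : _ - _ = (A - rho) * B - C * D); last by ring.
apply: le_trans (ler_normB _ _) _; rewrite !normrM.
by apply: lerD; rewrite ler_piMr.
Qed.

(* With rho the characteristic function of a centered Gaussian step, the
   summands are replaced one at a time by such steps. *)
Lemma expect_cos_sum m :
  `|\int[P]_w cos (th + \sum_(i < m) c * W i w) - rho ^+ m * cos th| <=
  m%:R * (a + b).
Proof.
have /andP[r0 r1] := rho1.
elim: m => [|m IH].
  rewrite expr0 mul1r mul0r.
  under eq_Rintegral do rewrite big_ord0 addr0.
  by rewrite expect_cst subrr normr0.
rewrite -natr1 mulrDl mul1r exprS -mulrA [leRHS]addrC.
apply: le_trans (ler_distD (rho * \int[P]_w cos (th + S m w)) _ _) _.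
apply: lerD; first exact: expect_step.
rewrite -mulrBr normrM (ger0_norm r0).
by apply: le_trans IH; rewrite ler_piMl.
Qed.

End step.

(** Here [rho n] is chosen so that its power [n + 1] is the Gaussian value, and the total error
    [(n + 1) (a + b)] tends to 0 by the second-order expansion. The free phase [th] lets cosines
    carry both the real and the imaginary part of the characteristic function. *)
Theorem clt_cos (th : R) :
  (fun n => \int[P]_w cos (th + (Num.sqrt n%:R)^-1 * \sum_(i < n) W i w))
    @ \oo --> expR (- (v / 2)) * cos th.
Proof.
rewrite -cvg_shiftS; set c := fun n : nat => (Num.sqrt n.+1%:R)^-1 : R.
have v0 : 0 <= v by apply: Rintegral_ge0 => w _; exact: sqr_ge0.
pose rho n := expR (- (v / 2 * c n ^+ 2)).
have rho1 n : 0 <= rho n <= 1.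
  by rewrite expR_ge0 -expR0 ler_expR oppr_le0 mulr_ge0 ?sqr_ge0// divr_ge0.
have rhoE n : rho n ^+ n.+1 = expR (- (v / 2)).
  rewrite /rho -expRM_natl; congr expR.
  by rewrite /c exprVn sqr_sqrtr// mulrN mulrCA divff ?mulr1// pnatr_eq0.
have h1 := cvg_cos_sub_exp (mW' 0%N) iomega2.
have h2 := cvg_norm (FF := eventually_filter) (cvg_expect_sin (mW' 0%N) iomega2 omega0).
have := cvgD (FF := eventually_filter) h1 h2; rewrite normr0 addr0 => h3.
apply/cvgrPdist_le => ep ep0.
have /cvgrPdist_le := h3; move=> /(_ ep ep0); apply: filterS => n.
rewrite sub0r normrN distrC => /(le_trans (ler_norm _)); apply: le_trans.
have := expect_cos_sum (c n) th (rho1 n) n.+1.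
rewrite rhoE mulrDr -[X in _ + X * _](ger0_norm (ler0n R n.+1)) -normrM.
by under eq_Rintegral do rewrite -mulr_sumr.
Qed.

End central_limit.

(** * Taylor expansion and the bias of the kernel *)

Section univariate_taylor.
Context {R : realType}.

Lemma mean_value_bound (f df : R -> R) (t M : R) :
  (forall x : R, is_derive x (1 : R) f (df x)) ->
  (forall x, `|x| <= `|t| -> `|df x| <= M) -> `|f t - f 0| <= M * `|t|.
Proof.
move=> fdf dfM.
have fc a b : {within `[a, b], continuous f}.
  by apply: derivable_within_continuous => x _; exact: ex_derive.
have [t0|/ltW t0] := leP 0 t.
  have [c /[!in_itv]/= /andP[c0 ct] ->] := MVT_segment t0 (fun x _ => fdf x) (fc _ _).
  by rewrite subr0 normrM ler_wpM2r// dfM// !ger0_norm.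
have [c /[!in_itv]/= /andP[ct c0] E] := MVT_segment t0 (fun x _ => fdf x) (fc _ _).
rewrite distrC E sub0r normrM normrN ler_wpM2r// dfM//.
by rewrite !ler0_norm// lerN2.
Qed.

(** The function [phi a] stands for the derivative of order [a]. The remainder is obtained by
    iterating the mean value bound, which gives the constant [M] in place of [M / k!]. *)
Lemma taylor_bound (k : nat) (phi : nat -> R -> R) (M t : R) :
  (forall a (x : R), (a < k)%N -> is_derive x (1 : R) (phi a) (phi a.+1 x)) ->
  (forall x, `|phi k x| <= M) ->
  `|phi 0%N t - \sum_(a < k) t ^+ a / a`!%:R * phi a 0| <= M * `|t| ^+ k.
Proof.
elim: k phi t => [|k IH] phi t dphi phiM.
  by rewrite big_ord0 subr0 expr0 mulr1.
pose F (x : R) := phi 0%N x - \sum_(a < k.+1) x ^+ a / a`!%:R * phi a 0.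
pose dF (x : R) := phi 1%N x - \sum_(a < k) x ^+ a / a`!%:R * phi a.+1 0.
have dFE (x : R) : is_derive x (1 : R) F (dF x).
  have h0 := dphi 0%N x isT.
  have h1 (a : 'I_k) : is_derive x (1 : R)
      (fun x => x ^+ a.+1 / (a.+1)`!%:R * phi a.+1 0) (x ^+ a / a`!%:R * phi a.+1 0).
    rewrite (_ : (fun x => _) = (((a.+1)`!%:R)^-1 * phi a.+1 0) \*: ((@id R) ^+ a.+1)); last first.
      by apply/funext => y; rewrite /= -[RHS]/(_ * _) exprfctE; ring.
    apply: is_derive_eq; rewrite -[LHS]/(_ * ((_ * _) * _)) /= mulr1 factS natrM.
    have f0 : a`!%:R != 0 :> R by rewrite pnatr_eq0 -lt0n fact_gt0.
    have a0 : a.+1%:R != 0 :> R by rewrite pnatr_eq0.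
    move: (phi a.+1 0) (a`!%:R : R) (a.+1%:R : R) f0 a0 => z p q p0 q0.
    by field; rewrite p0 q0.
  have h2 := is_derive_sum h1.
  rewrite (_ : F = phi 0%N - cst (phi 0%N 0) -
      \sum_(a < k) (fun x => x ^+ a.+1 / (a.+1)`!%:R * phi a.+1 0)); last first.
    apply/funext => y; rewrite /F big_ord_recl expr0 fact0 divr1 mul1r.
    by rewrite /= !fctE fct_sumE opprD addrA.
  by apply: is_derive_eq; rewrite /dF subr0.
have := mean_value_bound (t := t) (M := M * `|t| ^+ k) dFE.
have -> : F 0 = 0.
  rewrite /F big_ord_recl expr0 fact0 divr1 mul1r big1 ?addr0 ?subrr// => a _.
  by rewrite exprS !mul0r.
rewrite subr0 exprSr mulrA; apply => x xt.
apply: le_trans (IH (fun a => phi a.+1) x _ phiM) _.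
  by move=> a y ak; exact: dphi.
by rewrite ler_wpM2l ?lerXn2r ?nnegrE// (le_trans _ (phiM 0)).
Qed.

Lemma is_derive_line (d : nat) (G : 'rV[R]_d -> R) (x v : 'rV[R]_d) (t : R) :
  derivable G (x + t *: v) v ->
  is_derive t (1 : R) (fun t : R => G (x + t *: v)) ('D_v G (x + t *: v)).
Proof.
move=> dG.
have E : (fun h : R => h^-1 *: (((fun t : R => G (x + t *: v)) \o shift t) (h *: 1) - G (x + t *: v))) =
  (fun h : R => h^-1 *: ((G \o shift (x + t *: v)) (h *: v) - G (x + t *: v))).
  apply/funext => h; congr (_ *: (G _ - _)).
  by rewrite /shift /= scalerDl -[h *: 1]/(h * 1) mulr1 addrCA.
by split; [rewrite /derivable E|rewrite /derive E].
Qed.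

End univariate_taylor.

Section multivariate_taylor.
Context {R : realType} (d : nat).
Notation rV := ('rV[R]_d).

(** A polynomial as an unreduced list of coefficients and exponents: only its values and a bound on
    its degree matter, so repeated monomials are harmless. *)
Definition poly_eval (l : seq (R * ('I_d -> nat))) (u : rV) : R :=
  \sum_(t <- l) t.1 * monomial t.2 u.

Definition degree_lt (k : nat) (l : seq (R * ('I_d -> nat))) : bool :=
  all (fun t => (\sum_i t.2 i < k)%N) l.

Lemma monomial0 (u : rV) : monomial (fun=> 0%N) u = 1.
Proof. by rewrite /monomial big1// => i _; rewrite expr0. Qed.

Lemma monomial_norm_le m (u : rV) : `|monomial m u| <= `|u| ^+ (\sum_i m i).
Proof.
rewrite /monomial normr_prod -prodrXr; apply: ler_prod => i _.
by rewrite normrX exprn_ge0//= lerXn2r ?nnegrE ?coord_le_norm.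
Qed.

Lemma monomial_degree0 m (u : rV) : (\sum_i m i)%N = 0%N -> monomial m u = 1.
Proof.
move=> /eqP m0; rewrite /monomial big1// => i _.
by move: m0; rewrite sum_nat_eq0 => /forallP/(_ i)/= /eqP ->; rewrite expr0.
Qed.

Lemma monomial_at0 m : (0 < \sum_i m i)%N -> monomial m (0 : rV) = 0.
Proof.
move=> m0; apply/eqP; rewrite -normr_le0; apply: le_trans (monomial_norm_le _ _) _.
by rewrite normr0 expr0n eqn0Ngt m0.
Qed.

Lemma monomialM_coord m (i : 'I_d) a (u : rV) :
  monomial (fun j => m j + a * (j == i))%N u = u 0 i ^+ a * monomial m u.
Proof.
rewrite /monomial (bigD1 i)//= eqxx muln1 [in RHS](bigD1 i)//= exprD.
rewrite mulrA [u 0 i ^+ a * _]mulrC; congr (_ * _).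
by apply: eq_bigr => j /negbTE ->; rewrite muln0 addn0.
Qed.

Lemma degreeM_coord (m : 'I_d -> nat) (i : 'I_d) a :
  (\sum_j (m j + a * (j == i)) = \sum_j m j + a)%N.
Proof.
rewrite big_split/=; congr addn; rewrite (bigD1 i)//= eqxx muln1 big1 ?addn0//.
by move=> j /negbTE ->; rewrite muln0.
Qed.

Lemma poly_evalZ_coord (i : 'I_d) a c l (u : rV) :
  poly_eval [seq (c * t.1, fun j => (t.2 j + a * (j == i))%N) | t <- l] u =
  c * u 0 i ^+ a * poly_eval l u.
Proof.
rewrite /poly_eval big_map mulr_sumr; apply: eq_bigr => t _ /=.
rewrite monomialM_coord; ring.
Qed.

Definition zero_coord (i : 'I_d) (u : rV) : rV := u - u 0 i *: delta_mx 0 i.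

Lemma zero_coordE i u j : zero_coord i u 0 j = if j == i then 0 else u 0 j.
Proof.
rewrite !mxE eqxx/= ; case: eqP => [->|_]; first by rewrite mulr1 subrr.
by rewrite mulr0 subr0.
Qed.

Lemma poly_eval_zero_coord (i : 'I_d) l (u : rV) :
  poly_eval l (zero_coord i u) = poly_eval [seq t <- l | t.2 i == 0%N] u.
Proof.
rewrite /poly_eval big_filter [RHS]big_mkcond; apply: eq_bigr => t _.
case: eqP => ti.
  congr (_ * _); apply: eq_bigr => j _; rewrite zero_coordE.
  by case: eqP => [->|//]; rewrite ti !expr0.
rewrite /monomial (bigD1 i)//= zero_coordE eqxx expr0n; move/eqP/negbTE: ti => ->.
by rewrite mul0r mulr0.
Qed.

Variables (r : nat) (f : rV -> R).
Hypothesis fr : bounded_order_derivatives r f.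

(* The coordinates are moved one at a time: the Taylor coefficients in the last
   one are mixed derivatives, expanded in turn in the remaining coordinates. *)
Lemma taylor_expansion m (s : seq 'I_d) : (m <= d)%N -> (size s <= r)%N ->
  exists2 C, 0 <= C & forall x, exists2 l, degree_lt (r - size s) l &
    forall u : rV, (forall i : 'I_d, (m <= i)%N -> u 0 i = 0) ->
    `|iter_partial s f (x + u) - poly_eval l u| <= C * `|u| ^+ (r - size s).
Proof.
elim: m s => [|m IH] s md sr.
  (* With no coordinate left the displacement is 0. At order [r] the degree bound leaves only the
     empty polynomial, and the bound on the derivative itself serves as the remainder. *)
  have [sr'|] := eqVneq (size s) r.
    have [M [_ /(_ (M + 1))]] := fr.2 s sr'.
    rewrite ltrDl ltr01 => /(_ isT) fM.
    have fM' x : `|iter_partial s f x| <= `|M + 1|.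
      by apply: le_trans (ler_norm _); exact: fM.
    exists `|M + 1| => // x; exists [::] => // u _.
    by rewrite /poly_eval big_nil subr0 sr' subnn expr0 mulr1.
  move=> sr'; have {sr'} sr' : (size s < r)%N by rewrite ltn_neqAle sr' sr.
  exists 0 => // x; exists [:: (iter_partial s f x, fun=> 0%N)].
    by rewrite /degree_lt/= andbT big1// subn_gt0.
  move=> u u0; have -> : u = 0 by apply/rowP => i; rewrite mxE u0.
  by rewrite /poly_eval big_seq1 monomial0 mulr1 addr0 subrr normr0 mul0r.
pose i := Ordinal md; pose k := (r - size s)%N.
pose sa (a : nat) := nseq a i ++ s.
have sas a : size (sa a) = (a + size s)%N by rewrite size_cat size_nseq.
have /choice[C HC] : forall a : 'I_k, exists C, 0 <= C /\
    forall x, exists2 l, degree_lt (r - size (sa a)) l &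
    forall u : rV, (forall i : 'I_d, (m <= i)%N -> u 0 i = 0) ->
    `|iter_partial (sa a) f (x + u) - poly_eval l u| <= C * `|u| ^+ (r - size (sa a)).
  move=> a; have [||C C0 HC] := IH (sa a); first exact: ltnW.
    by have := ltn_ord a; rewrite sas /k ltn_subRL addnC => /ltnW.
  by exists C.
have [M HM] : exists M, forall x, `|iter_partial (sa k) f x| <= M.
  have [M [_ /(_ (M + 1))]] : bounded_fun (iter_partial (sa k) f).
    by apply: fr.2; rewrite sas /k subnK.
  by rewrite ltrDl ltr01 => /(_ isT) fM; exists (M + 1) => x; exact: fM.
have M0 : 0 <= M by exact: le_trans (HM 0).
exists (M + \sum_a C a).
  by rewrite addr_ge0// sumr_ge0// => a _; case: (HC a).
move=> x.
have /choice[l Hl] : forall a : 'I_k, exists l, degree_lt (r - size (sa a)) l /\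
    forall u : rV, (forall i : 'I_d, (m <= i)%N -> u 0 i = 0) ->
    `|iter_partial (sa a) f (x + u) - poly_eval l u| <= C a * `|u| ^+ (r - size (sa a)).
  by move=> a; have [_ /(_ x)[l]] := HC a; exists l.
pose l' (a : 'I_k) := [seq (((a`!)%:R)^-1 * t.1, fun j => (t.2 j + a * (j == i))%N) |
  t <- [seq t <- l a | t.2 i == 0%N]].
have evalS : forall u, poly_eval (flatten [seq l' a | a <- index_enum 'I_k]) u =
    \sum_(a < k) u 0 i ^+ a / (a`!)%:R * poly_eval (l a) (zero_coord i u).
  move=> u; rewrite {1}/poly_eval big_flatten big_map.
  apply: eq_bigr => a _; rewrite -/(poly_eval _ _) /l' poly_evalZ_coord.
  by rewrite poly_eval_zero_coord; congr (_ * _); rewrite mulrC.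
exists (flatten [seq l' a | a <- index_enum 'I_k]).
  rewrite /degree_lt; elim: (index_enum 'I_k) => //= a s' IHs'; rewrite all_cat IHs' andbT.
  rewrite /l' all_map /preim/= all_filter.
  have [] := Hl a; rewrite /degree_lt sas => h _; apply: sub_all h => t /= h.
  apply/implyP => _; rewrite degreeM_coord.
  by rewrite addnC -ltn_subRL -subnDA [(size s + _)%N]addnC.
move=> u u0; set u' := zero_coord i u.
have uE : x + u = (x + u') + u 0 i *: delta_mx 0 i by rewrite -addrA subrK.
have u'0 (j : 'I_d) : (m <= j)%N -> u' 0 j = 0.
  rewrite zero_coordE; case: eqP => // /eqP ji mj; apply: u0.
  by rewrite ltn_neqAle mj andbT eq_sym; apply: contra ji => /eqP ji; apply/eqP/val_inj.
have u'u : `|u'| <= `|u|.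
  apply: row_norm_le => // j; rewrite zero_coordE; case: eqP => _.
    by rewrite normr0.
  exact: coord_le_norm.
have h1 := @taylor_bound R k (fun a t => iter_partial (sa a) f (x + u' + t *: delta_mx 0 i))
  M (u 0 i).
have {h1} := h1 _ _; rewrite -uE => h1.
have {}h1 : `|iter_partial s f (x + u) - \sum_(a < k) u 0 i ^+ a / a`!%:R *
    iter_partial (sa a) f (x + u')| <= M * `|u| ^+ k.
  apply: le_trans (ler_wpM2l M0 _); last first.
    by apply: (lerXn2r k _ _ (coord_le_norm u i)); rewrite nnegrE.
  have := h1 _ _.
  under eq_bigr do rewrite scale0r addr0.
  apply => [a t ak|t]; last exact: HM.
  apply: is_derive_line; apply: (proj1 fr (sa a)); rewrite sas.
  by rewrite addnC -ltn_subRL.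
rewrite evalS mulrDl.
apply: le_trans (ler_distD (\sum_(a < k) u 0 i ^+ a / a`!%:R *
    iter_partial (sa a) f (x + u')) _ _) _.
apply: lerD => //.
rewrite -sumrB mulr_suml; apply: le_trans (ler_norm_sum _ _ _) _.
apply: ler_sum => a _; rewrite -mulrBr normrM.
have [_ /(_ u' u'0)] := Hl a; rewrite sas => h2.
have [C0 _] := HC a.
have ak : k = (a + (r - (a + size s)))%N.
  by rewrite [(a + size s)%N]addnC subnDA subnKC// ltnW.
rewrite -/k (_ : `|u| ^+ k = `|u| ^+ a * `|u| ^+ (r - (a + size s))); last first.
  by rewrite -exprD -ak.
rewrite mulrCA; apply: ler_pM => //.
  rewrite normrM normrX -[leRHS]mulr1; apply: ler_pM => //.
    by apply: lerXn2r; rewrite ?nnegrE// coord_le_norm.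
  rewrite ger0_norm ?invr_ge0// invf_le1 ?ltr0n ?fact_gt0//.
  by rewrite ler1n fact_gt0.
apply: le_trans h2 _; apply: ler_wpM2l => //.
by apply: lerXn2r; rewrite ?nnegrE.
Qed.

Hypothesis r0 : (0 < r)%N.

Lemma taylor_polynomial : exists2 C, 0 <= C & forall x, exists l,
  [/\ degree_lt r l, poly_eval l 0 = f x &
    forall u : rV, `|f (x + u) - poly_eval l u| <= C * `|u| ^+ r].
Proof.
have [C C0 HC] := @taylor_expansion d [::] (leqnn d) isT.
rewrite subn0 in HC; exists C => // x; have [l dl Hl] := HC x.
have {}Hl u : `|f (x + u) - poly_eval l u| <= C * `|u| ^+ r.
  by apply: Hl => i; rewrite leqNgt ltn_ord.
exists l; split => //; apply/esym/eqP; rewrite -subr_eq0 -normr_le0.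
by have := Hl 0; rewrite addr0 normr0 expr0n eqn0Ngt r0 mulr0.
Qed.

(** Derivatives along the axes do not give continuity by themselves; it comes from the Taylor bound,
    whose polynomial varies by at most a multiple of [|u|] near 0. *)
Lemma bounded_order_derivatives_continuous : continuous f.
Proof.
move=> x; have [C C0 /(_ x)[l [dl l0 Hl]]] := taylor_polynomial.
pose D := C + \sum_(t <- l) `|t.1|.
have D0 : 0 <= D by rewrite addr_ge0// sumr_ge0.
have near_le u : `|u| <= 1 -> `|f (x + u) - f x| <= D * `|u|.
  move=> u1; rewrite -l0 /D mulrDl.
  apply: le_trans (ler_distD (poly_eval l u) _ _) _; apply: lerD.
    apply: le_trans (Hl u) _; apply: ler_wpM2l => //.
    by rewrite -(prednK r0) exprS ler_piMr// exprn_ile1.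
  rewrite /poly_eval -sumrB mulr_suml; apply: le_trans (ler_norm_sum _ _ _) _.
  apply: ler_sum => t _; rewrite -mulrBr normrM ler_wpM2l//.
  have [m0|m0] := posnP (\sum_i t.2 i)%N.
    by rewrite !monomial_degree0// subrr normr0.
  rewrite monomial_at0// subr0; apply: le_trans (monomial_norm_le _ _) _.
  by rewrite -(prednK m0) exprS ler_piMr// exprn_ile1.
apply/(@cvgrPdist_le _ _ _ _ (@nbhs_filter rV x)) => a a0.
have e0 : 0 < Num.min 1 (a / (D + 1)) by rewrite lt_min ltr01 divr_gt0// ltr_wpDl.
have h : nbhs x (ball x (Num.min 1 (a / (D + 1)))) by exact: nbhsx_ballx.
apply: filterS h => y; rewrite -ball_normE /= => /ltW.
rewrite le_min ler_pdivlMr ?ltr_wpDl// => /andP[xy1 xy2].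
rewrite distrC -[y](subrKC x); apply: le_trans (near_le _ _) _; rewrite distrC//.
have := normr_ge0 (x - y); nra.
Qed.

End multivariate_taylor.

(** * Bias of smoothing by a kernel of order [r] *)

Section kernel_bias.
Context {R : realType} (d : nat).
Notation rV := ('rV[R]_d).
Notation leb := (lebesgue_row d).
Variables (r : nat) (f : rV -> R) (K : rV -> R).
Hypotheses (r0 : (0 < r)%N) (fr : bounded_order_derivatives r f)
  (bf : bounded_fun f) (Kr : kernel_order r K).

Let mf : measurable_fun setT f.
Proof.
apply: continuous_measurable_row.
exact: bounded_order_derivatives_continuous fr r0.
Qed.

Let iK : leb.-integrable setT (EFin \o K). Proof. by case: Kr. Qed.

Let mK : measurable_fun setT K.
Proof. by case/integrableP : iK => /measurable_EFinP. Qed.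

(** The order of the kernel includes integrability of [u_i ^ r * K u] for each coordinate, and the
    sup norm is attained at one coordinate, so the sum over coordinates dominates. *)
Let integrable_kernel_norm :
  leb.-integrable setT (EFin \o (fun u => `|K u| * `|u| ^+ r)).
Proof.
have [_ _ Kmon] := Kr.
have iKi (i : 'I_d) : leb.-integrable setT (EFin \o (fun u : rV => `|u 0 i ^+ r * K u|)).
  have [|h _] := Kmon (fun j => r * (j == i))%N.
    rewrite (bigD1 i)//= eqxx muln1 big1 ?addn0 ?r0 ?leqnn//.
    by move=> j /negbTE ->; rewrite muln0.
  have E u : monomial (fun j => r * (j == i))%N u = u 0 i ^+ r.
    have := monomialM_coord (fun=> 0%N) i r u; rewrite monomial0 mulr1 => <-.
    by [].
  have := integrable_abse h; apply: eq_integrable => // u _ /=.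
  by rewrite E.
have mn : measurable_fun setT (fun u : rV => `|u|).
  by apply: continuous_measurable_row; exact: norm_continuous.
have iS : leb.-integrable setT
    (EFin \o (fun u : rV => \sum_(i < d) `|u 0 i ^+ r * K u|)).
  rewrite (_ : _ \o _ = fun u : rV =>
      (\sum_(i < d) (`|u 0 i ^+ r * K u|)%R%:E)%E).
    by apply: integrable_sum => // i _; exact: iKi.
  by apply/funext => u; rewrite sumEFin.
apply: (le_integrable _ _ _ iS) => //.
  apply/measurable_EFinP; apply: measurable_funM.
    exact: (measurableT_comp (@normr_measurable R setT) mK).
  exact: measurable_funX.
move=> u _; rewrite lee_fin [leRHS]ger0_norm ?sumr_ge0//.
rewrite ger0_norm ?mulr_ge0 ?exprn_ge0//.
have [u0|u0] := eqVneq u 0.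
  by rewrite u0 normr0 expr0n eqn0Ngt r0 mulr0 sumr_ge0.
have [[a i] ui] : exists i : 'I_1 * 'I_d, `|u| = `|u i.1 i.2|.
  by apply: mx_norm_neq0; rewrite -[mx_norm u]/(`|u|) normr_eq0.
rewrite ui /= ord1 (bigD1 i)//= normrM normrX mulrC lerDl.
by rewrite sumr_ge0.
Qed.

(** Against [K], the Taylor polynomial of degree below [r] integrates to its constant term [f x];
    the remainder contributes [h ^ r] times an absolute moment of [K], uniformly in [x]. *)
Lemma kernel_bias : exists2 C, 0 <= C & forall x (h : R), 0 < h ->
  `|\int[leb]_u (K u * f (x + h *: u)) - f x| <= C * h ^+ r.
Proof.
have [_ K1 Kmon] := Kr.
have [C C0 HC] := taylor_polynomial fr r0.
pose A := \int[leb]_u (`|K u| * `|u| ^+ r).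
have A0 : 0 <= A by apply: Rintegral_ge0 => u _; rewrite mulr_ge0 ?exprn_ge0.
exists (C * A) => [|x h h0]; first exact: mulr_ge0.
have [l [dl l0 Hl]] := HC x.
have bfx : bmf (fun u : rV => f (x + h *: u)).
  apply: (bmf_precomp _ (measurable_row_lin x h)); split => //.
  by case: bf => M [_ /(_ (M + 1))]; rewrite ltrDl ltr01 => /(_ isT) fM;
     exists (M + 1) => y; exact: fM.
have monE m : (\sum_i m i < r)%N ->
    leb.-integrable setT (EFin \o (fun u => monomial m u * K u)) /\
    \int[leb]_u (monomial m u * K u) = monomial m 0.
  have [m0 _|m0 mr] := posnP (\sum_i m i)%N.
    have E v := @monomial_degree0 R d m v m0.
    rewrite E; under eq_Rintegral do rewrite E mul1r; split => //.
    by apply: eq_integrable iK => // u _; rewrite /= E mul1r.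
  by rewrite monomial_at0//; apply: Kmon; rewrite m0 ltnW.
have polE : leb.-integrable setT (EFin \o (fun u => poly_eval l (h *: u) * K u)) /\
    \int[leb]_u (poly_eval l (h *: u) * K u) = f x.
  rewrite -l0; elim: l dl {l0 Hl} => [_|t l IH /=/andP[td /IH[ih1 ih2]]].
    rewrite /poly_eval big_nil; split.
      rewrite (_ : _ \o _ = cst 0%E); first exact: integrable0.
      by apply/funext => u; rewrite /= big_nil mul0r.
    under eq_Rintegral do rewrite big_nil mul0r.
    by rewrite /Rintegral integral0.
  have [i1 e1] := monE _ td.
  have i2 := integrableZl measurableT (t.1 * h ^+ (\sum_i t.2 i)) i1.
  have E u : poly_eval (t :: l) (h *: u) * K u =
     t.1 * h ^+ (\sum_i t.2 i) * (monomial t.2 u * K u) + poly_eval l (h *: u) * K u.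
    rewrite /poly_eval big_cons mulrDl; congr (_ + _).
    rewrite -!mulrA; congr (_ * _); rewrite mulrA; congr (_ * _).
    rewrite /monomial -prodrXr -big_split/=; apply: eq_bigr => i _.
    by rewrite mxE exprMn.
  split.
    have := integrableD measurableT i2 ih1; apply: eq_integrable => // u _ /=.
    by rewrite E.
  under eq_Rintegral do rewrite E.
  rewrite RintegralD//= ih2 RintegralZl// e1 {2}/poly_eval big_cons; congr (_ + _).
  rewrite -mulrA; congr (_ * _).
  have [m0|m0] := posnP (\sum_i t.2 i)%N; first by rewrite m0 expr0 mul1r.
  by rewrite monomial_at0// mulr0.
have [i1 {1}<-] := polE.
have i2 := integrableM_bmf iK bfx.
rewrite -RintegralB//.
have i3 := integrableB measurableT i2 i1.
apply: le_trans (le_normr_Rintegral _ _) _ => //.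
rewrite [leRHS]mulrAC /A -(RintegralZl _ measurableT integrable_kernel_norm).
apply: le_Rintegral => //.
- exact: (integrable_norm i3).
- exact: (integrableZl measurableT (C * h ^+ r) integrable_kernel_norm).
- move=> u _; rewrite mulrC -mulrBl normrM mulrC [leRHS]mulrCA ler_wpM2l//.
  apply: le_trans (Hl _) _.
  by rewrite normrZ exprMn (gtr0_norm h0) mulrA.
Qed.

End kernel_bias.

(** * The support of the gradient *)

Section hoelder.
Context {R : realType} (d : nat).
Notation rV := ('rV[R]_d).
Variable Q : set rV.

Lemma hoelder_continuous (F : rV -> R^o) x e : hoelder_on F Q -> Q x -> 0 < e ->
  exists2 dl, 0 < dl & forall y, Q y -> `|x - y| < dl -> `|F x - F y| <= e.
Proof.
move=> [alpha [C [a0 _ FC]]] Qx e0.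
have C1 : 0 < `|C| + 1 by rewrite ltr_wpDl.
(* The radius below solves [(|C| + 1) * delta ^ alpha = e]; the absolute value is there because the
   sign of [C] is unspecified. *)
pose c := e / (`|C| + 1); have c0 : 0 < c by rewrite divr_gt0.
exists (c `^ alpha^-1); first exact: powR_gt0.
move=> y Qy xy; apply: le_trans (FC _ _ Qx Qy) _.
have : `|x - y| `^ alpha <= c.
  rewrite -[leRHS](powRr1 (ltW c0)) -[X in c `^ X](mulVf (lt0r_neq0 a0)) powRrM.
  by apply: ge0_ler_powR; rewrite ?nnegrE ?powR_ge0 ?(ltW a0) ?(ltW xy).
rewrite /c ler_pdivlMr//; have := powR_ge0 `|x - y| alpha; have := ler_norm C.
nra.
Qed.

Lemma hoelder_bounded (F : rV -> R^o) : hoelder_on F Q -> bounded_set Q ->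
  exists M, forall x, Q x -> `|F x| <= M.
Proof.
move=> [alpha [C [a0 _ FC]]] [B0 [_ QB0]]; pose B := B0 + 1.
have QB x : Q x -> `|x| <= B by apply: QB0; rewrite ltrDl.
have [Q0|/set0P[z Qz]] := eqVneq Q set0; first by exists 0; rewrite Q0.
exists (`|F z| + `|C| * (B + B) `^ alpha) => x Qx.
rewrite -[F x](subrK (F z)) addrC; apply: le_trans (ler_normD _ _) _.
rewrite lerD2l; apply: le_trans (FC _ _ Qx Qz) _.
apply: le_trans (ler_wpM2r (powR_ge0 _ _) (ler_norm C)) _; apply: ler_wpM2l => //.
apply: ge0_ler_powR; rewrite ?nnegrE ?(ltW a0)//.
  by rewrite addr_ge0//; exact: le_trans (QB _ Qz).
by apply: le_trans (ler_normB _ _) _; rewrite lerD// QB.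
Qed.

End hoelder.

Section gradient_support.
Context {R : realType} (d : nat).
Notation rV := ('rV[R]_d).
Variables (psi : rV -> R) (Q : set rV).
Hypotheses (hpsi : forall x, differentiable psi x)
  (hQ : Q = closure [set x | gradient psi x != 0])
  (bQ : bounded_set Q)
  (cQ : convex_set (Q : set (convex_lmodType rV)))
  (psiH : hoelder_on (gradient psi) Q).
Variable k : 'I_d.

Let E : rV := delta_mx 0 k.

Let closedQ : closed Q.
Proof. by rewrite hQ; exact: closed_closure. Qed.

Lemma partial_neq0_in x : partial k psi x != 0 -> Q x.
Proof.
move=> px; rewrite hQ; apply: subset_closure => /=.
by apply: contra px => /eqP/rowP/(_ k); rewrite !mxE => ->.
Qed.

Let hoelder_partial : hoelder_on (partial k psi : rV -> R^o) Q.
Proof.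
have [al [C [a0 a1 H]]] := psiH; exists al, C; split => // x y Qx Qy.
apply: le_trans (H x y Qx Qy).
by have := coord_le_norm (gradient psi x - gradient psi y) k; rewrite !mxE.
Qed.

Let psi_continuous : continuous psi.
Proof. by move=> x; exact/differentiable_continuous. Qed.

Let line_point (y : rV) (a b : R) : a <= b -> psi (y + a *: E) != psi (y + b *: E) ->
  exists2 c, a <= c <= b & Q (y + c *: E).
Proof.
move=> ab ne.
have dl (t : R) : is_derive t (1 : R) (fun t : R => psi (y + t *: E)) (partial k psi (y + t *: E)).
  by apply: is_derive_line; exact: diff_derivable.
have cont : {within `[a, b], continuous (fun t : R => psi (y + t *: E))}.
  by apply: derivable_within_continuous => t _; exact: ex_derive.
have [c /[!in_itv]/= cab eq] := MVT_segment ab (fun t _ => dl t) cont.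
exists c => //; apply: partial_neq0_in; apply: contra ne => /eqP h.
by move: eq; rewrite h mul0r => /eqP; rewrite subr_eq0 eq_sym.
Qed.

(* A point y with psi (y + rho E) and psi (y - rho E) both different from psi y
   has, by the mean value theorem, points of Q on both sides of it on the line
   y + R E; these inequalities are stable under small moves of y. *)
Lemma partial_neq0_interior x : partial k psi x != 0 -> nbhs x Q.
Proof.
move=> px.
have [rho rho0 [h1 h2]] : exists2 rho : R, 0 < rho &
    psi (x + rho *: E) != psi x /\ psi (x + (- rho) *: E) != psi x.
  have : (fun h : R => h^-1 *: ((psi \o shift x) (h *: E) - psi x)) @ 0^' --> partial k psi x.
    have dx : derivable psi x E by exact: diff_derivable.
    exact: dx.
  move=> /cvgr_neq0 /(_ px)[ep /= ep0 hep].
  have ep2 : 0 < ep / 2 by rewrite divr_gt0.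
  have main (t : R) : `|t| < ep -> t != 0 -> psi (x + t *: E) != psi x.
    move=> tep t0; have := hep t; rewrite /ball_ /= sub0r normrN => /(_ tep t0).
    by rewrite scaler_eq0 negb_or subr_eq0 addrC => /andP[].
  exists (ep / 2) => //; split; apply: main; rewrite ?normrN ?oppr_eq0 ?gt_eqF//.
    by rewrite gtr0_norm// ltr_pdivrMr// mulr2n mulrDr mulr1 ltrDl.
  by rewrite gtr0_norm// ltr_pdivrMr// mulr2n mulrDr mulr1 ltrDl.
have near_ne (t : R) : psi (x + t *: E) != psi x ->
    \forall y \near nbhs x, psi (y + t *: E) != psi y.
  move=> ne; pose c := `|psi (x + t *: E) - psi x| / 3.
  have c0 : 0 < c by rewrite divr_gt0// normr_gt0 subr_eq0.
  have /cvgrPdist_le/(_ _ c0)/nbhs_ballP[d1 /= d10 H1] := @psi_continuous (x + t *: E).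
  have /cvgrPdist_le/(_ _ c0)/nbhs_ballP[d2 /= d20 H2] := @psi_continuous x.
  apply: filterS2 (nbhsx_ballx x _ d10) (nbhsx_ballx x _ d20) => y y1 /H2 b2.
  have {y1} : ball (x + t *: E) d1 (y + t *: E).
    by move: y1; rewrite -!ball_normE /= opprD addrACA subrr addr0.
  move=> /H1 b1; apply/eqP => yt; move: c0.
  have : `|psi (x + t *: E) - psi x| <= c + c.
    apply: le_trans (ler_distD (psi y) _ _) _.
    by rewrite -{1}yt [X in _ + X]distrC lerD.
  by rewrite /c; lra.
apply: filterS2 (near_ne _ h1) (near_ne _ h2) => y n1 n2.
have [|c1 /andP[c10 _] Q1] := @line_point y 0 rho (ltW rho0).
  by rewrite scale0r addr0 eq_sym.
have [||c2 /andP[_ c20] Q2] := @line_point y (- rho) 0.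
- by rewrite oppr_le0 ltW.
- by rewrite scale0r addr0.
have [c12|c12] := eqVneq (c1 - c2) 0.
  have e0 : c1 = 0 by lra.
  by move: Q1; rewrite e0 scale0r addr0.
have c12p : 0 < c1 - c2 by rewrite lt0r c12 subr_ge0 (le_trans c20).
(* The weight for which the convex combination of the two points of [Q], on either side of [y], is
   [y] itself. *)
pose l := - c2 / (c1 - c2).
have l0 : 0 <= l by rewrite divr_ge0 ?oppr_ge0// ltW.
have l1 : l <= 1 by rewrite ler_pdivrMr// mul1r lerDr.
have := cQ (Itv01 l0 l1) (mem_set Q1) (mem_set Q2).
move=> /set_mem; congr Q; rewrite /conv/=.
rewrite !scalerDr addrACA -scalerDl /unstable.onem subrKC scale1r.
rewrite !scalerA -scalerDl (_ : l * c1 + (1 - l) * c2 = 0) ?scale0r ?addr0//.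
by rewrite /l; field.
Qed.

Variable g : rV -> R.
Hypothesis gH : hoelder_on (g : rV -> R^o) Q.

(** The function [g] is only controlled on [Q]. Where the partial derivative is nonzero, a
    neighbourhood lies in [Q] and both factors are continuous there; where it vanishes, [g] is
    bounded on [Q], the derivative is small nearby in [Q] and zero outside. *)
Lemma continuous_mul_partial : continuous (fun x => g x * partial k psi x).
Proof.
have [M gM] := hoelder_bounded gH bQ.
have nearQ x e : 0 < e -> Q x -> \forall y \near nbhs x, Q y ->
    `|g x - g y| <= e /\ `|partial k psi x - partial k psi y| <= e.
  move=> e0 Qx.
  have [d1 d10 H1] := hoelder_continuous gH Qx e0.
  have [d2 d20 H2] := hoelder_continuous hoelder_partial Qx e0.
  apply: filterS2 (nbhsx_ballx x _ d10) (nbhsx_ballx x _ d20) => y.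
  by rewrite -!ball_normE /= => y1 y2 Qy; split; [exact: H1|exact: H2].
move=> x; apply/(@cvgrPdist_le _ _ _ _ (@nbhs_filter rV x)) => e e0.
have [px|px] := eqVneq (partial k psi x) 0; last first.
  have M0 : 0 < `|M| + `|partial k psi x| + 1 by rewrite ltr_wpDl// addr_ge0.
  have Qx := partial_neq0_in px.
  apply: filterS2 (partial_neq0_interior px) (nearQ x _ (divr_gt0 e0 M0) Qx) => y Qy /(_ Qy).
  rewrite !ler_pdivlMr// => -[h1 h2].
  rewrite (_ : _ - _ = (g x - g y) * partial k psi x +
     g y * (partial k psi x - partial k psi y)); last by ring.
  apply: le_trans (ler_normD _ _) _; rewrite !normrM.
  have := gM y Qy; have := ler_norm M; move: h1 h2; move: `|g x - g y| (normr_ge0 (g x - g y)).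
  move: `|partial k psi x - _| (normr_ge0 (partial k psi x - partial k psi y)).
  move: `|partial k psi x| (normr_ge0 (partial k psi x)) `|M| (normr_ge0 M) `|g y| (normr_ge0 (g y)).
  move=> p p0 N N0 q q0 w w0 z z0 h1 h2 h3 h4.
  have D0 : 0 < N + p + 1 by lra.
  rewrite -(ler_pM2r D0).
  have : z * (N + p + 1) * p <= e * p by rewrite ler_wpM2r.
  have : q * (w * (N + p + 1)) <= N * e by apply: ler_pM => //; [rewrite mulr_ge0// ltW|lra].
  lra.
rewrite px mulr0.
have [Qx|nQx] := pselect (Q x); last first.
  have : nbhs x (~` Q) by apply: open_nbhs_nbhs; split => //; exact: closed_openC.
  apply: filterS => y /= nQy; have -> : partial k psi y = 0.
    by apply/eqP; apply: contrapT => /negP/partial_neq0_in.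
  by rewrite mulr0 subrr normr0 ltW.
have M1 : 0 < `|M| + 1 by rewrite ltr_wpDl.
apply: filterS (nearQ x (e / (`|M| + 1)) (divr_gt0 e0 M1) Qx) => y h.
have [->|py] := eqVneq (partial k psi y) 0.
  by rewrite mulr0 subrr normr0 ltW.
have Qy := partial_neq0_in py.
have [_] := h Qy; rewrite px !sub0r !normrN normrM ler_pdivlMr//.
have := gM y Qy; have := ler_norm M; have := normr_ge0 (partial k psi y).
have := normr_ge0 (g y); nra.
Qed.

Lemma bounded_mul_partial : exists M, forall x, `|g x * partial k psi x| <= M.
Proof.
have [M1 g1] := hoelder_bounded gH bQ.
have [M2 g2] := hoelder_bounded hoelder_partial bQ.
exists (`|M1| * `|M2|) => x.
have [->|px] := eqVneq (partial k psi x) 0; first by rewrite mulr0 normr0 mulr_ge0.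
have Qx := partial_neq0_in px.
rewrite normrM ler_pM//; [apply: le_trans (g1 x Qx) _|apply: le_trans (g2 x Qx) _];
  exact: ler_norm.
Qed.

End gradient_support.

(** * The leave-one-out density estimator *)

Section convergence_in_probability.
Context {R : realType} dO (O : measurableType dO) (P : probability O R).

(* The covering by a measurable set spares the measurability of [A n]. *)
Definition asymptotically_null (A : nat -> set O) := forall e : R, 0 < e ->
  \forall n \near \oo, exists S, [/\ measurable S, A n `<=` S & (P S <= e%:E)%E].

Definition vanishes_in_prob (D : nat -> O -> R) := forall dl : R, 0 < dl ->
  asymptotically_null (fun n => [set w | dl < `|D n w|]).

Lemma asymptotically_null_le (A B : nat -> set O) :
  (\forall n \near \oo, A n `<=` B n) ->
  asymptotically_null B -> asymptotically_null A.
Proof.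
move=> AB B0 e e0; apply: filterS2 AB (B0 e e0) => n ABn [S [mS BS PS]].
by exists S; split => //; exact: subset_trans BS.
Qed.

Lemma asymptotically_nullU (A B : nat -> set O) :
  asymptotically_null A -> asymptotically_null B ->
  asymptotically_null (fun n => A n `|` B n).
Proof.
move=> A0 B0 e e0; have e2 : 0 < e / 2 by rewrite divr_gt0.
apply: filterS2 (A0 _ e2) (B0 _ e2) => n [S [mS AS PS]] [S' [mS' BS' PS']].
exists (S `|` S'); split; [exact: measurableU|exact: setUSS|].
apply: le_trans (measureU2 _ _ _) _ => //.
by rewrite [e](splitr e) EFinD leeD.
Qed.

Lemma vanishes_in_probW (D D' : nat -> O -> R) :
  asymptotically_null (fun n => [set w | ~ `|D n w| <= `|D' n w|]) ->
  vanishes_in_prob D' -> vanishes_in_prob D.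
Proof.
move=> DD D0 dl dl0; apply: asymptotically_null_le (asymptotically_nullU DD (D0 dl dl0)).
apply: nearW => n w /= h; have [h'|h'] := leP `|D n w| `|D' n w|; last first.
  by left.
by right; exact: lt_le_trans h'.
Qed.

Lemma vanishes_in_prob_le (D D' : nat -> O -> R) :
  (\forall n \near \oo, forall w, `|D n w| <= `|D' n w|) ->
  vanishes_in_prob D' -> vanishes_in_prob D.
Proof.
move=> h; apply: vanishes_in_probW => e e0; apply: filterS h => n h.
by exists set0; split => //; [move=> w /=; rewrite h|rewrite measure0 lee_fin ltW].
Qed.

Lemma vanishes_in_probD (D D' : nat -> O -> R) :
  vanishes_in_prob D -> vanishes_in_prob D' ->
  vanishes_in_prob (fun n w => D n w + D' n w).
Proof.
move=> h h' dl dl0; have dl2 : 0 < dl / 2 by rewrite divr_gt0.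
apply: asymptotically_null_le (asymptotically_nullU (h _ dl2) (h' _ dl2)).
apply: nearW => n w /= hD; have [h1|h1] := ltP (dl / 2) `|D n w|; first by left.
right; have := ler_normD (D n w) (D' n w); lra.
Qed.

Lemma vanishes_in_probZ (a : R) (D : nat -> O -> R) :
  vanishes_in_prob D -> vanishes_in_prob (fun n w => a * D n w).
Proof.
move=> h dl dl0; have c0 : 0 < `|a| + 1 by rewrite ltr_wpDl.
apply: asymptotically_null_le (h _ (divr_gt0 dl0 c0)).
apply: nearW => n w /=; rewrite normrM ltr_pdivrMr//.
have := normr_ge0 (D n w); have := normr_ge0 a; nra.
Qed.

Lemma vanishes_in_prob_cvg (u : nat -> R) : u @ \oo --> (0 : R) ->
  vanishes_in_prob (fun n _ => u n).
Proof.
move=> /cvgrPdist_le u0 dl dl0 e e0; apply: filterS (u0 dl dl0) => n.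
rewrite sub0r normrN => h; exists set0; split => //.
  by move=> w /=; rewrite ltNge h.
by rewrite measure0 lee_fin ltW.
Qed.

Lemma vanishes_in_prob_markov (F : nat -> O -> R) (u : nat -> R) :
  u @ \oo --> (0 : R) ->
  (\forall n \near \oo, [/\ measurable_fun setT (F n), forall w, 0 <= F n w &
    (\int[P]_w (F n w)%:E <= (u n)%:E)%E]) ->
  vanishes_in_prob F.
Proof.
move=> /cvgrPdist_le u0 hF dl dl0 e e0.
apply: filterS2 (u0 _ (mulr_gt0 dl0 e0)) hF => n.
rewrite sub0r normrN => /(le_trans (ler_norm _)) une [mF F0 iF].
exists [set w | dl <= F n w]; split.
- rewrite -[X in measurable X]setTI.
  exact: (measurable_fun_ler (measurable_cst dl) mF).
- by move=> w /=; rewrite ger0_norm// => /ltW.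
have mF' : measurable_fun setT (EFin \o F n) by exact/measurable_EFinP.
have := le_integral_abse P measurableT mF' dl0.
rewrite setTI (_ : [set x | _] = [set w | dl <= F n w]); last first.
  by apply/seteqP; split => w /=; rewrite lee_fin ger0_norm.
under eq_integral do rewrite /= ger0_norm//.
move=> /le_trans/(_ iF) h.
rewrite -(@lee_pmul2l _ dl%:E)// -EFinM; apply: le_trans h _.
by rewrite lee_fin.
Qed.

Lemma vanishes_in_prob_sqr (D : nat -> O -> R) :
  vanishes_in_prob (fun n w => D n w ^+ 2) -> vanishes_in_prob D.
Proof.
move=> h dl dl0; have dl2 : 0 < dl ^+ 2 by rewrite exprn_gt0.
apply: asymptotically_null_le (h _ dl2); apply: nearW => n w /= lt.
by rewrite normrX ltrXn2r// ltW.
Qed.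

Lemma vanishes_in_prob_moment2 (D : nat -> O -> R) (u : nat -> R) :
  u @ \oo --> (0 : R) ->
  (\forall n \near \oo, bmf (D n) /\ \int[P]_w (D n w ^+ 2) <= u n) ->
  vanishes_in_prob D.
Proof.
move=> u0 h; apply: vanishes_in_prob_sqr.
apply: (vanishes_in_prob_markov (u := u)) => //; apply: filterS h => n [bD Du].
have bD2 := bmfX 2 bD; split.
- by case: bD2.
- by move=> w; exact: sqr_ge0.
- move: Du; rewrite -lee_fin; apply: le_trans; rewrite /Rintegral fineK//.
  by apply: integrable_fin_num => //; exact: bmf_integrable.
Qed.

End convergence_in_probability.

(** The inverse takes the value 0 at 0, and so do the continuous functions
    [x / (x^2 + 1 / (n + 1))], which converge to it everywhere. *)
Lemma measurable_inv {R : realType} :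
  measurable_fun [set: measurableTypeR R] (fun x : R => x^-1).
Proof.
apply: (measurable_fun_cvg (h := fun (n : nat) (x : R) => x * (x ^+ 2 + n.+1%:R^-1)^-1)).
  move=> n; apply: continuous_measurable_fun => x.
  have x0 : x ^+ 2 + n.+1%:R^-1 != 0.
    by rewrite gt_eqF// ltr_wpDl ?sqr_ge0// invr_gt0.
  apply: cvgM => //; apply: cvgV => //; apply: cvgD; last exact: cvg_cst.
  exact: exprn_continuous.
move=> x _; have [->|x0] := eqVneq x 0.
  by rewrite invr0; under eq_fun do rewrite mul0r; exact: cvg_cst.
rewrite -[X in _ --> X](_ : x * (x ^+ 2 + 0)^-1 = x^-1); last first.
  by rewrite addr0 expr2 invfM mulrA divff// mul1r.
apply: cvgMr; apply: cvgV; first by rewrite addr0 sqrf_eq0.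
by apply: cvgD; [exact: cvg_cst|exact: cvg_harmonic].
Qed.

Lemma measurable_funV {R : realType} d (T : measurableType d) (f : T -> R) :
  measurable_fun setT f -> measurable_fun setT (fun x => (f x)^-1).
Proof. by move=> mf; exact: (measurableT_comp measurable_inv mf). Qed.

Section kernel_estimates.
Context {R : realType} dO (O : measurableType dO) (P : probability O R).
Context (d : nat) d2 (T2 : measurableType d2).
Notation rV := ('rV[R]_d).
Notation leb := (lebesgue_row d).
Variables (X : nat -> {RV P >-> rV}) (e : nat -> {RV P >-> T2}).
Hypotheses (hX : iid X) (he : iid e) (hXe : independent_seqs X e).
Variables (f K : rV -> R) (Bf KM : R).
Hypotheses (hf : has_density (X 0%N) f) (fB : forall x, f x <= Bf)
  (mK : measurable_fun setT K) (iK : leb.-integrable setT (EFin \o K))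
  (KB : forall x, `|K x| <= KM).

Let mf : measurable_fun setT f. Proof. by case: hf. Qed.
Let f0 x : 0 <= f x. Proof. by case: hf. Qed.
Let bK : bmf K. Proof. by split => //; exists KM. Qed.
Let bf : bmf f. Proof. by split => //; exists Bf => x; rewrite ger0_norm. Qed.
Let Bf0 : 0 <= Bf. Proof. exact: le_trans (fB 0). Qed.
Let KM0 : 0 <= KM. Proof. exact: le_trans (KB 0). Qed.

Lemma expect_density (G : rV -> R) : bmf G ->
  \int[P]_w G (X 0%N w) = \int[leb]_x (G x * f x).
Proof.
move=> bG; have [mG _] := bG.
have [_ _ hfP] := hf.
have iG := bmf_integrable (distribution P (X 0%N)) bG.
have [_ <-] := integrable_density mf f0 hfP mG iG.
rewrite /Rintegral; congr fine; rewrite integral_distribution//.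
  exact/measurable_EFinP.
by apply: (bmf_integrable P (f := fun w => G (X 0%N w))); exact: bmf_precomp.
Qed.

Variable h : R.
Hypothesis h0 : 0 < h.

Let hd0 : 0 < h ^+ d. Proof. exact: exprn_gt0. Qed.

Definition scaled (u : rV -> R) (x y : rV) : R :=
  (h ^+ d)^-1 * u (h^-1 *: (y - x)).

Lemma bmf_scaled u : bmf u -> bmf (fun z : rV * rV => scaled u z.1 z.2).
Proof.
move=> bu; apply: bmfM; first exact: bmf_cst.
apply: (bmf_precomp bu (g := fun z : rV * rV => h^-1 *: (z.2 - z.1))).
apply: measurable_row => i; under eq_fun do rewrite !mxE.
apply: measurable_funM => //; apply: measurable_funB.
  exact: (measurableT_comp (measurable_coord i) measurable_snd).
exact: (measurableT_comp (measurable_coord i) measurable_fst).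
Qed.

Lemma expect_scaled u k x : bmf u -> leb.-integrable setT (EFin \o u) -> bmf k ->
  \int[P]_w (k (X 0%N w) * scaled u x (X 0%N w)) =
  \int[leb]_v (u v * (k (x + h *: v) * f (x + h *: v))).
Proof.
move=> bu iu bk.
have bG : bmf (fun y => k y * scaled u x y).
  by apply: bmfM => //; exact: (bmf_pair1 x (bmf_scaled bu)).
rewrite (expect_density bG).
have E v : k (x + h *: v) * scaled u x (x + h *: v) * f (x + h *: v) =
    (h ^+ d)^-1 * (u v * (k (x + h *: v) * f (x + h *: v))).
  rewrite /scaled addrAC subrr add0r scalerA mulVf ?gt_eqF// scale1r; ring.
have ikf : leb.-integrable setT (EFin \o (fun v => u v * (k (x + h *: v) * f (x + h *: v)))).
  apply: integrableM_bmf => //.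
  by apply: bmfM; apply: (bmf_precomp _ (measurable_row_lin x h)).
have [||_ ->] := @integral_affine R d (fun y => k y * scaled u x y * f y) x h h0.
- by apply: measurable_funM => //; case: bG.
- have := integrableZl measurableT (h ^+ d)^-1 ikf; apply: eq_integrable => // v _.
  by rewrite /= E.
under eq_Rintegral do rewrite E.
by rewrite RintegralZl// mulrA divff ?mul1r// gt_eqF.
Qed.

(** The mean of the kernel estimator at a fixed point, after the change of variables that makes it
    comparable with [f x]. *)
Definition smoothed (x : rV) : R := \int[leb]_u (K u * f (x + h *: u)).

Let K1 := \int[leb]_u `|K u|.

Let K10 : 0 <= K1. Proof. by apply: Rintegral_ge0. Qed.

Let bnK : bmf (fun u => `|K u|).
Proof.
split; first exact: (measurableT_comp (@normr_measurable R setT) mK).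
by exists KM => x; rewrite normr_id.
Qed.

Let inK : leb.-integrable setT (EFin \o (fun u => `|K u|)).
Proof. exact: integrable_norm iK. Qed.

Let bfx x : bmf (fun u : rV => f (x + h *: u)).
Proof. exact: bmf_precomp bf (measurable_row_lin x h). Qed.

Lemma expect_kernel x : \int[P]_w scaled K x (X 0%N w) = smoothed x.
Proof.
have := expect_scaled x bK iK (bmf_cst _ 1).
under eq_Rintegral do rewrite mul1r.
by move=> ->; apply: eq_Rintegral => u _; rewrite mul1r.
Qed.

Let norm_smoothed x : \int[leb]_u (`|K u| * f (x + h *: u)) <= Bf * K1.
Proof.
rewrite /K1 -RintegralZl//; apply: le_Rintegral => //.
- exact: integrableM_bmf.
- exact: (integrableZl measurableT Bf inK).
- by move=> u _; rewrite mulrC ler_wpM2r.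
Qed.

Lemma smoothed_le x : `|smoothed x| <= Bf * K1.
Proof.
have i1 := integrableM_bmf iK (bfx x).
apply: le_trans (le_normr_Rintegral _ i1) _ => //.
apply: le_trans (norm_smoothed x).
by under eq_Rintegral do rewrite normrM (ger0_norm (f0 _)).
Qed.

Let A := KM * (Bf * K1).

(** One factor of the square is bounded by its supremum and the other is integrated, so that only
    one of the two factors [h ^ (- d)] survives. *)
Lemma kernel_moment2 x : \int[P]_w (scaled K x (X 0%N w) ^+ 2) <= A / h ^+ d.
Proof.
have b1 := bmf_precomp (bmf_pair1 x (bmf_scaled bK)) (measurable_funPT (X 0%N)).
have b2 := bmf_precomp (bmf_pair1 x (bmf_scaled bnK)) (measurable_funPT (X 0%N)).
apply: (@le_trans _ _ (\int[P]_w (KM / h ^+ d * (1 * scaled (fun u => `|K u|) x (X 0%N w))))).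
  apply: expect_le; first exact: bmfX.
    by apply: bmfM; [exact: bmf_cst|apply: bmfM => //; exact: bmf_cst].
  move=> w; rewrite /scaled mul1r; set z := h^-1 *: _.
  rewrite exprMn -[K z ^+ 2]real_normK ?num_real// expr2.
  rewrite (_ : KM / _ * _ = (h ^+ d)^-1 * (h ^+ d)^-1 * (KM * `|K z|)); last by ring.
  by rewrite ler_wpM2l ?mulr_ge0 ?invr_ge0 ?(ltW hd0)// expr2 ler_wpM2r.
rewrite expectZ; last by apply: bmfM => //; exact: bmf_cst.
rewrite (expect_scaled x bnK inK (bmf_cst _ 1)) /A -!mulrA ler_wpM2l//.
rewrite mulrC [leRHS]mulrA ler_wpM2r ?invr_ge0 ?(ltW hd0)//.
by under eq_Rintegral do rewrite mul1r.
Qed.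

Definition centered (x y : rV) : R := scaled K x y - smoothed x.

Lemma bmf_smoothed : bmf smoothed.
Proof.
rewrite (_ : smoothed = fun x => \int[P]_w scaled K x (X 0%N w)); last first.
  by apply/funext => x; rewrite expect_kernel.
exact: (bmf_expect P (eta := X 0%N) (measurable_funPT _) (bmf_scaled bK)).
Qed.

Lemma bmf_centered : bmf (fun z : rV * rV => centered z.1 z.2).
Proof.
apply: bmfB; first exact: bmf_scaled.
exact: (bmf_precomp bmf_smoothed measurable_fst).
Qed.

Let bcx x : bmf (centered x). Proof. exact: (bmf_pair1 x bmf_centered). Qed.

Let bsx x : bmf (fun w => scaled K x (X 0%N w)).
Proof. exact: bmf_precomp (bmf_pair1 x (bmf_scaled bK)) (measurable_funPT (X 0%N)). Qed.

Lemma centered_moment1 x : \int[P]_w centered x (X 0%N w) = 0.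
Proof.
by rewrite expectB//; [rewrite expect_kernel expect_cst subrr|exact: bmf_cst].
Qed.

Lemma centered_moment2 x : \int[P]_w (centered x (X 0%N w) ^+ 2) <= A / h ^+ d.
Proof.
apply: le_trans (kernel_moment2 x).
have E : \int[P]_w (centered x (X 0%N w) ^+ 2) =
   \int[P]_w (scaled K x (X 0%N w) ^+ 2 -
     (2 * smoothed x * centered x (X 0%N w) + smoothed x ^+ 2)).
  by apply: eq_Rintegral => w _; rewrite /centered; ring.
have bc : bmf (fun w => centered x (X 0%N w)) by exact: bmf_precomp.
rewrite E expectB; last 2 first.
- exact: bmfX.
- by apply: bmfD; [apply: bmfM => //; exact: bmf_cst|exact: bmf_cst].
rewrite expectD; last 2 first.
- by apply: bmfM => //; exact: bmf_cst.
- exact: bmf_cst.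
by rewrite expectZ// centered_moment1 mulr0 add0r expect_cst gerBl sqr_ge0.
Qed.

Lemma centered_le x y : `|centered x y| <= 2 * KM / h ^+ d.
Proof.
have sc z : `|scaled K x z| <= KM / h ^+ d.
  rewrite /scaled normrM ger0_norm ?invr_ge0 ?(ltW hd0)// mulrC.
  by rewrite ler_wpM2r ?invr_ge0 ?(ltW hd0).
apply: le_trans (ler_normB _ _) _.
have : `|smoothed x| <= KM / h ^+ d.
  by rewrite -expect_kernel; apply: expect_normE => //; case: (bsx x).
by have := sc y; rewrite -mulrA; lra.
Qed.

Lemma centered_moment4 x : \int[P]_w (centered x (X 0%N w) ^+ 4) <=
  (2 * KM / h ^+ d) ^+ 2 * (A / h ^+ d).
Proof.
have bc : bmf (fun w => centered x (X 0%N w)) by exact: bmf_precomp.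
apply: (@le_trans _ _ (\int[P]_w ((2 * KM / h ^+ d) ^+ 2 * centered x (X 0%N w) ^+ 2))).
  apply: expect_le; first exact: bmfX.
    by apply: bmfM; [exact: bmf_cst|exact: bmfX].
  move=> w; rewrite -[4%N]/(2 + 2)%N exprD ler_wpM2r ?sqr_ge0//.
  rewrite -[centered _ _ ^+ 2]real_normK ?num_real// lerXn2r ?nnegrE ?centered_le//.
  by rewrite divr_ge0 ?mulr_ge0// ltW.
rewrite expectZ; last exact: bmfX.
by rewrite ler_wpM2l ?sqr_ge0// centered_moment2.
Qed.

Section leave_one_out.
Variables (n : nat) (i : 'I_n).

Let s : seq nat := [seq j <- index_iota 0 n | j != i :> nat].

Let us : uniq s. Proof. by rewrite filter_uniq// iota_uniq. Qed.

Let s_le : (size s)%:R <= n%:R :> R.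
Proof.
by rewrite ler_nat size_filter (leq_trans (count_size _ _))// size_iota subn0.
Qed.

Let sumE (F : nat -> R) : \sum_(j < n | j != i) F j = \sum_(j <- s) F j.
Proof. by rewrite /s big_filter big_mkord. Qed.

Definition loo_error (w : O) : R :=
  n%:R^-1 * \sum_(j < n | j != i) centered (X i w) (X j w).

Let n0 : (0 : R) < n%:R. Proof. by rewrite ltr0n; exact: leq_ltn_trans (ltn_ord i). Qed.

Lemma bmf_loo_error : bmf loo_error.
Proof.
apply: bmfM; first exact: bmf_cst.
apply: bmf_sum => j.
by apply: (bmf_precomp bmf_centered (g := fun w => (X i w, X j w))); exact: measurable_fun_pair.
Qed.

Let J1 : set (nat + nat) := [set inl (i : nat)].
Let J2 : set (nat + nat) := [set z | if z is inl j then j != i :> nat else false].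

Let J12 : J1 `&` J2 = set0.
Proof. by rewrite -subset0 => z [/= ->] /=; rewrite eqxx. Qed.

(** With [X i] frozen at [x], the other points remain i.i.d. and their terms centered; leaving out
    [i] is what makes this possible, and a bound uniform in [x] survives averaging. *)
Let moment_le p c : (forall x, \int[P]_w ((\sum_(j <- s) centered x (X j w)) ^+ p) <= c) ->
  \int[P]_w (loo_error w ^+ p) <= n%:R^-1 ^+ p * c.
Proof.
move=> hc.
pose F (w w' : O) := (n%:R^-1 * \sum_(j < n | j != i) centered (X i w) (X j w')) ^+ p.
have bF : bmf (fun z : subsample X e J1 * subsample X e J2 => F z.1 z.2).
  apply: bmfX; apply: bmfM; first exact: bmf_cst.
  have -> : (fun z : subsample X e J1 * subsample X e J2 =>
        \sum_(j < n | j != i) centered (X i z.1) (X j z.2)) = fun z =>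
      \sum_(j < n) if j != i then centered (X i z.1) (X j z.2) else 0.
    by apply/funext => z; rewrite big_mkcond.
  apply: bmf_sum => j; case: (boolP (j != i)) => ji; last exact: bmf_cst.
  apply: (bmf_precomp bmf_centered (g := fun z : subsample X e J1 *
    subsample X e J2 => (X i z.1, X j z.2))); apply: measurable_fun_pair.
    exact: (measurableT_comp (subsample_X (X := X) (e := e) (J := J1)
      (i := i) erefl) measurable_fst).
  exact: (measurableT_comp (subsample_X (X := X) (e := e) (J := J2)
    (i := j) ji) measurable_snd).
have b1 x : bmf (fun w => \sum_(j <- s) centered x (X j w)).
  by apply: bmf_sum => j; exact: bmf_precomp.
rewrite [leLHS](subsample_expect hX he hXe J12 (F := F)) //.
rewrite -[leRHS](expect_cst P); apply: expect_le => [||w].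
- have := bmf_integral P (F := fun z : rV * O => (n%:R^-1 *
    \sum_(j < n | j != i) centered z.1 (X j z.2)) ^+ p).
  move=> bI; apply: (bmf_precomp (bI _) (measurable_funPT (X i))).
  apply: bmfX; apply: bmfM; first exact: bmf_cst.
  apply: bmf_sum => j; apply: (bmf_precomp bmf_centered (g := fun z : rV * O => (z.1, X j z.2))).
  by apply: measurable_fun_pair => //; exact: (measurableT_comp (measurable_funPT (X j))).
- exact: bmf_cst.
- rewrite /F; under eq_Rintegral do rewrite exprMn (sumE (fun j => centered (X i w) (X j _))).
  by rewrite (expectZ P _ (bmfX p (b1 (X i w)))) ler_wpM2l// exprn_ge0// invr_ge0 ltW.
Qed.

Lemma loo_error_moment2 : \int[P]_w (loo_error w ^+ 2) <= A / (n%:R * h ^+ d).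
Proof.
have Ah : 0 <= A / h ^+ d by rewrite divr_ge0 ?mulr_ge0 ?(ltW hd0).
apply: le_trans (moment_le (p := 2) (c := n%:R * (A / h ^+ d)) _) _ => [x|].
  rewrite (sum_moment2 hX he hXe (bcx x) (centered_moment1 x) us).
  by apply: ler_pM => //; [apply: Rintegral_ge0 => w _; exact: sqr_ge0|exact: centered_moment2].
rewrite le_eqVlt; apply/orP; left; apply/eqP.
by field; rewrite !gt_eqF.
Qed.

(** The cube comes from the fourth moments of single terms, the square from the squared variance of
    the sum; the square dominates as the effective sample size [n h^d] grows. *)
Lemma loo_error_moment4 : \int[P]_w (loo_error w ^+ 4) <=
  4 * KM ^+ 2 * A * (n%:R * h ^+ d)^-1 ^+ 3 + 3 * A ^+ 2 * (n%:R * h ^+ d)^-1 ^+ 2.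
Proof.
have A0 : 0 <= A by rewrite !mulr_ge0.
have Ah : 0 <= A / h ^+ d by rewrite divr_ge0 ?(ltW hd0).
pose c := n%:R * ((2 * KM / h ^+ d) ^+ 2 * (A / h ^+ d)) + 3 * (n%:R * (A / h ^+ d)) ^+ 2.
apply: le_trans (moment_le (p := 4) (c := c) _) _ => [x|].
  apply: le_trans (sum_moment4 hX he hXe (bcx x) (centered_moment1 x) us) _.
  have m2 : 0 <= \int[P]_w (centered x (X 0%N w) ^+ 2).
    by apply: Rintegral_ge0 => w _; exact: sqr_ge0.
  apply: lerD.
    apply: ler_pM => //; last exact: centered_moment4.
    by apply: Rintegral_ge0 => w _; rewrite exprn_even_ge0.
  rewrite ler_wpM2l// lerXn2r ?nnegrE ?(mulr_ge0 (ler0n _ _) Ah) ?(mulr_ge0 (ler0n _ _) m2)//.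
  by apply: ler_pM => //; exact: centered_moment2.
rewrite le_eqVlt; apply/orP; left; apply/eqP; rewrite /c.
by field; rewrite !gt_eqF.
Qed.

(** The estimator divides a sum of [n - 1] terms by [n], whence the factor in front of its
    conditional mean. *)
Lemma loo_kde_error (hn : nat -> R) w : hn n = h ->
  loo_kde X K hn i (X i w) w = loo_error w + n.-1%:R / n%:R * smoothed (X i w).
Proof.
move=> hnE; rewrite /loo_kde hnE /loo_error /centered sumrB mulrBr.
have -> : \sum_(j < n | j != i) smoothed (X i w) = n.-1%:R * smoothed (X i w).
  rewrite sumr_const (_ : #|_| = n.-1) ?mulr_natl//.
  by rewrite cardC1 card_ord.
rewrite /scaled -mulr_sumr invfM mulrA; ring.
Qed.

End leave_one_out.
End kernel_estimates.

(** * Hoeffding decomposition and the linear part of the expansion *)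

Section off_diagonal_sums.
Context {R : realType}.

Lemma sum_off_diagonal (F : nat -> nat -> R) n :
  \sum_(i < n) \sum_(j < n | j != i) F i j =
  \sum_(0 <= i < n) \sum_(0 <= j < i) (F i j + F j i).
Proof.
have E m : \sum_(i < m) \sum_(j < m | j != i) F i j =
    \sum_(i < m) (\sum_(j < m) F i j - F i i).
  by apply: eq_bigr => i _; rewrite [in RHS](bigD1 i)//= addrAC subrr add0r.
rewrite E {E}; elim: n => [|n IH]; first by rewrite big_ord0 big_geq.
rewrite big_nat_recr//= -IH big_ord_recr/= big_ord_recr/= addrK.
under eq_bigr do rewrite big_ord_recr/= addrAC.
rewrite big_split/= -addrA; congr (_ + _).
by rewrite [RHS]big_mkord [in RHS]big_split/= addrC.
Qed.

(** A purely algebraic identity; [u1], [u2] and [th] will be the two projections and the mean. The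
    pairs are symmetrized so that the first sum runs over [j < i], the form whose second moment is
    known. *)
Lemma hoeffding_decomposition (F : nat -> nat -> R) (u1 u2 : nat -> R) th n :
  let G i j := F i j - u1 i - u2 j + th in
  \sum_(i < n) \sum_(j < n | j != i) F i j =
  \sum_(0 <= i < n) \sum_(0 <= j < i) (G i j + G j i) +
  (n%:R - 1) * (\sum_(i < n) u1 i + \sum_(i < n) u2 i) - n%:R * (n%:R - 1) * th.
Proof.
move=> G; rewrite -sum_off_diagonal.
have E i : \sum_(j < n | j != i) F i j = \sum_(j < n | j != i) G i j +
    (n%:R - 1) * u1 i + (\sum_(j < n) u2 j - u2 i) - (n%:R - 1) * th.
  have -> : \sum_(j < n | j != i) G i j = \sum_(j < n | j != i) F i j -
      \sum_(j < n | j != i) u1 i - \sum_(j < n | j != i) u2 j + \sum_(j < n | j != i) th.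
    by rewrite /G big_split/= !sumrB.
  have C (c : R) : \sum_(j < n | j != i) c = (n%:R - 1) * c.
    have := sumr_const [pred j : 'I_n | true] c; rewrite card_ord (bigD1 i)//= => h.
    rewrite mulrBl mul1r mulr_natl -h [c + _]addrC addrK.
    by [].
  by rewrite !C [\sum_(j < n) u2 j](bigD1 i)//=; ring.
under eq_bigr do rewrite E.
have C (c : R) : \sum_(i < n) c = n%:R * c by rewrite sumr_const card_ord mulr_natl.
rewrite !big_split/= -mulr_sumr !sumrN !C; ring.
Qed.

End off_diagonal_sums.

Lemma expect_swap {R : realType} d (T : measurableType d) (P : probability T R)
    (F : T * T -> R) : bmf F ->
  \int[P]_x \int[P]_y F (x, y) = \int[P]_y \int[P]_x F (x, y).
Proof.
move=> bF.
have iF : (P \x P)%E.-integrable setT (EFin \o F).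
  exact: bmf_integrable_fin (product_probability_lty _ _) bF.
have := Fubini iF; rewrite /Rintegral.
have -> : (\int[P]_x \int[P]_y (EFin \o F) (x, y) =
    \int[P]_x (fine (\int[P]_y (F (x, y))%:E))%:E)%E.
  apply: eq_integral => x _; rewrite fineK//.
  by apply: integrable_fin_num => //; apply: bmf_integrable; exact: bmf_pair1.
move=> ->; congr fine; apply: eq_integral => y _; rewrite fineK//.
by apply: integrable_fin_num => //; apply: bmf_integrable; exact: bmf_pair2.
Qed.

Section linear_part.
Context {R : realType} dO (O : measurableType dO) (P : probability O R).
Context (d : nat) d2 (T2 : measurableType d2).
Notation rV := ('rV[R]_d).
Notation leb := (lebesgue_row d).
Variables (X : nat -> {RV P >-> rV}) (e : nat -> {RV P >-> T2}).
Hypotheses (hX : iid X) (he : iid e) (hXe : independent_seqs X e).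
Variables (f K : rV -> R) (Bf KM : R).
Hypotheses (hf : has_density (X 0%N) f) (fB : forall x, f x <= Bf)
  (mK : measurable_fun setT K) (iK : leb.-integrable setT (EFin \o K))
  (KB : forall x, `|K x| <= KM) (Ks : forall x, K (- x) = K x).
Variables (h : R) (a : rV -> R) (aM : R).
Hypotheses (h0 : 0 < h) (ma : measurable_fun setT a) (aB : forall x, `|a x| <= aM).

Let mf : measurable_fun setT f. Proof. by case: hf. Qed.
Let f0 x : 0 <= f x. Proof. by case: hf. Qed.
Let bf : bmf f. Proof. by split => //; exists Bf => x; rewrite ger0_norm. Qed.
Let bK : bmf K. Proof. by split => //; exists KM. Qed.
Let ba : bmf a. Proof. by split => //; exists aM. Qed.
Let aM0 : 0 <= aM. Proof. exact: le_trans (aB 0). Qed.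
Let K1 := \int[leb]_u `|K u|.
Let A := KM * (Bf * K1).
Let U := aM * (Bf * K1).
(** For [a = g psi_k / f^2] this is the function [q]. *)
Definition ratio (x : rV) : R := a x * f x.
Let q := ratio.

Let bq : bmf q. Proof. exact: bmfM. Qed.

Let s (x y : rV) := a x * scaled h K x y.
Let u1 (x : rV) := a x * smoothed f K h x.

(** The projection of the pair kernel on its second variable; symmetry of [K] turns the average over
    the first variable into a smoothing of [q]. *)
Definition smoothed_ratio (y : rV) : R := \int[leb]_v (K v * q (y + h *: v)).
Let u2 := smoothed_ratio.

Let scaledC x y : scaled h K x y = scaled h K y x.
Proof. by rewrite /scaled -(Ks (h^-1 *: (x - y))) -scalerN opprB. Qed.

Let bsc : bmf (fun z : rV * rV => scaled h K z.1 z.2).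
Proof. exact: bmf_scaled. Qed.

Let bs : bmf (fun z : rV * rV => s z.1 z.2).
Proof. by apply: bmfM => //; exact: bmf_precomp ba measurable_fst. Qed.

Let su1 x : \int[P]_w s x (X 0%N w) = u1 x.
Proof.
rewrite expectZ; last by exact: bmf_precomp (bmf_pair1 x bsc) (measurable_funPT (X 0%N)).
by rewrite (expect_kernel hf fB mK iK KB h0).
Qed.

Let su2 y : \int[P]_w s (X 0%N w) y = u2 y.
Proof.
apply: etrans (expect_scaled hf fB h0 y bK iK ba).
by apply: eq_Rintegral => w _; rewrite /s scaledC.
Qed.

Let bsmoothed : bmf (smoothed f K h).
Proof. exact: (bmf_smoothed hf fB mK iK KB h0). Qed.

Let bu1 : bmf u1. Proof. exact: bmfM. Qed.

Lemma bmf_smoothed_ratio : bmf smoothed_ratio.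
Proof.
rewrite (_ : smoothed_ratio = fun y => \int[P]_w s (X 0%N w) y); last first.
  by apply/funext => y; rewrite su2.
apply: (bmf_expect P (eta := X 0%N) (measurable_funPT _)
  (F := fun z : rV * rV => s z.2 z.1)).
by apply: (bmf_precomp bs (g := fun z : rV * rV => (z.2, z.1))); exact: measurable_fun_pair.
Qed.

Let bu2 : bmf u2. Proof. exact: bmf_smoothed_ratio. Qed.

Let u1_le x : `|u1 x| <= U.
Proof.
by rewrite normrM; apply: ler_pM => //; exact: (smoothed_le hf fB iK h x).
Qed.

Lemma smoothed_ratio_le y : `|smoothed_ratio y| <= U.
Proof.
have bqy : bmf (fun v : rV => q (y + h *: v)).
  exact: bmf_precomp bq (measurable_row_lin y h).
apply: le_trans (le_normr_Rintegral _ (integrableM_bmf iK bqy)) _ => //.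
rewrite /U mulrA /K1 -RintegralZl//; last exact: integrable_norm iK.
apply: le_Rintegral => //.
- exact: (integrable_norm (integrableM_bmf iK bqy)).
- exact: (integrableZl measurableT _ (integrable_norm iK)).
- move=> v _; rewrite normrM mulrC ler_wpM2r// normrM ler_pM//.
  by rewrite ger0_norm.
Qed.

Let u2_le y : `|u2 y| <= U. Proof. exact: smoothed_ratio_le. Qed.

Let th := \int[P]_w u1 (X 0%N w).

Let bX (k : rV -> R) i : bmf k -> bmf (fun w => k (X i w)).
Proof. by move=> bk; exact: bmf_precomp bk (measurable_funPT (X i)). Qed.

Let th_le : `|th| <= U.
Proof. by apply: expect_normE => [|w]; [case: (bX 0 bu1)|exact: u1_le]. Qed.

(** Smoothing [q] and smoothing [f] have the same mean effect, by exchanging the two variables; this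
    is how the bias of [q] is traded for that of [f]. *)
Let th2 : \int[P]_w u2 (X 0%N w) = th.
Proof.
rewrite /th; under [RHS]eq_Rintegral do rewrite -su1.
under eq_Rintegral do rewrite -su2.
have bF : bmf (fun z : O * O => s (X 0%N z.1) (X 0%N z.2)).
  apply: (bmf_precomp bs (g := fun z : O * O => (X 0%N z.1 : rV, X 0%N z.2 : rV))).
  by apply: measurable_fun_pair; exact: measurableT_comp.
exact: (esym (expect_swap P bF)).
Qed.

(** The degenerate part of the pair kernel: its mean in either variable is 0. Its symmetrization
    [sb] inherits this. *)
Let st (x y : rV) := s x y - u1 x - u2 y + th.
Let sb (z : rV * rV) := st z.1 z.2 + st z.2 z.1.

Let bst : bmf (fun z : rV * rV => st z.1 z.2).
Proof.
apply: bmfD; last exact: bmf_cst.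
apply: bmfB; last exact: bmf_precomp bu2 measurable_snd.
by apply: bmfB => //; exact: bmf_precomp bu1 measurable_fst.
Qed.

Let bsb : bmf sb.
Proof.
apply: bmfD => //.
by apply: (bmf_precomp bst (g := fun z : rV * rV => (z.2, z.1))); exact: measurable_fun_pair.
Qed.

Let st1 x : \int[P]_w st x (X 0%N w) = 0.
Proof.
rewrite expectD ?expectB ?su1 ?expect_cst ?th2//;
  try by [exact: bmf_cst|exact: bX|exact: bX (bmf_pair1 x bs)].
- ring.
- by apply: bmfB; [exact: bX (bmf_pair1 x bs)|exact: bmf_cst].
- by apply: bmfB; [apply: bmfB; [exact: bX (bmf_pair1 x bs)|exact: bmf_cst]|exact: bX].
Qed.

Let st2 y : \int[P]_w st (X 0%N w) y = 0.
Proof.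
have b2 : bmf (fun w => s (X 0%N w) y) by exact: bX (bmf_pair2 y bs).
rewrite expectD ?expectB ?su2 ?expect_cst//;
  try by [exact: bmf_cst|exact: bX].
- rewrite -/th; ring.
- by apply: bmfB => //; exact: bX.
- by apply: bmfB; [apply: bmfB => //; exact: bX|exact: bmf_cst].
Qed.

Let sb1 x : \int[P]_w sb (x, X 0%N w) = 0.
Proof.
rewrite /sb/= expectD ?st1 ?st2 ?addr0//.
  exact: bX (bmf_pair1 x bst).
exact: bX (bmf_pair2 x bst).
Qed.

Let sb2 y : \int[P]_w sb (X 0%N w, y) = 0.
Proof.
rewrite /sb/= expectD ?st1 ?st2 ?addr0//.
  exact: bX (bmf_pair2 y bst).
exact: bX (bmf_pair1 y bst).
Qed.

Let sb_moment2 : \int[P]_w \int[P]_w' (sb (X 0%N w, X 0%N w') ^+ 2) <=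
  8 * aM ^+ 2 * (A / h ^+ d) + 72 * U ^+ 2.
Proof.
rewrite -[leRHS](expect_cst P); apply: expect_le; [|exact: bmf_cst|move=> w].
  apply: (bX 0 (k := fun x => \int[P]_w' (sb (x, X 0%N w') ^+ 2))).
  apply: (bmf_expect P (eta := X 0%N) (measurable_funPT _) (F := fun z => sb z ^+ 2)).
  exact: bmfX.
set x := X 0%N w.
have b1 : bmf (fun w => scaled h K x (X 0%N w) ^+ 2).
  by apply: bmfX; exact: bX (bmf_pair1 x bsc).
(* The square of a sum is at most twice the sum of squares: 8 is twice the square of 2, from
   [|a x + a y| <= 2 aM], and 72 is twice the square of 6, from four projections and twice the mean,
   each at most [U]. *)
apply: (@le_trans _ _ (\int[P]_w' (8 * aM ^+ 2 * scaled h K x (X 0%N w') ^+ 2 + 72 * U ^+ 2))).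
  apply: expect_le.
  - by apply: bmfX; exact: bX (bmf_pair1 x bsb).
  - by apply: bmfD; [apply: bmfM => //; exact: bmf_cst|exact: bmf_cst].
  - move=> w'; set y := X 0%N w'.
    have -> : sb (x, y) = (a x + a y) * scaled h K x y +
      (- u1 x - u1 y - u2 x - u2 y + 2 * th).
      by rewrite /sb /st /s /= (scaledC y x); ring.
    set c := (X in _ + X); set z := scaled h K x y.
    have c2 : c ^+ 2 <= 36 * U ^+ 2.
      have cU : `|c| <= 6 * U.
        move: (u1_le x) (u1_le y) (u2_le x) (u2_le y) th_le.
        by rewrite /c !ler_norml; lra.
      rewrite -[c ^+ 2]real_normK ?num_real//.
      have -> : 36 * U ^+ 2 = (6 * U) ^+ 2 by ring.
      by rewrite lerXn2r ?nnegrE ?(le_trans _ cU).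
    have a2 : (a x + a y) ^+ 2 <= 4 * aM ^+ 2.
      have aU : `|a x + a y| <= 2 * aM.
        by apply: le_trans (ler_normD _ _) _; have := aB x; have := aB y; lra.
      rewrite -[(_ + _) ^+ 2]real_normK ?num_real//.
      have -> : 4 * aM ^+ 2 = (2 * aM) ^+ 2 by ring.
      by rewrite lerXn2r ?nnegrE ?mulr_ge0.
    have := ler_wpM2r (sqr_ge0 z) a2; have := sqr_ge0 ((a x + a y) * z - c).
    rewrite !expr2; nra.
rewrite (expectD P (bmfM (bmf_cst _ (8 * aM ^+ 2)) b1) (bmf_cst _ (72 * U ^+ 2))).
rewrite (expectZ P _ b1) expect_cst.
rewrite lerD2r ler_wpM2l ?mulr_ge0 ?sqr_ge0//.
exact: (kernel_moment2 hf fB mK iK KB h0).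
Qed.

Variable n : nat.
Hypothesis n0 : (0 < n)%N.

Let c : R := n.-1%:R / n%:R.
Let Iq := \int[P]_w q (X 0%N w).

Definition linear_part (w : O) : R := Num.sqrt n%:R *
  (n%:R^-1 * \sum_(i < n) (2 * q (X i w) - a (X i w) *
    (n%:R^-1 * \sum_(j < n | j != i) scaled h K (X i w) (X j w))) - Iq).

(** The term [2 q] is shared equally between the two linear terms, so that each compares [q] with
    one projection approximating it; this is the first-order cancellation. *)
Let k1 x := (q x - c * u1 x) - (Iq - c * th).
Let k2 x := (q x - c * u2 x) - (Iq - c * th).
Let D w := \sum_(0 <= i < n) \sum_(0 <= j < i) sb (X i w, X j w).

Let linear_partE w : linear_part w = - (Num.sqrt n%:R / n%:R ^+ 2 * D w) +
  Num.sqrt n%:R / n%:R * \sum_(i < n) k1 (X i w) +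
  Num.sqrt n%:R / n%:R * \sum_(i < n) k2 (X i w) + Num.sqrt n%:R * (Iq - c * th).
Proof.
have nn : n%:R != 0 :> R by rewrite pnatr_eq0 -lt0n.
have cE : n%:R * c = n%:R - 1.
  by rewrite /c mulrCA divff// mulr1 -subn1 natrB.
rewrite /linear_part sumrB -mulr_sumr.
have -> : \sum_(i < n) a (X i w) * (n%:R^-1 * \sum_(j < n | j != i) scaled h K (X i w) (X j w)) =
    n%:R^-1 * \sum_(i < n) \sum_(j < n | j != i) s (X i w) (X j w).
  rewrite mulr_sumr; apply: eq_bigr => i _; rewrite mulrCA; congr (_ * _).
  by rewrite mulr_sumr.
rewrite (hoeffding_decomposition (fun i j => s (X i w) (X j w)) (fun i => u1 (X i w))
  (fun j => u2 (X j w)) th n) -/(D w) -cE.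
have C (z : R) : \sum_(i < n) z = n%:R * z by rewrite sumr_const card_ord mulr_natl.
rewrite /k1 /k2 !sumrB -!mulr_sumr !C.
by field.
Qed.

Let bk1 : bmf k1.
Proof. by apply: bmfB; [apply: bmfB => //; apply: bmfM => //|]; exact: bmf_cst. Qed.

Let bk2 : bmf k2.
Proof. by apply: bmfB; [apply: bmfB => //; apply: bmfM => //|]; exact: bmf_cst. Qed.

Let bD : bmf D.
Proof.
apply: bmf_sum => i; apply: bmf_sum => j.
by apply: (bmf_precomp bsb (g := fun w => (X i w, X j w))); exact: measurable_fun_pair.
Qed.

Let Ek1 : \int[P]_w k1 (X 0%N w) = 0.
Proof.
have b1 : bmf (fun w => c * u1 (X 0%N w)) by apply: bmfM; [exact: bmf_cst|exact: bX].
rewrite expectB ?expectB ?expectZ ?expect_cst -/Iq -/th ?subrr//;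
  by [exact: bmf_cst|exact: bX|apply: bmfB => //; exact: bX].
Qed.

Let Ek2 : \int[P]_w k2 (X 0%N w) = 0.
Proof.
have b2 : bmf (fun w => c * u2 (X 0%N w)) by apply: bmfM; [exact: bmf_cst|exact: bX].
rewrite expectB ?expectB ?expectZ ?th2 ?expect_cst -/Iq ?subrr//;
  by [exact: bmf_cst|exact: bX|apply: bmfB => //; exact: bX].
Qed.

Let variance_le (k : rV -> R) m : bmf k -> \int[P]_w (k (X 0%N w) - m) = 0 ->
  \int[P]_w ((k (X 0%N w) - m) ^+ 2) <= \int[P]_w (k (X 0%N w) ^+ 2).
Proof.
move=> bk km.
have bkm : bmf (fun w => k (X 0%N w) - m) by apply: bmfB; [exact: bX|exact: bmf_cst].
have -> : \int[P]_w (k (X 0%N w) ^+ 2) =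
   \int[P]_w ((k (X 0%N w) - m) ^+ 2 + (2 * m * (k (X 0%N w) - m) + m ^+ 2)).
  by apply: eq_Rintegral => w _; ring.
rewrite expectD; last 2 first.
- exact: bmfX.
- by apply: bmfD; [apply: bmfM => //; exact: bmf_cst|exact: bmf_cst].
rewrite [X in _ + X]expectD; last 2 first.
- by apply: bmfM => //; exact: bmf_cst.
- exact: bmf_cst.
by rewrite expectZ// km mulr0 add0r expect_cst lerDl sqr_ge0.
Qed.

Let mean_moment2 (k : rV -> R) : bmf k -> \int[P]_w k (X 0%N w) = 0 ->
  \int[P]_w ((Num.sqrt n%:R / n%:R * \sum_(i < n) k (X i w)) ^+ 2) =
  \int[P]_w (k (X 0%N w) ^+ 2).
Proof.
move=> bk k0; have nn : n%:R != 0 :> R by rewrite pnatr_eq0 -lt0n.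
under eq_Rintegral do rewrite exprMn -(big_mkord xpredT (fun i => k (X i _))).
rewrite expectZ; last by apply: bmfX; apply: bmf_sum => i; exact: bX.
rewrite (sum_moment2 hX he hXe bk k0 (iota_uniq _ _)) size_iota subn0.
by rewrite exprMn sqr_sqrtr// mulrA exprVn expr2 invfM mulrA divff// mul1r mulVf// mul1r.
Qed.

Lemma bmf_linear_part : bmf linear_part.
Proof.
rewrite (_ : linear_part = fun w => - (Num.sqrt n%:R / n%:R ^+ 2 * D w) +
  Num.sqrt n%:R / n%:R * \sum_(i < n) k1 (X i w) +
  Num.sqrt n%:R / n%:R * \sum_(i < n) k2 (X i w) + Num.sqrt n%:R * (Iq - c * th)).
  apply: bmfD; last exact: bmf_cst.
  apply: bmfD; [apply: bmfD; [apply: bmfN|]|];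
    by apply: bmfM; [exact: bmf_cst|try (apply: bmf_sum => i; exact: bX)].
by apply/funext => w; exact: linear_partE.
Qed.

Lemma linear_part_moment2 : \int[P]_w (linear_part w ^+ 2) <=
  4 * ((8 * aM ^+ 2 * (A / h ^+ d) + 72 * U ^+ 2) / n%:R +
       \int[P]_w ((q (X 0%N w) - c * u1 (X 0%N w)) ^+ 2) +
       \int[P]_w ((q (X 0%N w) - c * u2 (X 0%N w)) ^+ 2) +
       n%:R * (Iq - c * th) ^+ 2).
Proof.
have nn : n%:R != 0 :> R by rewrite pnatr_eq0 -lt0n.
pose t1 w := Num.sqrt n%:R / n%:R ^+ 2 * D w.
pose t2 w := Num.sqrt n%:R / n%:R * \sum_(i < n) k1 (X i w).
pose t3 w := Num.sqrt n%:R / n%:R * \sum_(i < n) k2 (X i w).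
pose t4 := Num.sqrt n%:R * (Iq - c * th).
have b1 : bmf t1 by apply: bmfM => //; exact: bmf_cst.
have b2 : bmf t2 by apply: bmfM; [exact: bmf_cst|apply: bmf_sum => i; exact: bX].
have b3 : bmf t3 by apply: bmfM; [exact: bmf_cst|apply: bmf_sum => i; exact: bX].
have b12 : bmf (fun w => t1 w ^+ 2 + t2 w ^+ 2) by apply: bmfD; exact: bmfX.
have b123 : bmf (fun w => t1 w ^+ 2 + t2 w ^+ 2 + t3 w ^+ 2) by apply: bmfD => //; exact: bmfX.
apply: (@le_trans _ _ (\int[P]_w (4 * (t1 w ^+ 2 + t2 w ^+ 2 + t3 w ^+ 2 + t4 ^+ 2)))).
  apply: expect_le.
  - exact: bmfX bmf_linear_part.
  - by apply: bmfM; [exact: bmf_cst|apply: bmfD => //; exact: bmf_cst].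
  - move=> w; rewrite linear_partE -/(t1 w) -/(t2 w) -/(t3 w) -/t4.
    move: (t1 w) (t2 w) (t3 w) t4 => y1 y2 y3 y4.
    (* Cauchy-Schwarz for four terms, the first with a minus sign: these six squares add up to the
       difference of the two sides. *)
    have := sqr_ge0 (y1 + y2); have := sqr_ge0 (y1 + y3); have := sqr_ge0 (y1 + y4).
    have := sqr_ge0 (y2 - y3); have := sqr_ge0 (y2 - y4); have := sqr_ge0 (y3 - y4).
    rewrite !expr2; lra.
rewrite expectZ; last by apply: bmfD => //; exact: bmf_cst.
rewrite expectD ?expectD ?expect_cst//; try by [exact: bmfX|exact: bmf_cst].
rewrite ler_wpM2l//; apply: lerD; [apply: lerD; [apply: lerD|]|].
- rewrite /t1; under eq_Rintegral do rewrite exprMn.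
  rewrite expectZ; last exact: bmfX.
  have h1 := le_trans (degenerate_ustat_moment2 hX he hXe bsb sb1 sb2 n)
    (ler_wpM2l (sqr_ge0 n%:R) sb_moment2).
  apply: le_trans (ler_wpM2l (sqr_ge0 _) h1) _.
  rewrite exprMn sqr_sqrtr// le_eqVlt; apply/orP; left; apply/eqP.
  by field; rewrite nn gt_eqF// exprn_gt0.
- rewrite /t2 mean_moment2//.
  apply: (variance_le (k := fun x => q x - c * u1 x)) => //.
  by apply: bmfB => //; apply: bmfM => //; exact: bmf_cst.
- rewrite /t3 mean_moment2//.
  apply: (variance_le (k := fun x => q x - c * u2 x)) => //.
  by apply: bmfB => //; apply: bmfM => //; exact: bmf_cst.
- by rewrite /t4 exprMn sqr_sqrtr.
Qed.

End linear_part.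

Section null_sequences.
Context {R : realType}.

Lemma cvg_eq_seq (u v : nat -> R) (l : R) : u @ \oo --> l ->
  (forall n, u n = v n) -> v @ \oo --> l.
Proof. by move=> + uv; rewrite (_ : v = u)//; apply/funext => n; rewrite uv. Qed.

Lemma cvg0Z (c : R) (u : nat -> R) : u @ \oo --> (0 : R) ->
  (fun n => c * u n) @ \oo --> (0 : R).
Proof. by move=> u0; rewrite -[X in _ --> X](mulr0 c); apply: cvgMr. Qed.

Lemma cvg0D (u v : nat -> R) : u @ \oo --> (0 : R) -> v @ \oo --> (0 : R) ->
  (fun n => u n + v n) @ \oo --> (0 : R).
Proof. by move=> u0 v0; rewrite -[X in _ --> X](addr0 0); apply: cvgD. Qed.

Lemma cvg0M (u v : nat -> R) : u @ \oo --> (0 : R) -> v @ \oo --> (0 : R) ->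
  (fun n => u n * v n) @ \oo --> (0 : R).
Proof. by move=> u0 v0; rewrite -[X in _ --> X](mulr0 0); apply: cvgM. Qed.

End null_sequences.

(** * Rates attached to the bandwidth *)

Section bandwidth.
Context {R : realType}.
Variables (d r : nat) (h : nat -> R).
Hypotheses (r0 : (0 < r)%N) (h0 : forall n, (0 < n)%N -> 0 < h n)
  (hr0 : (fun n => Num.sqrt n%:R * h n ^+ r) @ \oo --> (0 : R))
  (hdoo : (fun n => Num.sqrt n%:R * h n ^+ d) @ \oo --> +oo).

Definition inv_effective_size (n : nat) : R := (n%:R * h n ^+ d)^-1.
Let tau := inv_effective_size.

(** The first term is the bias of the kernel; the second is the cost of dividing [n - 1] terms by
    [n]. *)
Definition rate (C B : R) (n : nat) : R := C * h n ^+ r + B / n%:R.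

Let n_gt0 : \forall n \near \oo, (0 < n)%N.
Proof. by exists 1%N. Qed.

Let sqrt_ge1 n : (0 < n)%N -> 1 <= Num.sqrt n%:R :> R.
Proof. by move=> n0; rewrite -[leLHS]sqrtr1 ler_wsqrtr// ler1n. Qed.

Let cvg0_le (u v : nat -> R) : u @ \oo --> (0 : R) ->
  (\forall n \near \oo, 0 <= v n <= u n) -> v @ \oo --> (0 : R).
Proof. by move=> u0 vu; apply: squeeze_cvgr (cvg_cst 0) u0. Qed.

Let tau_ge0 : \forall n \near \oo, 0 <= tau n.
Proof.
apply: filterS n_gt0 => n n0.
by rewrite invr_ge0 mulr_ge0// exprn_ge0// ltW// h0.
Qed.

Lemma bandwidth_pow : (fun n => h n ^+ r) @ \oo --> (0 : R).
Proof.
apply: cvg0_le hr0 _; apply: filterS n_gt0 => n n0.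
have hn : 0 <= h n ^+ r by rewrite exprn_ge0// ltW// h0.
by rewrite hn ler_peMl// sqrt_ge1.
Qed.

Lemma bandwidth_cvg0 : h @ \oo --> (0 : R).
Proof.
apply/cvgrPdist_le => e e0; have er : 0 < e ^+ r by rewrite exprn_gt0.
move/cvgrPdist_le : bandwidth_pow => /(_ _ er).
apply: filterS2 n_gt0 => n n0; rewrite !sub0r !normrN normrX.
by rewrite ler_pXn2r ?nnegrE// ltW.
Qed.

(** The product is the inverse of [n^(1/2) h^d]; its square, [n tau^2], is what a union over the
    sample points requires. *)
Lemma sqrt_inv_effective_size :
  (fun n => Num.sqrt n%:R * tau n) @ \oo --> (0 : R).
Proof.
have pos : \forall n \near \oo, 0 < Num.sqrt n%:R * h n ^+ d :> R.
  by apply: filterS n_gt0 => n n0; rewrite mulr_gt0 ?sqrtr_gt0 ?ltr0n ?exprn_gt0 ?h0.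
apply: (cvg_eq_seq (proj2 (gtr0_cvgV0 pos) hdoo)) => n; rewrite /tau /inv_effective_size.
have [->|n0] := posnP n; first by rewrite sqrtr0 !mul0r /= sqrtr0 mul0r invr0.
rewrite -[X in _ = _ / (X * _)](@sqr_sqrtr R n%:R)// expr2 -mulrA [in RHS]invfM.
rewrite [RHS]mulrA divff ?mul1r//.
by rewrite gt_eqF// sqrtr_gt0 ltr0n.
Qed.

Lemma inv_effective_size_cvg0 : tau @ \oo --> (0 : R).
Proof.
apply: cvg0_le sqrt_inv_effective_size _; apply: filterS2 n_gt0 tau_ge0 => n n0 t0.
by rewrite t0 ler_peMl// sqrt_ge1.
Qed.

Lemma inv_effective_size_sqr : (fun n => n%:R * tau n ^+ 2) @ \oo --> (0 : R).
Proof.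
apply: (cvg_eq_seq (cvg0M sqrt_inv_effective_size sqrt_inv_effective_size)) => n.
by rewrite mulrACA -expr2 sqr_sqrtr.
Qed.

Lemma inv_effective_size_cube : (fun n => n%:R * tau n ^+ 3) @ \oo --> (0 : R).
Proof.
apply: (cvg_eq_seq (cvg0M inv_effective_size_sqr inv_effective_size_cvg0)) => n.
by rewrite -mulrA -exprSr.
Qed.

Let inv_sqrt_cvg0 : (fun n : nat => (Num.sqrt n%:R)^-1) @ \oo --> (0 : R).
Proof.
rewrite -cvg_shiftS.
have h1 : (fun n => Num.sqrt (@harmonic R n)) @ \oo --> (0 : R).
  rewrite -[X in _ --> X]sqrtr0.
  exact: (cvg_comp _ _ (@cvg_harmonic R) (@sqrt_continuous R 0)).
by apply: (cvg_eq_seq h1) => n; rewrite /= sqrtrV.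
Qed.

Lemma sqrt_rate C B : (fun n => Num.sqrt n%:R * rate C B n) @ \oo --> (0 : R).
Proof.
apply: (cvg_eq_seq (cvg0D (cvg0Z C hr0) (cvg0Z B inv_sqrt_cvg0))) => n.
rewrite /rate mulrDr; congr (_ + _); first by ring.
have [->|n0] := posnP n; first by rewrite sqrtr0 invr0 mulr0 mul0r.
rewrite -[X in _ = _ * (_ / X)](@sqr_sqrtr R n%:R)//.
have s0 : Num.sqrt n%:R != 0 :> R by rewrite gt_eqF// sqrtr_gt0 ltr0n.
by field.
Qed.

Lemma rate_cvg0 C B : rate C B @ \oo --> (0 : R).
Proof.
have h2 : (fun n : nat => (n%:R)^-1) @ \oo --> (0 : R).
  by rewrite -cvg_shiftS; exact: cvg_harmonic.
exact: (cvg_eq_seq (cvg0D (cvg0Z C bandwidth_pow) (cvg0Z B h2))).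
Qed.

End bandwidth.

(** * Asymptotics of averages weighted by the inverse density estimate *)

Section kernel_asymptotics.
Context {R : realType} dO (O : measurableType dO) (P : probability O R).
Context (d : nat) d2 (T2 : measurableType d2).
Notation rV := ('rV[R]_d).
Notation leb := (lebesgue_row d).
Variables (X : nat -> {RV P >-> rV}) (e : nat -> {RV P >-> T2}).
Hypotheses (hX : iid X) (he : iid e) (hXe : independent_seqs X e).
Variables (r : nat) (f K : rV -> R) (Bf KM C : R) (h : nat -> R).
Hypotheses (hf : has_density (X 0%N) f) (fB : forall x, f x <= Bf)
  (mK : measurable_fun setT K) (iK : leb.-integrable setT (EFin \o K))
  (KB : forall x, `|K x| <= KM) (Ks : forall x, K (- x) = K x)
  (K1 : \int[leb]_u K u = 1).
Hypotheses (r0 : (0 < r)%N) (h0 : forall n, (0 < n)%N -> 0 < h n)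
  (hr0 : (fun n => Num.sqrt n%:R * h n ^+ r) @ \oo --> (0 : R))
  (hdoo : (fun n => Num.sqrt n%:R * h n ^+ d) @ \oo --> +oo).
Hypotheses (C0 : 0 <= C)
  (bias : forall x t, 0 < t -> `|smoothed f K t x - f x| <= C * t ^+ r).

Let mf : measurable_fun setT f. Proof. by case: hf. Qed.
Let f0 x : 0 <= f x. Proof. by case: hf. Qed.
Let bf : bmf f. Proof. by split => //; exists Bf => x; rewrite ger0_norm. Qed.
Let bK : bmf K. Proof. by split => //; exists KM. Qed.

Let B := Bf * \int[leb]_u `|K u|.
Let A := KM * B.
Let tau := inv_effective_size d h.
Let rt := rate r h C B.

Let n_gt0 : \forall n \near \oo, (0 < n)%N.
Proof. by exists 1%N. Qed.

Let B0 : 0 <= B.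
Proof. by rewrite mulr_ge0//; [exact: le_trans (fB 0)|apply: Rintegral_ge0]. Qed.

Let A0 : 0 <= A. Proof. by rewrite mulr_ge0//; exact: le_trans (KB 0). Qed.

Let c n : R := n.-1%:R / n%:R.

Let bias_le n x : (0 < n)%N -> `|f x - c n * smoothed f K (h n) x| <= rt n.
Proof.
move=> n0; have nn : n%:R != 0 :> R by rewrite pnatr_eq0 -lt0n.
have cE : c n = 1 - n%:R^-1.
  by rewrite /c -subn1 natrB// mulrBl divff// mul1r.
have -> : f x - c n * smoothed f K (h n) x =
    n%:R^-1 * smoothed f K (h n) x - (smoothed f K (h n) x - f x).
  by rewrite cE; ring.
apply: le_trans (ler_normB _ _) _; rewrite addrC; apply: lerD; first exact: bias (h0 n0).
rewrite normrM ger0_norm ?invr_ge0// mulrC ler_wpM2r ?invr_ge0//.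
exact: (smoothed_le hf fB iK).
Qed.

Let rt_ge0 n : (0 < n)%N -> 0 <= rt n.
Proof. by move=> n0; exact: le_trans (bias_le 0 n0). Qed.

Section linear.
Variables (a : rV -> R) (aM : R).
Hypotheses (ma : measurable_fun setT a) (aB : forall x, `|a x| <= aM)
  (cq : continuous (ratio f a)).

Let ba : bmf a. Proof. by split => //; exists aM. Qed.
Let aM0 : 0 <= aM. Proof. exact: le_trans (aB 0). Qed.
Let q := ratio f a.
Let bq : bmf q. Proof. exact: bmfM. Qed.
Let qM x : `|q x| <= aM * Bf.
Proof. by rewrite normrM ler_pM// ger0_norm. Qed.

Let bX (k : rV -> R) i : bmf k -> bmf (fun w => k (X i w)).
Proof. by move=> bk; exact: bmf_precomp bk (measurable_funPT (X i)). Qed.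

Let bsm n : (0 < n)%N -> bmf (smoothed f K (h n)).
Proof. by move=> n0; exact: (bmf_smoothed hf fB mK iK KB (h0 n0)). Qed.

Let u2 n := smoothed_ratio f K (h n) a.

Let bqs n (y : rV) : bmf (fun v : rV => q (y + h n *: v)).
Proof. exact: bmf_precomp bq (measurable_row_lin y (h n)). Qed.

Let bu2 n : (0 < n)%N -> bmf (u2 n).
Proof. by move=> n0; exact: (bmf_smoothed_ratio hf fB mK iK KB Ks (h0 n0) ma aB). Qed.

Let u2_le n y : `|u2 n y| <= aM * B.
Proof. exact: (smoothed_ratio_le hf fB iK (h n) ma aB). Qed.

(** As [q] is merely continuous, smoothing it converges without a rate. This is enough, since [u2]
    enters only through the variance of a centered average. *)
Let u2_cvg y : (fun n => u2 n y) @ \oo --> q y.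
Proof.
have [|||||_] := @Rdominated_cvg _ _ _ leb (fun n v => K v * q (y + h n *: v))
   (fun v => K v * q y) (fun v => aM * Bf * `|K v|).
- by move=> n; apply: measurable_funM => //; case: (bqs n y).
- exact: measurable_funM.
- exact: (integrableZl measurableT _ (integrable_norm iK)).
- by move=> n v; rewrite normrM mulrC ler_wpM2r.
- move=> v; apply: cvgMr.
  have hv : (fun n => y + h n *: v) @ \oo --> y.
    apply: row_norm_cvg => i; under eq_fun do rewrite !mxE.
    have hi : (fun n => y 0 i + h n * v 0 i) @ \oo --> y 0 i + 0 * v 0 i.
      apply: cvgD; first exact: cvg_cst.
      by apply: cvgMl; exact: bandwidth_cvg0 r0 h0 hr0.
    by move: hi; rewrite mul0r addr0.
  exact: (continuous_cvg _ (@cq y) hv).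
by rewrite RintegralZr// K1 mul1r.
Qed.

Let u2_moment2 : (fun n => \int[P]_w ((q (X 0%N w) - c n * u2 n (X 0%N w)) ^+ 2))
  @ \oo --> (0 : R).
Proof.
have cc : c @ \oo --> (1 : R).
  rewrite -cvg_shiftS.
  have h1 : (fun n => 1 - @harmonic R n) @ \oo --> (1 - 0 : R).
    by apply: cvgB; [exact: cvg_cst|exact: cvg_harmonic].
  rewrite subr0 in h1; apply: (cvg_eq_seq h1) => n; rewrite /c /= -[X in X - _](@divff _ n.+1%:R)//.
  by rewrite -[X in _ - X]mul1r -mulrBl -natr1 addrK.
have c01 n : 0 <= c n <= 1.
  rewrite /c; case: n => [|n]; first by rewrite invr0 mulr0 lexx ler01.
  by rewrite divr_ge0//= ler_pdivrMr ?ltr0n// mul1r ler_nat.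
pose F n w := (q (X 0%N w) - c n * u2 n (X 0%N w)) ^+ 2.
have bF n : bmf (F n).
  apply: bmfX; apply: bmfB; first exact: bX.
  have [->|n0] := posnP n.
    by rewrite /c mul0r; under eq_fun do rewrite mul0r; exact: bmf_cst.
  by apply: bmfM; [exact: bmf_cst|apply: bX; exact: bu2].
have [|||||_] := @Rdominated_cvg _ _ _ P F (fun=> 0) (fun=> (aM * Bf + aM * B) ^+ 2).
- by move=> n; case: (bF n).
- by [].
- exact: (bmf_integrable P (bmf_cst _ _)).
- move=> n w; have Bf0 : 0 <= Bf := le_trans (f0 0) (fB 0).
  have S0 : 0 <= aM * Bf + aM * B by apply: addr_ge0; apply: mulr_ge0.
  rewrite normrX lerXn2r ?nnegrE//.
  apply: le_trans (ler_normB _ _) _; apply: lerD => //; rewrite normrM.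
  have /andP[c0 c1] := c01 n; rewrite (ger0_norm c0).
  by apply: le_trans (u2_le n (X 0%N w)); rewrite ler_piMl.
- move=> w; have h1 : (fun n => q (X 0%N w) - c n * u2 n (X 0%N w)) @ \oo --> (0 : R).
    rewrite -[X in _ --> X](subrr (q (X 0%N w))) -[X in _ - X](mul1r (q (X 0%N w))).
    by apply: cvgB; [exact: cvg_cst|apply: cvgM => //; exact: u2_cvg].
  by apply: (cvg_eq_seq (cvg0M h1 h1)) => n; rewrite /F expr2.
by rewrite expect_cst.
Qed.

Let Iq := \int[P]_w q (X 0%N w).
Let th n := \int[P]_w (a (X 0%N w) * smoothed f K (h n) (X 0%N w)).

(** The deterministic remainder is multiplied by [n^(1/2)] and does need a rate: in this form the
    smoothing acts on [f], for which the bias of order [r] is available. *)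
Let mean_le n : (0 < n)%N -> `|Iq - c n * th n| <= aM * rt n.
Proof.
move=> n0; have b1 : bmf (fun w => a (X 0%N w) * smoothed f K (h n) (X 0%N w)).
  by apply: bmfM; apply: bX => //; exact: bsm.
rewrite /th -expectZ// /Iq -expectB; last 2 first.
- exact: bX.
- by apply: bmfM => //; exact: bmf_cst.
apply: expect_normE => [|w].
  by case: (bmfB (bX 0 bq) (bmfM (bmf_cst _ (c n)) b1)).
rewrite /q /ratio mulrCA -mulrBr normrM ler_pM//.
exact: bias_le.
Qed.

Lemma linear_part_vanishes : vanishes_in_prob P (fun n => linear_part X f K (h n) a n).
Proof.
pose U := aM * B.
pose u n := 4 * (8 * aM ^+ 2 * A * tau n + 72 * U ^+ 2 * n%:R^-1 + (aM * rt n) ^+ 2 +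
  \int[P]_w ((q (X 0%N w) - c n * u2 n (X 0%N w)) ^+ 2) +
  (aM * (Num.sqrt n%:R * rt n)) ^+ 2).
have n1 : (fun n : nat => (n%:R)^-1) @ \oo --> (0 : R).
  by rewrite -cvg_shiftS; exact: cvg_harmonic.
have tau0 := inv_effective_size_cvg0 h0 hdoo.
have sq0 (v : nat -> R) : v @ \oo --> (0 : R) -> (fun n => v n ^+ 2) @ \oo --> (0 : R).
  by move=> v0; apply: (cvg_eq_seq (cvg0M v0 v0)) => n; rewrite expr2.
apply: (vanishes_in_prob_moment2 (u := u)).
  apply: cvg0Z; apply: cvg0D; last first.
    by apply: sq0; apply: cvg0Z; exact: sqrt_rate.
  apply: cvg0D u2_moment2; apply: cvg0D; last first.
    by apply: sq0; apply: cvg0Z; exact: rate_cvg0 h0 hr0 C B.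
  by apply: cvg0D; exact: cvg0Z.
apply: filterS n_gt0 => n n0; split.
  exact: (bmf_linear_part hf fB mK iK KB Ks (h0 n0) ma aB n0).
apply: le_trans (linear_part_moment2 hX he hXe hf fB mK iK KB Ks (h0 n0) ma aB n0) _.
have nn : n%:R != 0 :> R by rewrite pnatr_eq0 -lt0n.
rewrite ler_wpM2l//; apply: lerD; [apply: lerD => //; apply: lerD|].
- rewrite mulrDl lerD2r /tau /inv_effective_size invfM -/B -/A.
  by rewrite -!mulrA [_^-1 / _]mulrC.
- rewrite -[leRHS](expect_cst P); apply: expect_le; [|exact: bmf_cst|move=> w].
    apply: bmfX; apply: bmfB; first exact: bX.
    by apply: bmfM; [exact: bmf_cst|apply: bmfM; apply: bX => //; exact: bsm].
  rewrite /ratio mulrCA -mulrBr -[leLHS]real_normK ?num_real//.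
  rewrite lerXn2r ?nnegrE ?mulr_ge0 ?rt_ge0// normrM ler_pM//.
  exact: bias_le.
- rewrite [aM * _]mulrCA exprMn sqr_sqrtr// ler_wpM2l//.
  rewrite -[leLHS]real_normK ?num_real// lerXn2r ?nnegrE ?mulr_ge0 ?rt_ge0//.
  exact: mean_le.
Qed.

End linear.

Let m n (i : 'I_n) (w : O) : R := loo_kde X K h i (X i w) w.
Let dev n (i : 'I_n) (w : O) : R := m i w - f (X i w).

Let devE n (i : 'I_n) w : (0 < n)%N -> dev i w =
  loo_error X f K (h n) i w - (f (X i w) - c n * smoothed f K (h n) (X i w)).
Proof. by move=> n0; rewrite /dev /m (loo_kde_error X f K (h := h n))//; rewrite /c; ring. Qed.

Lemma bmf_loo_deviation n (i : 'I_n) : (0 < n)%N -> bmf (dev i).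
Proof.
move=> n0; rewrite (_ : dev i = fun w => loo_error X f K (h n) i w -
    (f (X i w) - c n * smoothed f K (h n) (X i w))); last first.
  by apply/funext => w; exact: devE.
have hn := h0 n0.
apply: bmfB; first exact: (bmf_loo_error hf fB mK iK KB hn).
apply: (bmf_precomp (f := fun x => f x - c n * smoothed f K (h n) x)) => //.
apply: bmfB => //; apply: bmfM; first exact: bmf_cst.
exact: (bmf_smoothed hf fB mK iK KB hn).
Qed.

Lemma loo_deviation_moment2 n (i : 'I_n) : (0 < n)%N ->
  \int[P]_w (dev i w ^+ 2) <= 2 * (A * tau n) + 2 * rt n ^+ 2.
Proof.
move=> n0; have hn := h0 n0.
have bl := bmf_loo_error hf fB mK iK KB hn i.
apply: (@le_trans _ _ (\int[P]_w (2 * loo_error X f K (h n) i w ^+ 2 + 2 * rt n ^+ 2))).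
  apply: expect_le.
  - by apply: bmfX; exact: bmf_loo_deviation.
  - by apply: bmfD; [apply: bmfM; [exact: bmf_cst|exact: bmfX]|exact: bmf_cst].
  - move=> w; rewrite devE//; move: (loo_error _ _ _ _ _ _) => x.
    have : (f (X i w) - c n * smoothed f K (h n) (X i w)) ^+ 2 <= rt n ^+ 2.
      by rewrite -[leLHS]real_normK ?num_real// lerXn2r ?nnegrE ?rt_ge0// bias_le.
    move: (_ - _ * _) => y; have := sqr_ge0 (x + y); rewrite !expr2; lra.
rewrite expectD; last 2 first.
- by apply: bmfM; [exact: bmf_cst|exact: bmfX].
- exact: bmf_cst.
rewrite expect_cst expectZ; last exact: bmfX.
rewrite lerD2r ler_wpM2l//.
exact: (loo_error_moment2 hX he hXe hf fB mK iK KB hn).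
Qed.

(** One large deviation forces the sum of all fourth powers to be large; the mean of that sum is of
    order [n tau^2 + n tau^3]. The bias is below [b / 2] for large [n]. *)
Lemma loo_uniform b : 0 < b -> asymptotically_null P
  (fun n => [set w | exists i : 'I_n, b < `|dev i w|]).
Proof.
move=> b0; have b2 : 0 < b / 2 by rewrite divr_gt0.
pose u n := 4 * KM ^+ 2 * A * (n%:R * tau n ^+ 3) + 3 * A ^+ 2 * (n%:R * tau n ^+ 2).
have u0 : u @ \oo --> (0 : R).
  by apply: cvg0D; apply: cvg0Z; [exact: inv_effective_size_cube|exact: inv_effective_size_sqr].
have van : vanishes_in_prob P (fun n w => \sum_(i < n) loo_error X f K (h n) i w ^+ 4).
  apply: (vanishes_in_prob_markov u0); apply: filterS n_gt0 => n n0.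
  have hn := h0 n0.
  have bl (i : 'I_n) : bmf (fun w => loo_error X f K (h n) i w ^+ 4).
    by apply: bmfX; exact: (bmf_loo_error hf fB mK iK KB hn).
  have bS := bmf_sum (index_enum 'I_n) xpredT bl.
  split; [by case: bS|by move=> w; apply: sumr_ge0 => i _; rewrite exprn_even_ge0|].
  have : \int[P]_w (\sum_(i < n) loo_error X f K (h n) i w ^+ 4) <= u n.
    rewrite expect_sum//; apply: (@le_trans _ _ (\sum_(i < n)
      (4 * KM ^+ 2 * A * tau n ^+ 3 + 3 * A ^+ 2 * tau n ^+ 2))).
      by apply: ler_sum => i _; exact: (loo_error_moment4 hX he hXe hf fB mK iK KB hn).
    by rewrite sumr_const card_ord -mulr_natl /u le_eqVlt; apply/orP; left; apply/eqP; ring.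
  rewrite -lee_fin; apply: le_trans; rewrite /Rintegral fineK//.
  by apply: integrable_fin_num => //; exact: bmf_integrable.
(* Half of the threshold, because vanishing in probability is stated with a strict inequality. *)
have b4 : 0 < (b / 2) ^+ 4 / 2 by rewrite divr_gt0// exprn_gt0.
apply: asymptotically_null_le (van _ b4).
have /cvgrPdist_le/(_ _ b2) := rate_cvg0 h0 hr0 C B.
apply: filterS2 n_gt0 => n n0; rewrite sub0r normrN => /(le_trans (ler_norm _)) rb.
move=> w [i /= bi]; rewrite ger0_norm; last first.
  by apply: sumr_ge0 => j _; rewrite exprn_even_ge0.
have h1 : b / 2 <= `|loo_error X f K (h n) i w|.
  move: bi; rewrite devE// => bi; have := ler_normB (loo_error X f K (h n) i w)
    (f (X i w) - c n * smoothed f K (h n) (X i w)).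
  have := bias_le (X i w) n0; rewrite -/rt in rb; lra.
have h2 : (b / 2) ^+ 4 <= loo_error X f K (h n) i w ^+ 4.
  rewrite -[leRHS](@ger0_norm _ (_ ^+ 4)) ?exprn_even_ge0// normrX.
  by rewrite lerXn2r ?nnegrE ?(ltW b2).
apply: (@lt_le_trans _ _ ((b / 2) ^+ 4)).
  by rewrite ltr_pdivrMr// mulr2n mulrDr mulr1 ltrDl exprn_gt0.
by rewrite (bigD1 i)//= -[leLHS]addr0 lerD// sumr_ge0// => j _; rewrite exprn_even_ge0.
Qed.

(** The mean is of order [n^(1/2) (tau + rt^2)], variance plus squared bias; the bandwidth
    conditions make both terms negligible. *)
Lemma loo_quadratic : vanishes_in_prob P
  (fun n w => (Num.sqrt n%:R)^-1 * \sum_(i < n) dev i w ^+ 2).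
Proof.
pose u n := 2 * A * (Num.sqrt n%:R * tau n) + 2 * (Num.sqrt n%:R * rt n * rt n).
have u0 : u @ \oo --> (0 : R).
  apply: cvg0D; apply: cvg0Z; first exact: sqrt_inv_effective_size.
  by apply: cvg0M; [exact: sqrt_rate|exact: rate_cvg0 h0 hr0 C B].
apply: (vanishes_in_prob_markov u0); apply: filterS n_gt0 => n n0.
have s0 : 0 < Num.sqrt n%:R :> R by rewrite sqrtr_gt0 ltr0n.
have bd (i : 'I_n) : bmf (fun w => dev i w ^+ 2) by apply: bmfX; exact: bmf_loo_deviation.
have bS := bmf_sum (index_enum 'I_n) xpredT bd.
have bT : bmf (fun w => (Num.sqrt n%:R)^-1 * \sum_(i < n) dev i w ^+ 2).
  by apply: bmfM => //; exact: bmf_cst.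
split; [by case: bT|by move=> w; rewrite mulr_ge0 ?invr_ge0 ?sumr_ge0// => i _; exact: sqr_ge0|].
have : \int[P]_w ((Num.sqrt n%:R)^-1 * \sum_(i < n) dev i w ^+ 2) <= u n.
  rewrite expectZ// expect_sum//.
  apply: (@le_trans _ _ ((Num.sqrt n%:R)^-1 * \sum_(i < n)
      (2 * (A * tau n) + 2 * rt n ^+ 2))).
    rewrite ler_wpM2l ?invr_ge0 ?(ltW s0)//; apply: ler_sum => i _.
    exact: loo_deviation_moment2.
  rewrite sumr_const card_ord -[(_ + _) *+ n]mulr_natl [leLHS]mulrA.
  have -> : (Num.sqrt n%:R)^-1 * n%:R = Num.sqrt n%:R :> R.
    by rewrite -[X in _ * X](@sqr_sqrtr R n%:R)// expr2 mulrA mulVf ?mul1r// gt_eqF.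
  by rewrite /u le_eqVlt; apply/orP; left; apply/eqP; ring.
rewrite -lee_fin; apply: le_trans; rewrite /Rintegral fineK//.
by apply: integrable_fin_num => //; exact: bmf_integrable.
Qed.

(* For m near f, 1 / m = 2 / f - m / f ^ 2 + (m - f) ^ 2 / (f ^ 2 m); the first
   two terms make up linear_part. *)
Lemma ratio_estimator_vanishes (a : rV -> R) aM b : measurable_fun setT a ->
  (forall x, `|a x| <= aM) -> continuous (ratio f a) ->
  0 < b -> (forall x, a x != 0 -> b <= f x) ->
  vanishes_in_prob P (fun n w => Num.sqrt n%:R *
    (n%:R^-1 * \sum_(i < n) (a (X i w) * f (X i w) ^+ 2 / m i w) -
     \int[P]_w ratio f a (X 0%N w))).
Proof.
move=> ma aB cq b0 ab; have b2 : 0 < b / 2 by rewrite divr_gt0.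
have aM0 : 0 <= aM := le_trans (normr_ge0 _) (aB 0).
have V1 : vanishes_in_prob P (fun n w => `|linear_part X f K (h n) a n w|).
  apply: vanishes_in_prob_le (linear_part_vanishes ma aB cq).
  by apply: nearW => n w; rewrite normr_id.
have V := vanishes_in_probD V1
  (vanishes_in_probZ (aM * (2 / b)) loo_quadratic).
apply: vanishes_in_probW V.
apply: asymptotically_null_le (loo_uniform b2).
apply: filterS n_gt0 => n n0 w /= nle; apply: contrapT => nex; apply: nle.
have {nex}near_f (i : 'I_n) : `|dev i w| <= b / 2.
  by rewrite leNgt; apply/negP => hi; apply: nex; exists i.
have s0 : 0 < Num.sqrt n%:R :> R by rewrite sqrtr_gt0 ltr0n.
set Iq := \int[P]_w _.
pose rho (i : 'I_n) := a (X i w) * dev i w ^+ 2 / m i w.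
have rhoE (i : 'I_n) : a (X i w) * f (X i w) ^+ 2 / m i w =
    (2 * ratio f a (X i w) - a (X i w) * m i w) + rho i.
  (* Where the weight vanishes both sides are 0, whatever the inverse of [m] is; elsewhere [f >= b]
     and hence [m >= b / 2]. *)
  rewrite /rho /ratio /dev; have [->|ai] := eqVneq (a (X i w)) 0.
    by rewrite !(mul0r, mulr0) subr0 addr0.
  have fb := ab _ ai; have := near_f i; rewrite /dev ler_norml => /andP[h1 _].
  have m0 : m i w != 0 by rewrite gt_eqF//; lra.
  by field.
have rho_le (i : 'I_n) : `|rho i| <= aM * (2 / b) * dev i w ^+ 2.
  rewrite /rho; have [->|ai] := eqVneq (a (X i w)) 0.
    by rewrite !mul0r normr0 mulr_ge0 ?sqr_ge0// mulr_ge0// divr_ge0// ltW.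
  have fb := ab _ ai; have := near_f i; rewrite {1}/dev ler_norml => /andP[h1 _].
  have m0 : b / 2 <= m i w by lra.
  have mp : 0 < m i w by lra.
  rewrite 2!normrM normrX real_normK ?num_real// normfV (gtr0_norm mp) mulrAC.
  rewrite ler_wpM2r ?sqr_ge0// ler_pM ?invr_ge0 ?(ltW mp)//.
  by rewrite -[2 / b]invf_div lef_pV2 ?posrE// divr_gt0.
have -> : Num.sqrt n%:R * (n%:R^-1 * \sum_(i < n) (a (X i w) * f (X i w) ^+ 2 / m i w) - Iq) =
    linear_part X f K (h n) a n w + (Num.sqrt n%:R)^-1 * \sum_(i < n) rho i.
  have -> : linear_part X f K (h n) a n w = Num.sqrt n%:R * (n%:R^-1 * \sum_(i < n)
      (2 * ratio f a (X i w) - a (X i w) * m i w) - Iq).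
    rewrite /linear_part; congr (_ * (_ * _ - _)); apply: eq_bigr => i _.
    congr (_ - _ * _); rewrite /m /loo_kde invfM -mulrA; congr (_ * _).
    by rewrite mulr_sumr.
  under eq_bigr do rewrite rhoE.
  rewrite big_split/=; set S1 := \sum_(i < n) _; set S2 := \sum_(i < n) _.
  rewrite -{2 4}(@sqr_sqrtr R n%:R)//; move: (Num.sqrt _) s0 => s s0.
  by field; rewrite gt_eqF.
apply: le_trans (ler_normD _ _) _.
have S0 : 0 <= aM * (2 / b) * ((Num.sqrt n%:R)^-1 * \sum_(i < n) dev i w ^+ 2).
  by rewrite !mulr_ge0 ?invr_ge0 ?(ltW b0)// sumr_ge0// => i _; exact: sqr_ge0.
have : `|(Num.sqrt n%:R)^-1 * \sum_(i < n) rho i| <=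
    aM * (2 / b) * ((Num.sqrt n%:R)^-1 * \sum_(i < n) dev i w ^+ 2).
  rewrite normrM ger0_norm ?invr_ge0 ?(ltW s0)// mulrCA ler_wpM2l ?invr_ge0 ?(ltW s0)//.
  apply: le_trans (ler_norm_sum _ _ _) _; rewrite mulr_sumr.
  by apply: ler_sum => i _.
move=> h1; rewrite [leRHS]ger0_norm; last by rewrite addr_ge0.
by rewrite lerD2l.
Qed.

End kernel_asymptotics.

(** * The noise *)

Lemma measurable_loo_kde {R : realType} (d : nat) dT (T : measurableType dT)
    (X : nat -> T -> 'rV[R]_d) (K : 'rV[R]_d -> R) (h : nat -> R) n (i : 'I_n) :
  measurable_fun setT K -> (forall j : 'I_n, measurable_fun setT (X j)) ->
  measurable_fun setT (fun w => loo_kde X K h i (X i w) w).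
Proof.
move=> mK mX; apply: measurable_funM => //.
under eq_fun do rewrite big_mkcond; apply: measurable_sum => j.
case: (j != i) => //; apply: (measurableT_comp mK).
apply: measurable_row => k; under eq_fun do rewrite !mxE.
apply: measurable_funM => //.
by apply: measurable_funB; exact: (measurableT_comp (measurable_coord k)).
Qed.

Section noise.
Context {R : realType} dO (O : measurableType dO) (P : probability O R).
Context (d1 : measure_display) (T1 : measurableType d1).
Variables (X : nat -> {RV P >-> T1}) (e : nat -> {RV P >-> R}).
Hypotheses (hX : iid X) (he : iid e) (hXe : independent_seqs X e).
Hypotheses (ie2 : P.-integrable setT (EFin \o (fun w => e 0%N w ^+ 2)))
  (e0 : \int[P]_w e 0%N w = 0).

Let v := \int[P]_w (e 0%N w ^+ 2).

Let ie j : P.-integrable setT (EFin \o e j).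
Proof.
have me : measurable_fun setT (e 0%N) by exact: measurable_funPT.
have ie0 := integrable_of_sqr me ie2.
have mn : measurable_fun [set: measurableTypeR R] (fun x : R => `|x|%:E).
  by apply/measurable_EFinP; apply: continuous_measurable_fun; exact: norm_continuous.
apply/integrableP; split; first by apply/measurable_EFinP; exact: measurable_funPT.
have E k : (\int[P]_w `|(e k w)%:E| = \int[distribution P (e k)]_x `|x|%:E)%E.
  by rewrite ge0_integral_distribution.
rewrite (E j) (@eq_measure_integral _ _ _ setT (distribution P (e 0%N))).
  by rewrite -E; case/integrableP : ie0.
by move=> A mA _; exact: (proj2 he).
Qed.

Let Ee j : \int[P]_w e j w = 0.
Proof. by rewrite (expect_X he j (k := id)). Qed.

Variable al : nat -> R.

Let S m w := \sum_(j < m) al j * e j w.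

Let mS m : measurable_fun setT (S m).
Proof. by apply: measurable_sum => j; apply: measurable_funM. Qed.

Let iS m : P.-integrable setT (EFin \o S m).
Proof.
rewrite (_ : _ \o _ = fun w => (\sum_(j < m) (al j * e j w)%R%:E)%E).
  apply: integrable_sum => // j _.
  exact: (integrableZl measurableT (al j) (ie j)).
by apply/funext => w; rewrite sumEFin.
Qed.

Let ES m : \int[P]_w S m w = 0.
Proof.
elim: m => [|m IH].
  by rewrite /S; under eq_Rintegral do rewrite big_ord0; rewrite expect_cst.
have E w : S m.+1 w = S m w + al m * e m w by rewrite /S big_ord_recr.
under eq_Rintegral do rewrite E.
rewrite RintegralD//; last exact: (integrableZl measurableT (al m) (ie m)).
by rewrite IH (RintegralZl (al m) measurableT (ie m)) Ee mulr0 addr0.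
Qed.

Let J1 (m : nat) : set (nat + nat) := [set inr m].
Let J2 (m : nat) : set (nat + nat) := [set z | if z is inr j then (j < m)%N else false].

Let J12 m : J1 m `&` J2 m = set0.
Proof. by rewrite -subset0 => z [/= ->] /=; rewrite ltnn. Qed.

(** Stated with an extended integral, so that the induction hypothesis also gives the integrability
    of the square, which is not known beforehand as [e] is unbounded. *)
Lemma weighted_sum_moment2 m :
  (\int[P]_w (S m w ^+ 2)%:E = ((\sum_(j < m) al j ^+ 2) * v)%:E)%E.
Proof.
elim: m => [|m IH].
  rewrite big_ord0 mul0r; under eq_integral do rewrite /S big_ord0 expr0n.
  by rewrite integral0.
have iS2 : P.-integrable setT (EFin \o (fun w => S m w ^+ 2)).
  apply/integrableP; split; first by apply/measurable_EFinP; exact: measurable_funX.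
  rewrite (eq_integral (fun w => (S m w ^+ 2)%:E)) ?IH ?ltry//.
  by move=> w _ /=; rewrite ger0_norm// sqr_ge0.
pose F (w w' : O) : \bar R := ((al m * e m w + S m w') ^+ 2)%:E.
transitivity (\int[P]_w F w w)%E.
  by apply: eq_integral => w _; rewrite /F /S big_ord_recr/= addrC.
rewrite (subsample_integral_ge0 hX he hXe (J12 m) (F := F)); first last.
- by move=> w w'; rewrite lee_fin sqr_ge0.
- apply/measurable_EFinP; apply: measurable_funX; apply: measurable_funD.
    apply: measurable_funM => //.
    exact: (measurableT_comp (subsample_e (X := X) (e := e) (J := J1 m)
      (i := m) erefl) measurable_fst).
  apply: measurable_sum => j; apply: measurable_funM => //.
  exact: (measurableT_comp (subsample_e (X := X) (e := e) (J := J2 m)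
    (i := j) (ltn_ord j)) measurable_snd).
have inner w : (\int[P]_w' F w w' =
    ((al m * e m w) ^+ 2 + (\sum_(j < m) al j ^+ 2) * v)%:E)%E.
  set c := al m * e m w.
  have i1 : P.-integrable setT (EFin \o (fun w' => 2 * c * S m w')).
    exact: (integrableZl measurableT _ (iS m)).
  have i2 : P.-integrable setT (EFin \o (fun w' => 2 * c * S m w' + S m w' ^+ 2)).
    exact: (integrableD measurableT i1 iS2).
  have i0 := bmf_integrable P (bmf_cst _ (c ^+ 2)).
  have i3 : P.-integrable setT
      (EFin \o (fun w' => c ^+ 2 + (2 * c * S m w' + S m w' ^+ 2))).
    exact: (integrableD measurableT i0 i2).
  transitivity (\int[P]_w' (c ^+ 2 + (2 * c * S m w' + S m w' ^+ 2))%:E)%E.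
    have sq (x y : R) : (x + y) ^+ 2 = x ^+ 2 + (2 * x * y + y ^+ 2) by ring.
    by apply: eq_integral => w' _; congr EFin; exact: sq.
  rewrite EFin_Rintegral// RintegralD// RintegralD// (RintegralZl _ measurableT (iS m)).
  rewrite ES mulr0 add0r.
  by rewrite expect_cst; congr (_ + _)%:E; rewrite /Rintegral IH.
under eq_integral do rewrite inner.
have i1 : P.-integrable setT (EFin \o (fun w => (al m * e m w) ^+ 2)).
  have h1 : P.-integrable setT (EFin \o (fun w => e m w ^+ 2)).
    apply/integrableP; split; first by apply/measurable_EFinP; exact: measurable_funX.
    have E k : (\int[P]_w `|(e k w ^+ 2)%:E| = \int[distribution P (e k)]_x (x ^+ 2)%:E)%E.
      rewrite ge0_integral_distribution//.
      - by apply: eq_integral => w _ /=; rewrite ger0_norm// sqr_ge0.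
      - by apply/measurable_EFinP; exact: exprn_measurable.
      - by move=> x; rewrite lee_fin sqr_ge0.
    rewrite (E m) (@eq_measure_integral _ _ _ setT (distribution P (e 0%N))).
      by rewrite -E; case/integrableP : ie2.
    by move=> A mA _; exact: (proj2 he).
  have := integrableZl measurableT (al m ^+ 2) h1.
  by apply: eq_integrable => // w _ /=; rewrite exprMn.
have i0 := bmf_integrable P (bmf_cst _ ((\sum_(j < m) al j ^+ 2) * v)).
rewrite EFin_Rintegral; last exact: (integrableD measurableT i1 i0).
rewrite RintegralD// expect_cst big_ord_recr/= mulrDl addrC; congr (_ + _)%:E.
rewrite (expect_X he m (k := fun x => (al m * x) ^+ 2)); last first.
  by apply: measurable_funX; exact: measurable_funM.
by under eq_Rintegral do rewrite exprMn; rewrite RintegralZl.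
Qed.

End noise.

Section noise_vanishes.
Context {R : realType} dO (O : measurableType dO) (P : probability O R).
Context (d : nat).
Notation rV := ('rV[R]_d).
Notation leb := (lebesgue_row d).
Variables (X : nat -> {RV P >-> rV}) (e : nat -> {RV P >-> R}).
Hypotheses (hX : iid X) (he : iid e) (hXe : independent_seqs X e).
Variables (r : nat) (f K : rV -> R) (Bf KM C : R) (h : nat -> R).
Hypotheses (hf : has_density (X 0%N) f) (fB : forall x, f x <= Bf)
  (mK : measurable_fun setT K) (iK : leb.-integrable setT (EFin \o K))
  (KB : forall x, `|K x| <= KM).
Hypotheses (h0 : forall n, (0 < n)%N -> 0 < h n)
  (hr0 : (fun n => Num.sqrt n%:R * h n ^+ r) @ \oo --> (0 : R))
  (hdoo : (fun n => Num.sqrt n%:R * h n ^+ d) @ \oo --> +oo).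
Hypotheses
  (bias : forall x t, 0 < t -> `|smoothed f K t x - f x| <= C * t ^+ r).
Hypotheses (ie2 : P.-integrable setT (EFin \o (fun w => e 0%N w ^+ 2)))
  (e0 : \int[P]_w e 0%N w = 0).
Variables (t : rV -> R) (tM b : R).
Hypotheses (mt : measurable_fun setT t) (tB : forall x, `|t x| <= tM)
  (b0 : 0 < b) (tb : forall x, t x != 0 -> b <= f x).

Let mf : measurable_fun setT f. Proof. by case: hf. Qed.
Let v := \int[P]_w (e 0%N w ^+ 2).
Let v0 : 0 <= v. Proof. by apply: Rintegral_ge0 => w _; exact: sqr_ge0. Qed.
Let tM0 : 0 <= tM. Proof. exact: le_trans (tB 0). Qed.
Let b2 : 0 < b / 2. Proof. exact: divr_gt0. Qed.

(* A truncation that only matters off the event where the density estimator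
   is uniformly close to f. *)
Let weight (y m : R) : R := (Num.max (b / 2) m)^-1 - (Num.max b y)^-1.

(** The constant is the product of [1 / (b / 2)] and [1 / b], bounds on the two inverses; truncating
    at [b / 2] only brings [m] closer to a value [y >= b]. *)
Let weight_le y m : b <= y -> `|weight y m| <= 2 / b ^+ 2 * `|m - y|.
Proof.
move=> by_; rewrite /weight (max_r by_); set M := Num.max (b / 2) m.
have M0 : b / 2 <= M by rewrite le_max lexx.
have Mp : 0 < M := lt_le_trans b2 M0.
have yp : 0 < y := lt_le_trans b0 by_.
have -> : M^-1 - y^-1 = (y - M) * (M^-1 * y^-1) by field; rewrite !gt_eqF.
rewrite normrM mulrC; apply: ler_pM => //.
  rewrite ger0_norm; last by rewrite mulr_ge0// invr_ge0 ltW.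
  rewrite (_ : 2 / b ^+ 2 = (b / 2)^-1 * b^-1); last by field; rewrite gt_eqF.
  by apply: ler_pM; rewrite ?invr_ge0 ?(ltW Mp) ?(ltW yp)// lef_pV2.
have h1 := ler_norm (m - y); have h2 := ler_norm (y - m).
rewrite [`|y - m|]distrC in h2.
by rewrite /M; case: (leP (b / 2) m) => hm; rewrite ler_norml; apply/andP; split; lra.
Qed.

Let m n (i : 'I_n) (w : O) : R := loo_kde X K h i (X i w) w.

Let noise (n : nat) w : R := (Num.sqrt n%:R)^-1 *
  \sum_(i < n) e i w * (t (X i w) * ((m i w)^-1 - (f (X i w))^-1)).

(** The weights are extended by 0 to all natural indices, the form in which the weighted noise sum
    takes them. *)
Let coef n (i : nat) (w : O) : R := if insub i is Some j then
  t (X i w) * weight (f (X i w)) (m (j : 'I_n) w) else 0.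

Let coefE n (i : 'I_n) w : coef n i w = t (X i w) * weight (f (X i w)) (m i w).
Proof. by rewrite /coef insubT//= => lt; rewrite (_ : Sub _ _ = i)//; exact: val_inj. Qed.

Let coefEfun n (i : 'I_n) :
  coef n i = fun w => t (X i w) * weight (f (X i w)) (m i w).
Proof. by apply/funext => w; exact: coefE. Qed.

Let truncated n w : R := (Num.sqrt n%:R)^-1 * \sum_(i < n) coef n i w * e i w.

Let J1 : set (nat + nat) := [set z | if z is inl _ then true else false].
Let J2 : set (nat + nat) := [set z | if z is inr _ then true else false].
Let J12 : J1 `&` J2 = set0. Proof. by rewrite -subset0 => -[j|j] [] /=. Qed.

Let mweight dT (T : measurableType dT) (y z : T -> R) : measurable_fun setT y ->
  measurable_fun setT z -> measurable_fun setT (fun w => weight (y w) (z w)).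
Proof.
by move=> my mz; apply: measurable_funB; apply: measurable_funV; exact: measurable_maxr.
Qed.

Let mcoef dT (T : measurableType dT) n (i : 'I_n) (g : nat -> T -> rV) :
  (forall j, measurable_fun setT (g j)) ->
  measurable_fun setT (fun w => t (g i w) * weight (f (g i w)) (loo_kde g K h i (g i w) w)).
Proof.
move=> mg; apply: measurable_funM; first exact: measurableT_comp.
apply: mweight; first exact: measurableT_comp.
exact: measurable_loo_kde.
Qed.

(** With the whole sequence [X] frozen, the weights are constants and the second moment is [v / n]
    times the sum of their squares; averaging over [X] then brings in the mean square deviation of
    the estimator. *)
Let truncated_moment2 n : (0 < n)%N ->
  (\int[P]_w (truncated n w ^+ 2)%:E <= ((tM * (2 / b ^+ 2)) ^+ 2 * v *
    (2 * (KM * (Bf * \int[leb]_u `|K u|) * inv_effective_size d h n) +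
     2 * rate r h C (Bf * \int[leb]_u `|K u|) n ^+ 2))%:E)%E.
Proof.
move=> n0; set q := tM * _; set s := 2 * _ + _.
pose F (w w' : O) : \bar R :=
  (((Num.sqrt n%:R)^-1 * \sum_(i < n) coef n i w * e i w') ^+ 2)%:E.
have mX1 j : measurable_fun setT (X j : subsample X e J1 -> rV) by exact: subsample_X.
have mF : measurable_fun setT (fun z : subsample X e J1 * subsample X e J2 => F z.1 z.2).
  apply/measurable_EFinP; apply: measurable_funX; apply: measurable_funM => //.
  apply: measurable_sum => i; apply: measurable_funM.
    rewrite coefEfun.
    exact: (measurableT_comp (mcoef i mX1) measurable_fst).
  exact: (measurableT_comp (subsample_e (X := X) (e := e) (J := J2) (i := i) erefl)
    measurable_snd).
rewrite (_ : (fun w => _) = fun w => F w w)//.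
rewrite (subsample_integral_ge0 hX he hXe J12 mF); last first.
  by move=> w w'; rewrite lee_fin sqr_ge0.
pose dev (i : 'I_n) w := m i w - f (X i w).
have bd (i : 'I_n) : bmf (dev i).
  exact: (bmf_loo_deviation hf fB mK iK KB h0).
have me i : measurable_fun setT (e i) by exact: measurable_funPT.
have mX i : measurable_fun setT (X i) by exact: measurable_funPT.
have inner w : (\int[P]_w' F w w' =
    (n%:R^-1 * v * (\sum_(i < n) coef n i w ^+ 2))%:E)%E.
  under eq_integral do rewrite /F exprMn EFinM.
  have mS : measurable_fun setT
      (fun w' => ((\sum_(i < n) coef n i w * e i w') ^+ 2)%:E).
    apply/measurable_EFinP; apply: measurable_funX; apply: measurable_sum => i.
    exact: measurable_funM.
  rewrite (ge0_integralZl _ measurableT mS) => [|w' _|]; last 2 first.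
  - by rewrite lee_fin sqr_ge0.
  - by rewrite lee_fin sqr_ge0.
  rewrite (weighted_sum_moment2 hX he hXe ie2 e0 (fun i => coef n i w)) -EFinM.
  by rewrite exprVn sqr_sqrtr// -mulrA [v * _]mulrC.
have q0 : 0 <= q by rewrite mulr_ge0// divr_ge0// sqr_ge0.
have coef_le (i : 'I_n) w : `|coef n i w| <= `|q * dev i w|.
  rewrite coefE; have [->|ti] := eqVneq (t (X i w)) 0; first by rewrite mul0r normr0.
  rewrite normrM [leRHS]normrM (ger0_norm q0) -mulrA.
  by apply: ler_pM => //; apply: weight_le; exact: tb.
have bc (i : 'I_n) : bmf (coef n i).
  apply: (@bmf_le _ _ _ _ (fun w => q * dev i w)) => //.
    by rewrite coefEfun; exact: mcoef.
  by apply: bmfM => //; exact: bmf_cst.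
have bc2 (i : 'I_n) : bmf (fun w => coef n i w ^+ 2) by exact: bmfX.
have bS := bmf_sum (index_enum 'I_n) xpredT bc2.
under eq_integral do rewrite inner.
have bI : bmf (fun w => n%:R^-1 * v * \sum_(i < n) coef n i w ^+ 2).
  by apply: bmfM => //; exact: bmf_cst.
have -> : (\int[P]_w (n%:R^-1 * v * \sum_(i < n) coef n i w ^+ 2)%:E =
    (\int[P]_w (n%:R^-1 * v * \sum_(i < n) coef n i w ^+ 2))%:E)%E.
  by rewrite /Rintegral fineK// integrable_fin_num//; exact: bmf_integrable.
rewrite lee_fin expectZ// expect_sum//.
apply: (@le_trans _ _ (n%:R^-1 * v * \sum_(i < n) (q ^+ 2 * s))).
  rewrite ler_wpM2l ?mulr_ge0 ?invr_ge0//; apply: ler_sum => i _.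
  apply: (@le_trans _ _ (\int[P]_w (q ^+ 2 * dev i w ^+ 2))).
    apply: expect_le => //.
      by apply: bmfM; [exact: bmf_cst|exact: bmfX].
    move=> w; rewrite -exprMn -[leLHS]real_normK ?num_real// -[leRHS]real_normK ?num_real//.
    by rewrite lerXn2r ?nnegrE.
  rewrite expectZ; last exact: bmfX.
  rewrite ler_wpM2l ?sqr_ge0//.
  exact: (loo_deviation_moment2 hX he hXe hf fB mK iK KB h0 bias).
rewrite sumr_const card_ord -[(_ * _) *+ n]mulr_natl.
rewrite le_eqVlt; apply/orP; left; apply/eqP.
by field; rewrite pnatr_eq0 -lt0n.
Qed.

Lemma noise_vanishes : vanishes_in_prob P noise.
Proof.
pose B := Bf * \int[leb]_u `|K u|.
pose tau := inv_effective_size d h.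
pose u n := (tM * (2 / b ^+ 2)) ^+ 2 * v * (2 * (KM * B * tau n) + 2 * rate r h C B n ^+ 2).
have u0 : u @ \oo --> (0 : R).
  apply: cvg0Z; apply: cvg0D; apply: cvg0Z.
    by apply: cvg0Z; exact: inv_effective_size_cvg0.
  have h1 := rate_cvg0 h0 hr0 C B.
  by apply: (cvg_eq_seq (cvg0M h1 h1)) => n; rewrite expr2.
have me i : measurable_fun setT (e i) by exact: measurable_funPT.
have mX i : measurable_fun setT (X i) by exact: measurable_funPT.
have V : vanishes_in_prob P truncated.
  apply: vanishes_in_prob_sqr; apply: (vanishes_in_prob_markov u0).
  exists 1%N => // n /= n0; split; last exact: truncated_moment2.
    apply: measurable_funX; apply: measurable_funM => //; apply: measurable_sum => i.
    apply: measurable_funM => //; rewrite coefEfun.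
    exact: mcoef.
  by move=> w; exact: sqr_ge0.
apply: vanishes_in_probW V.
apply: asymptotically_null_le (loo_uniform hX he hXe hf fB mK iK KB h0 hr0 hdoo bias b2).
apply: nearW => n w /= nle; apply: contrapT => nex; apply: nle.
rewrite /noise /truncated (eq_bigr (fun i : 'I_n => coef n i w * e i w))// => i _.
rewrite coefE mulrC; congr (_ * _).
have [->|ti] := eqVneq (t (X i w)) 0; first by rewrite !mul0r.
have near_f : `|m i w - f (X i w)| <= b / 2.
  by rewrite leNgt; apply/negP => hi; apply: nex; exists i.
have fb := tb ti; rewrite /weight (max_r fb) max_r//.
move: near_f; rewrite ler_norml => /andP[h1 _]; lra.
Qed.

End noise_vanishes.

Section noise_moments.
Context {R : realType} dO (O : measurableType dO) (P : probability O R).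
Context (d1 : measure_display) (T1 : measurableType d1).
Variables (X : nat -> {RV P >-> T1}) (e : nat -> {RV P >-> R}).
Hypotheses (hX : iid X) (he : iid e) (hXe : independent_seqs X e).

Let mX i : measurable_fun setT (X i). Proof. exact: measurable_funPT. Qed.
Let me i : measurable_fun setT (e i). Proof. exact: measurable_funPT. Qed.

Lemma integral_mul_ge0 (k : T1 -> R) (m : R -> R) i :
  measurable_fun setT k -> measurable_fun [set: measurableTypeR R] m ->
  (forall x, 0 <= k x) -> (forall x, 0 <= m x) ->
  (\int[P]_w (k (X i w) * m (e i w))%:E =
   \int[P]_w (k (X i w))%:E * \int[P]_w (m (e i w))%:E)%E.
Proof.
move=> mk mm k0 m0.
have dis : [set (inl i : nat + nat)] `&` [set (inr i : nat + nat)] = set0.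
  by rewrite -subset0 => z [/= ->].
have mkX : measurable_fun setT (fun w => k (X i w)) by exact: measurableT_comp.
have mme : measurable_fun setT (fun w => m (e i w)) by exact: measurableT_comp.
rewrite (subsample_integral_ge0 hX he hXe dis
  (F := fun w w' => (k (X i w) * m (e i w'))%:E)); last 2 first.
- have m1 := subsample_X (X := X) (e := e) (J := [set inl i]) (erefl (inl i)).
  have m2 := subsample_e (X := X) (e := e) (J := [set inr i]) (erefl (inr i)).
  apply/measurable_EFinP; apply: measurable_funM.
    exact: (measurableT_comp mk (measurableT_comp m1 measurable_fst)).
  exact: (measurableT_comp mm (measurableT_comp m2 measurable_snd)).
- by move=> w w'; rewrite lee_fin mulr_ge0.
rewrite -ge0_integralZr//; first last.
- by apply: integral_ge0 => w _; rewrite lee_fin.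
- by move=> w _; rewrite lee_fin.
- exact/measurable_EFinP.
apply: eq_integral => w _; under eq_integral do rewrite EFinM.
rewrite ge0_integralZl ?lee_fin//; first exact/measurable_EFinP.
by move=> w' _; rewrite lee_fin.
Qed.

Hypothesis ie : P.-integrable setT (EFin \o e 0%N).

Lemma integrable_mul (k : T1 -> R) : bmf k ->
  P.-integrable setT (EFin \o (fun w => k (X 0%N w) * e 0%N w)).
Proof.
move=> bk; have := integrableM_bmf ie (bmf_precomp bk (mX 0)).
by apply: eq_integrable => // w _ /=; rewrite mulrC.
Qed.

Let expect_mul_ge0 (k : T1 -> R) : bmf k -> (forall x, 0 <= k x) ->
  \int[P]_w (k (X 0%N w) * e 0%N w) = \int[P]_w k (X 0%N w) * \int[P]_w e 0%N w.
Proof.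
move=> bk k0; have [mk _] := bk.
have bkX := bmf_precomp bk (mX 0).
pose mp (x : R) := Num.max x 0; pose mn (x : R) := Num.max (- x) 0.
have mmp : measurable_fun [set: measurableTypeR R] mp by exact: measurable_maxr.
have mmn : measurable_fun [set: measurableTypeR R] mn.
  by apply: measurable_maxr => //; exact: measurable_oppr.
have mp0 x : 0 <= mp x by rewrite le_max lexx orbT.
have mn0 x : 0 <= mn x by rewrite le_max lexx orbT.
have split x : x = mp x - mn x.
  rewrite /mp /mn; case: (leP x 0) => hx; case: (leP (- x) 0) => hx';
    rewrite ?subr0 ?sub0r ?opprK//; lra.
have mple x : mp x <= `|x| by rewrite ge_max ler_norm normr_ge0.
have mnle x : mn x <= `|x| by rewrite ge_max -normrN ler_norm normr_ge0.
have imp : P.-integrable setT (EFin \o (fun w => mp (e 0%N w))).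
  apply: (le_integrable _ _ _ ie) => //.
    by apply/measurable_EFinP; exact: measurableT_comp.
  by move=> w _; rewrite lee_fin (ger0_norm (mp0 _)).
have imn : P.-integrable setT (EFin \o (fun w => mn (e 0%N w))).
  apply: (le_integrable _ _ _ ie) => //.
    by apply/measurable_EFinP; exact: measurableT_comp.
  by move=> w _; rewrite lee_fin (ger0_norm (mn0 _)).
have prod (m : R -> R) : measurable_fun [set: measurableTypeR R] m -> (forall x, 0 <= m x) ->
    P.-integrable setT (EFin \o (fun w => m (e 0%N w))) ->
    P.-integrable setT (EFin \o (fun w => k (X 0%N w) * m (e 0%N w))) /\
    \int[P]_w (k (X 0%N w) * m (e 0%N w)) =
    \int[P]_w k (X 0%N w) * \int[P]_w m (e 0%N w).
  move=> mm m0 im.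
  have i1 : P.-integrable setT (EFin \o (fun w => k (X 0%N w) * m (e 0%N w))).
    have := integrableM_bmf im bkX.
    by apply: eq_integrable => // w _ /=; rewrite mulrC.
  split => //; have := integral_mul_ge0 0 mk mm k0 m0.
  rewrite (EFin_Rintegral i1) (EFin_Rintegral (bmf_integrable P bkX)).
  by rewrite (EFin_Rintegral im) -EFinM => -[].
have [ip Ep] := prod _ mmp mp0 imp; have [in_ En] := prod _ mmn mn0 imn.
transitivity (\int[P]_w (k (X 0%N w) * mp (e 0%N w) - k (X 0%N w) * mn (e 0%N w))).
  by apply: eq_Rintegral => w _; rewrite -mulrBr -split.
rewrite RintegralB// Ep En -mulrBr -RintegralB//; congr (_ * _).
by apply: eq_Rintegral => w _; rewrite -split.
Qed.

(** As [e] is unbounded, the product formula is first proved for nonnegative functions, then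
    extended by splitting [e] into its positive and negative parts and shifting [k] by a bound. *)
Lemma expect_mul (k : T1 -> R) : bmf k ->
  \int[P]_w (k (X 0%N w) * e 0%N w) = \int[P]_w k (X 0%N w) * \int[P]_w e 0%N w.
Proof.
move=> bk; have [_ [M kM]] := bk.
have bM : bmf (fun=> M : R) := bmf_cst T1 M.
have b1 : bmf (fun x => k x + M) by exact: bmfD.
have k1 x : 0 <= k x + M by have := kM x; rewrite ler_norml => /andP[+ _]; lra.
have M0 : 0 <= M by apply: le_trans (kM point).
have h1 := expect_mul_ge0 b1 k1; have h2 := expect_mul_ge0 bM (fun=> M0).
transitivity (\int[P]_w ((k (X 0%N w) + M) * e 0%N w - M * e 0%N w)).
  by apply: eq_Rintegral => w _; rewrite mulrDl addrK.
rewrite (RintegralB measurableT (integrable_mul b1) (integrableZl measurableT M ie)).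
rewrite h1 h2 -mulrBl expectD ?expect_cst ?addrK//.
  exact: bmf_precomp bk (mX 0).
exact: bmf_cst.
Qed.

End noise_moments.

(** * Vanishing weights or moments of the noise *)

Lemma ae_zero_of_sqr {R : realType} d (T : measurableType d)
    (P : {measure set T -> \bar R}) (k : T -> R) : measurable_fun setT k ->
  (\int[P]_w (k w ^+ 2)%:E = 0)%E -> {ae P, forall w, k w = 0}.
Proof.
move=> mk k0; have mk2 : measurable_fun setT (fun w => (k w ^+ 2)%:E).
  by apply/measurable_EFinP; exact: measurable_funX.
have : (\int[P]_w `|(k w ^+ 2)%:E| = 0)%E.
  rewrite -[RHS]k0; apply: eq_integral => w _ /=.
  by rewrite ger0_norm// sqr_ge0.
move/(ae_eq_integral_abs P measurableT mk2).
by apply: filterS => w /(_ Logic.I) [] /eqP; rewrite sqrf_eq0 => /eqP.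
Qed.

Lemma sqr_integral_zero_ae {R : realType} d (T : measurableType d)
    (P : {measure set T -> \bar R}) (k : T -> R) : measurable_fun setT k ->
  {ae P, forall w, k w = 0} -> (\int[P]_w (k w ^+ 2)%:E = 0)%E.
Proof.
move=> mk k0; rewrite -[RHS](integral0 P setT).
apply: ae_eq_integral => //.
  by apply/measurable_EFinP; exact: measurable_funX.
by apply: filterS k0 => w k0 _; rewrite k0 expr0n.
Qed.

Section noise_dichotomy.
Context {R : realType} dO (O : measurableType dO) (P : probability O R).
Context (d1 : measure_display) (T1 : measurableType d1) (I : Type).
Variables (X : nat -> {RV P >-> T1}) (e : nat -> {RV P >-> R}).
Hypotheses (hX : iid X) (he : iid e) (hXe : independent_seqs X e).
Variables (sigma : T1 -> R) (p c : I -> T1 -> R).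
Hypotheses (bs : bmf sigma) (mp : forall k, measurable_fun setT (p k))
  (mc : forall k, measurable_fun setT (c k))
  (c0 : forall k x, c k x = 0 -> sigma x * p k x = 0).
Hypotheses
  (res : forall B, measurable B ->
     \int[P]_(w in X 0%N @^-1` B) (sigma (X 0%N w) * e 0%N w) = 0)
  (ice : forall k, P.-integrable setT
     (EFin \o (fun w => (c k (X 0%N w) * e 0%N w) ^+ 2))).

(* Integrability and centering are only assumed for products with e; they pass
   to e itself as soon as one of the weights does not vanish. *)
Lemma noise_dichotomy :
  (forall k, {ae P, forall w, sigma (X 0%N w) * p k (X 0%N w) = 0}) \/
  P.-integrable setT (EFin \o (fun w => e 0%N w ^+ 2)) /\ \int[P]_w e 0%N w = 0.
Proof.
have mX : measurable_fun setT (X 0%N) by exact: measurable_funPT.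
have me : measurable_fun setT (e 0%N) by exact: measurable_funPT.
have [h|/existsNP[k hk]] := pselect (forall k,
  {ae P, forall w, sigma (X 0%N w) * p k (X 0%N w) = 0}); [by left|right].
have mck : measurable_fun setT (fun w => c k (X 0%N w)) by exact: measurableT_comp.
have ie2 : P.-integrable setT (EFin \o (fun w => e 0%N w ^+ 2)).
  have me2 : measurable_fun setT (EFin \o (fun w => e 0%N w ^+ 2)).
    by apply/measurable_EFinP; exact: measurable_funX.
  apply/integrableP; split => //; rewrite ltey; apply/eqP => Eoo.
  (* The finite second moment of the product factorizes by independence; if that of [e] is infinite,
     that of the weight must be 0. *)
  apply: hk; suff : (\int[P]_w (c k (X 0%N w) ^+ 2)%:E = 0)%E.
    by move/(ae_zero_of_sqr mck); apply: filterS => w /c0.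
  have : (\int[P]_w (c k (X 0%N w) ^+ 2 * e 0%N w ^+ 2)%:E < +oo)%E.
    have /integrableP[_] := ice k; apply: le_lt_trans.
    rewrite le_eqVlt; apply/orP; left; apply/eqP; apply: eq_integral => w _ /=.
    by rewrite exprMn ger0_norm// mulr_ge0 ?sqr_ge0.
  rewrite (integral_mul_ge0 hX he hXe (k := fun x => c k x ^+ 2) (m := fun x => x ^+ 2) 0);
    [|exact: measurable_funX|exact: exprn_measurable|by move=> x; exact: sqr_ge0..].
  have -> : (\int[P]_w (e 0%N w ^+ 2)%:E = +oo)%E.
    by rewrite -Eoo; apply: eq_integral => w _ /=; rewrite ger0_norm// sqr_ge0.
  have : (0 <= \int[P]_w (c k (X 0%N w) ^+ 2)%:E)%E.
    by apply: integral_ge0 => w _; rewrite lee_fin sqr_ge0.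
  by rewrite le_eqVlt => /orP[/eqP//|c2]; rewrite gt0_muley.
split => //; have ie := integrable_of_sqr me ie2.
apply/eqP; apply: contrapT => /negP Ee; apply: hk.
(* If [e] had nonzero mean, the residual condition on [B] would give [sigma (X)] integral 0 over
   [B]. On a set where [sigma] has constant sign, recorded by [s], this forces it to vanish; the two
   signs together cover everything. *)
have zero (B : set T1) (s : R) : measurable B ->
    s != 0 -> (forall x, B x -> 0 <= s * sigma x) ->
    {ae P, forall w, \1_B (X 0%N w) * sigma (X 0%N w) = 0}.
  move=> mB s0 Bs.
  have bB : bmf (\1_B : T1 -> R).
    split; first exact: measurable_indic.
    by exists 1 => x; rewrite ger0_norm// indicE; case: (_ \in _).
  have bk : bmf (fun x => \1_B x * sigma x) by exact: bmfM.
  have E0 : \int[P]_w (\1_B (X 0%N w) * sigma (X 0%N w)) = 0.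
    apply/eqP; have := expect_mul hX he hXe ie bk.
    have -> : \int[P]_w (\1_B (X 0%N w) * sigma (X 0%N w) * e 0%N w) = 0.
      rewrite -[RHS](res mB) [RHS]Rintegral_mkcond; apply: eq_Rintegral => w _.
      rewrite patchE indicE; have [/set_mem h|h] := boolP (w \in _).
        by rewrite [X 0%N w \in B]mem_set// mul1r.
      rewrite (_ : (_ \in B) = false) ?mul0r//.
      by apply: contraNF h => h; rewrite inE/=; exact: set_mem.
    by move/esym/eqP; rewrite mulf_eq0 (negbTE Ee) orbF.
  have mk : measurable_fun setT (fun w => \1_B (X 0%N w) * sigma (X 0%N w)).
    by case: (bmf_precomp bk mX).
  have u0 w : 0 <= s * (\1_B (X 0%N w) * sigma (X 0%N w)).
    rewrite indicE; have [/set_mem h|_] := boolP (_ \in B); last by rewrite mul0r mulr0.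
    by rewrite mul1r Bs.
  have mu : measurable_fun setT (fun w => (s * (\1_B (X 0%N w) * sigma (X 0%N w)))%:E).
    by apply/measurable_EFinP; exact: measurable_funM.
  have : (\int[P]_w `|(s * (\1_B (X 0%N w) * sigma (X 0%N w)))%:E| = 0)%E.
    under eq_integral do rewrite /= (ger0_norm (u0 _)).
    have bkX := bmf_precomp bk mX.
    have : \int[P]_w (s * (\1_B (X 0%N w) * sigma (X 0%N w))) = 0.
      by rewrite expectZ// E0 mulr0.
    rewrite /Rintegral => h.
    rewrite -[LHS]fineK ?h//; apply: integrable_fin_num => //.
    by apply: bmf_integrable; apply: bmfM => //; exact: bmf_cst.
  move/(ae_eq_integral_abs P measurableT mu).
  apply: filterS => w /(_ Logic.I) [] /eqP; rewrite mulf_eq0 (negbTE s0) => /eqP.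
  exact.
have [ms _] := bs.
have mB1 : measurable [set x | 0 <= sigma x].
  rewrite -[X in measurable X]setTI.
  by have := measurable_fun_ler (measurable_cst (0 : R)) ms measurableT; exact.
have mB2 : measurable [set x | sigma x <= 0].
  rewrite -[X in measurable X]setTI.
  by have := measurable_fun_ler ms (measurable_cst (0 : R)) measurableT; exact.
have z1 := zero _ 1 mB1 (oner_neq0 _).
have z2 := zero _ (-1) mB2.
have {}z1 : {ae P, forall w, \1_[set x | 0 <= sigma x] (X 0%N w) * sigma (X 0%N w) = 0}.
  by apply: z1 => x; rewrite /= mul1r.
have {}z2 : {ae P, forall w, \1_[set x | sigma x <= 0] (X 0%N w) * sigma (X 0%N w) = 0}.
  by apply: z2 => [|x /=]; [rewrite oppr_eq0 oner_neq0|rewrite mulN1r oppr_ge0].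
apply: filterS2 z1 z2 => w; rewrite !indicE.
have [s0|/ltW s0] := leP 0 (sigma (X 0%N w)).
  by rewrite mem_set// mul1r => -> _; rewrite mul0r.
by move=> _; rewrite mem_set// mul1r => ->; rewrite mul0r.
Qed.

End noise_dichotomy.

(** * Asymptotic normality *)

Section covariance_of_centered.
Context {R : realType} dO (O : measurableType dO) (P : probability O R) (d : nat).
Variable W : O -> 'rV[R]_d.
Hypotheses (W2 : square_integrable P W)
  (W0 : forall k, \int[P]_w (W w 0 k) = 0).

Let mW k : measurable_fun setT (fun w => W w 0 k). Proof. by case: (W2 k). Qed.

Let iWW k l : P.-integrable setT (EFin \o (fun w => W w 0 k * W w 0 l)).
Proof.
have [_ ik] := W2 k; have [_ il] := W2 l.
apply: (le_integrable _ _ _ (integrableD measurableT ik il)) => //.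
  by apply/measurable_EFinP; exact: measurable_funM.
move=> w _; rewrite lee_fin [leRHS]ger0_norm ?addr_ge0 ?sqr_ge0//.
rewrite normrM -[W w 0 k ^+ 2]real_normK ?num_real// -[W w 0 l ^+ 2]real_normK ?num_real//.
have := sqr_ge0 (`|W w 0 k| - `|W w 0 l|); have := normr_ge0 (W w 0 k).
by have := normr_ge0 (W w 0 l); nra.
Qed.

Let covE k l : covariance_mx P W k l = \int[P]_w (W w 0 k * W w 0 l).
Proof.
have E0 j : expectation P (fun w => W w 0 j) = 0%E.
  rewrite unlock; have := W0 j; rewrite /Rintegral => h.
  rewrite -[LHS]fineK ?h//; apply: integrable_fin_num => //.
  by have [mj ij] := W2 j; exact: integrable_of_sqr.
rewrite mxE covariance.unlock !E0 unlock /Rintegral; congr fine.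
apply: eq_integral => w _; rewrite /GRing.mul /=.
by rewrite !subr0.
Qed.

Let linE (u : 'rV[R]_d) w : ((u *m (W w)^T) 0 0) ^+ 2 =
  \sum_k \sum_l (u 0 k * u 0 l) * (W w 0 k * W w 0 l).
Proof.
rewrite row_mulmx_tr expr2 mulr_suml; apply: eq_bigr => k _.
by rewrite mulr_sumr; apply: eq_bigr => l _; ring.
Qed.

Let iterm (u : 'rV[R]_d) k l :
  P.-integrable setT (EFin \o (fun w => (u 0 k * u 0 l) * (W w 0 k * W w 0 l))).
Proof. exact: (integrableZl measurableT _ (iWW k l)). Qed.

Let isum (I : Type) (s : seq I) (F : I -> O -> R) :
  (forall i, P.-integrable setT (EFin \o F i)) ->
  P.-integrable setT (EFin \o (fun w => \sum_(i <- s) F i w)) /\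
  \int[P]_w (\sum_(i <- s) F i w) = \sum_(i <- s) \int[P]_w F i w.
Proof.
move=> iF; elim: s => [|i s [IH1 IH2]].
  rewrite big_nil; split.
    rewrite (_ : _ \o _ = cst 0%E); first exact: integrable0.
    by apply/funext => w; rewrite /= big_nil.
  by under eq_Rintegral do rewrite big_nil; rewrite /Rintegral integral0.
have E w : \sum_(j <- i :: s) F j w = F i w + \sum_(j <- s) F j w by rewrite big_cons.
split.
  have := integrableD measurableT (iF i) IH1; apply: eq_integrable => // w _ /=.
  by rewrite E.
by under eq_Rintegral do rewrite E; rewrite RintegralD// IH2 big_cons.
Qed.

Lemma square_integrable_linear (u : 'rV[R]_d) :
  P.-integrable setT (EFin \o (fun w => ((u *m (W w)^T) 0 0) ^+ 2)).
Proof.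
have [i1 _] := isum (index_enum 'I_d) (fun k => proj1 (isum (index_enum 'I_d) (iterm u k))).
by apply: eq_integrable i1 => // w _ /=; rewrite linE.
Qed.

Lemma covariance_quadratic (u : 'rV[R]_d) :
  (u *m covariance_mx P W *m u^T) 0 0 = \int[P]_w (((u *m (W w)^T) 0 0) ^+ 2).
Proof.
under eq_Rintegral do rewrite linE.
have h k := isum (index_enum 'I_d) (iterm u k).
have [_ ->] := isum (index_enum 'I_d) (fun k => proj1 (h k)).
under [RHS]eq_bigr => k _ do rewrite (proj2 (h k)).
rewrite [LHS]mxE exchange_big/=; apply: eq_bigr => l _.
rewrite [X in X * _]mxE [u^T _ _]mxE mulr_suml; apply: eq_bigr => k _.
rewrite covE (RintegralZl _ measurableT (iWW k l)); ring.
Qed.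

Lemma psd_covariance : psd_mx (covariance_mx P W).
Proof.
split => [|u].
  apply/matrixP => k l; rewrite mxE !covE.
  by apply: eq_Rintegral => w _; rewrite mulrC.
by rewrite covariance_quadratic; apply: Rintegral_ge0 => w _; exact: sqr_ge0.
Qed.

End covariance_of_centered.

Lemma bounded_funP {R : realType} (T : Type) (F : T -> R) : bounded_fun F ->
  exists M, forall x, `|F x| <= M.
Proof.
by move=> [M [_ /(_ (M + 1))]]; rewrite ltrDl ltr01 => /(_ isT) h; exists (M + 1) => x; exact: h.
Qed.

Lemma asymptotically_null_exists {R : realType} dO (O : measurableType dO)
    (P : probability O R) (I : finType) (A : I -> nat -> set O) :
  (forall k, asymptotically_null P (A k)) ->
  asymptotically_null P (fun n => [set w | exists k, A k n w]).
Proof.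
move=> A0.
have h (s : seq I) : asymptotically_null P
    (fun n => [set w | exists2 k, k \in s & A k n w]).
  elim: s => [|k s IH].
    move=> e e0; apply: nearW => n; exists set0; split => //.
      by move=> w [].
    by rewrite measure0 lee_fin ltW.
  apply: asymptotically_null_le (asymptotically_nullU (A0 k) IH).
  apply: nearW => n w [j]; rewrite inE => /orP[/eqP ->|js] h; first by left.
  by right; exists j.
apply: asymptotically_null_le (h (enum I)); apply: nearW => n w [k Ak].
by exists k => //; rewrite mem_enum.
Qed.

(** * Assembly: bias and noise errors, leading term, limit law *)

Section weighted_average.
Context {R : realType} dO (O : measurableType dO) (P : probability O R).
Context (d : nat).
Notation rV := ('rV[R]_d).
Notation leb := (lebesgue_row d).
Variables (r : nat) (X : nat -> {RV P >-> rV}) (e : nat -> {RV P >-> R}).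
Hypotheses (hr : (0 < r)%N) (hX : iid X) (he : iid e) (hXe : independent_seqs X e).
Variables (g sigma : rV -> R).
Hypotheses (hgm : measurable_fun setT g) (hsm : measurable_fun setT sigma).
Variable Y : nat -> O -> R.
Hypotheses (hY : forall i w, Y i w = g (X i w) + sigma (X i w) * e i w)
  (hg : regression_function (X 0%N) (Y 0%N) g).
Variables (psi : rV -> R) (Q : set rV) (h : nat -> R) (f K : rV -> R) (b C1 C2 : R).
Hypotheses (hpsi : forall x, differentiable psi x)
  (hh : forall n, (0 < n)%N -> 0 < h n)
  (hf : has_density (X 0%N) f) (hfb : bounded_fun f)
  (hfr : bounded_order_derivatives r f)
  (hb : 0 < b) (hfQ : forall x, Q x -> b <= f x)
  (hKs : forall x, K (- x) = K x) (hKr : kernel_order r K)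
  (hC1 : 0 < C1) (hC2 : 0 < C2)
  (hKexp : forall x, `|K x| <= C1 * expR (- (C2 * `|x|)))
  (hpsiQ : Q = closure [set x | gradient psi x != 0])
  (hQb : bounded_set Q) (hQc : convex_set (Q : set (convex_lmodType rV)))
  (hpsiH : hoelder_on (gradient psi) Q)
  (hgH : hoelder_on (g : rV -> R^o) Q) (hsb : bounded_fun sigma)
  (hh0 : (fun n => Num.sqrt n%:R * h n ^+ r) @ \oo --> (0 : R))
  (hhoo : (fun n => Num.sqrt n%:R * h n ^+ d) @ \oo --> +oo).
Variable W : O -> rV.
Hypotheses (hW : forall w, W w =
      ((Y 0%N w - g (X 0%N w)) / f (X 0%N w)) *: gradient psi (X 0%N w))
  (hW2 : square_integrable P W).

Let p (k : 'I_d) : rV -> R := partial k psi.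

Let gradE x k : gradient psi x 0 k = p k x. Proof. by rewrite mxE. Qed.

Let mX i : measurable_fun setT (X i). Proof. exact: measurable_funPT. Qed.
Let me i : measurable_fun setT (e i). Proof. exact: measurable_funPT. Qed.
Let mf : measurable_fun setT f. Proof. by case: hf. Qed.
Let f0 x : 0 <= f x. Proof. by case: hf. Qed.

Let cf : continuous f. Proof. exact: bounded_order_derivatives_continuous hfr hr. Qed.

Let pf k x : p k x != 0 -> b <= f x.
Proof. by move=> px; apply: hfQ; exact: (partial_neq0_in hpsiQ px). Qed.

(** Taking [g = 1] in the lemmas on [g psi_k] gives continuity and boundedness of the partial
    derivatives themselves. *)
Let hone : hoelder_on ((fun=> 1) : rV -> R^o) Q.
Proof. by exists 1, 0; split => // x y _ _; rewrite subrr normr0 mul0r. Qed.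

Let mp k : measurable_fun setT (p k).
Proof.
apply: continuous_measurable_row.
have := continuous_mul_partial hpsi hpsiQ hQb hQc hpsiH (k := k) hone.
by under eq_fun do rewrite mul1r.
Qed.

Let bp k : bmf (p k).
Proof.
split => //; have [M pM] := bounded_mul_partial hpsiQ hQb hpsiH k hone.
by exists M => x; have := pM x; rewrite mul1r.
Qed.

Let bsg : bmf sigma. Proof. by split => //; exact: bounded_funP. Qed.

Let gp k : continuous (fun x => g x * p k x).
Proof. exact: (continuous_mul_partial hpsi hpsiQ hQb hQc hpsiH (k := k) hgH). Qed.

(** The density may vanish off [Q]; dividing by this maximum keeps the weight bounded everywhere and
    changes nothing where [psi_k] is nonzero. *)
Let fmax x := Num.max b (f x).

Let fmax_gt0 x : 0 < fmax x. Proof. by rewrite lt_max hb. Qed.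

Let a k x := g x * p k x / fmax x ^+ 2.

Let ma k : measurable_fun setT (a k).
Proof.
apply: measurable_funM; first exact: measurable_funM.
by apply: measurable_funV; apply: measurable_funX; exact: measurable_maxr.
Qed.

Let aB k : exists aM, forall x, `|a k x| <= aM.
Proof.
have [M gpM] := bounded_mul_partial hpsiQ hQb hpsiH k hgH.
exists (M * (b ^+ 2)^-1) => x; rewrite normrM; apply: ler_pM => //.
rewrite ger0_norm ?invr_ge0 ?sqr_ge0// lef_pV2 ?posrE ?exprn_gt0//.
by rewrite lerXn2r ?nnegrE ?(ltW hb) ?(ltW (fmax_gt0 x))// le_max lexx.
Qed.

Let af k x : a k x != 0 -> b <= f x.
Proof.
by move=> ax; apply: (@pf k); apply: contra ax => /eqP px; rewrite /a px mulr0 mul0r.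
Qed.

Let af2 k x : a k x * f x ^+ 2 = g x * p k x.
Proof.
have [px|px] := eqVneq (p k x) 0; first by rewrite /a px mulr0 !mul0r.
have fb := pf px; rewrite /a /fmax max_r// divfK//.
by rewrite expf_neq0// gt_eqF// (lt_le_trans hb).
Qed.

Let ca k : continuous (ratio f (a k)).
Proof.
move=> x.
have cr : {for f x, continuous (fun y : R => y / Num.max b y ^+ 2)}.
  have c0 : Num.max b (f x) ^+ 2 != 0 by rewrite expf_neq0// gt_eqF// (fmax_gt0 x).
  apply: cvgM; first exact: cvg_id.
  apply: (@cvgV _ _ _ _ (fun y : R => Num.max b y ^+ 2)) => //.
  have cm : (fun y : R => Num.max b y) @ f x --> Num.max b (f x).
    by apply: (@continuous_max R R (fun=> b) id); [exact: cst_continuous|exact: cvg_id].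
  by under eq_fun do rewrite expr2; apply: cvgM.
have h2 : {for x, continuous (fun x => f x / fmax x ^+ 2)}.
  by apply: (@continuous_comp _ _ _ f (fun y : R => y / Num.max b y ^+ 2)) => //; exact: cf.
have E y : ratio f (a k) y = g y * p k y * (f y / fmax y ^+ 2).
  by rewrite /ratio /a; ring.
have := @cvgM _ _ _ (nbhs_filter x) _ _ _ _ (@gp k x) h2.
rewrite /continuous_at E (_ : _ \* _ = ratio f (a k)); first exact.
by apply/funext => y; rewrite E.
Qed.

Let iK : leb.-integrable setT (EFin \o K). Proof. by case: hKr. Qed.

Let mK : measurable_fun setT K.
Proof. by case/integrableP : iK => /measurable_EFinP. Qed.

Let KB x : `|K x| <= C1.
Proof.
apply: le_trans (hKexp x) _; rewrite ler_piMr ?(ltW hC1)// -expR0 ler_expR.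
by rewrite oppr_le0 mulr_ge0// ltW.
Qed.

Let K1 : \int[leb]_u K u = 1. Proof. by case: hKr. Qed.

Let m n (i : 'I_n) w := loo_kde X K h i (X i w) w.

Let estimation_error k n w := Num.sqrt n%:R *
  (n%:R^-1 * \sum_(i < n) (g (X i w) * p k (X i w) / m i w) - beta_of psi g 0 k).

Let noise_error k n w := (Num.sqrt n%:R)^-1 * \sum_(i < n)
  e i w * (sigma (X i w) * p k (X i w) * ((m i w)^-1 - (f (X i w))^-1)).

Let estimation_error_vanishes k : vanishes_in_prob P (estimation_error k).
Proof.
have [Bf fB] := bounded_funP hfb.
have fB' x : f x <= Bf by exact: le_trans (ler_norm _) (fB x).
have [C C0 bias] := kernel_bias hr hfr hfb hKr.
have bias' x t : 0 < t -> `|smoothed f K t x - f x| <= C * t ^+ r by exact: bias.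
have [aM aM_le] := aB k.
have := ratio_estimator_vanishes hX he hXe hf fB' mK iK KB hKs K1 hr hh hh0 hhoo bias'
  (ma k) aM_le (@ca k) hb (@af k).
congr vanishes_in_prob; apply/funext => n; apply/funext => w.
congr (_ * (_ * _ - _)); first by apply: eq_bigr => i _; rewrite af2.
rewrite mxE (expect_density hf (G := ratio f (a k))).
  apply: eq_Rintegral => x _; rewrite gradE -/(p k x) -(af2 k x) /ratio; ring.
apply: bmfM; first by split => //; exact: aB.
by split => //; exists Bf.
Qed.

Let c k x := sigma x * p k x / f x.

Let bc k : bmf (c k).
Proof.
have bsp : bmf (fun x => b^-1 * (sigma x * p k x)).
  by apply: bmfM; [exact: bmf_cst|exact: bmfM].
apply: bmf_le bsp _ => [|x].
  apply: measurable_funM; last exact: measurable_funV.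
  by apply: measurable_funM => //; case: (bp k).
rewrite /c; have [px|px] := eqVneq (p k x) 0.
  by rewrite px !(mulr0, mul0r).
have fb := pf px; rewrite mulrC !normrM ler_wpM2r// !ger0_norm ?invr_ge0 ?(ltW hb)//.
by rewrite lef_pV2 ?posrE// (lt_le_trans hb).
Qed.

Let WE k w : W w 0 k = c k (X 0%N w) * e 0%N w.
Proof. by rewrite hW mxE gradE hY /c -/(p k _); ring. Qed.

Let dichotomy :
  (forall k, {ae P, forall w, sigma (X 0%N w) * p k (X 0%N w) = 0}) \/
  P.-integrable setT (EFin \o (fun w => e 0%N w ^+ 2)) /\ \int[P]_w e 0%N w = 0.
Proof.
apply: (noise_dichotomy hX he hXe (sigma := sigma) (p := p) (c := c)) => //.
- by move=> k; case: (bc k).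
- move=> k x; have [->|px] := eqVneq (p k x) 0; first by rewrite mulr0.
  have fx : 0 < f x := lt_le_trans hb (pf px).
  by rewrite /c => /eqP; rewrite mulf_eq0 invr_eq0 [f x == 0]gt_eqF ?orbF// => /eqP.
- move=> B mB; have [_ /(_ B mB)] := hg; under eq_Rintegral do rewrite hY addrAC subrr add0r.
  exact.
- move=> k; have [_] := hW2 k; apply: eq_integrable => // w _ /=.
  by rewrite WE.
Qed.

Let W0 k : \int[P]_w (W w 0 k) = 0.
Proof.
have mce : measurable_fun setT (fun w => c k (X 0%N w) * e 0%N w).
  by apply: measurable_funM => //; case: (bmf_precomp (bc k) (mX 0)).
under eq_Rintegral do rewrite WE.
have [/(_ k) sp0|[ie2 e0]] := dichotomy.
  rewrite /Rintegral (ae_eq_integral (cst 0%E)) ?integral0//.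
    exact/measurable_EFinP.
  by apply: filterS sp0 => w h0 _; rewrite /c h0 !mul0r.
have ie := integrable_of_sqr (me 0) ie2.
by rewrite (expect_mul hX he hXe ie (bc k)) e0 mulr0.
Qed.

Let noise_error_vanishes k : vanishes_in_prob P (noise_error k).
Proof.
have [/(_ k) sp0|[ie2 e0]] := dichotomy; last first.
  have [Bf fB] := bounded_funP hfb.
  have fB' x : f x <= Bf by exact: le_trans (ler_norm _) (fB x).
  have [C C0 bias] := kernel_bias hr hfr hfb hKr.
  have bias' x t : 0 < t -> `|smoothed f K t x - f x| <= C * t ^+ r by exact: bias.
  have [mt [tM tB]] : bmf (fun x => sigma x * p k x) by exact: bmfM.
  apply: (noise_vanishes hX he hXe hf fB' mK iK KB hh hh0 hhoo bias' ie2 e0 mt tB hb).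
  by move=> x tx; apply: (@pf k); apply: contra tx => /eqP ->; rewrite mulr0.
have mt i : measurable_fun setT (fun w => sigma (X i w) * p k (X i w)).
  by apply: measurable_funM; exact: measurableT_comp.
(* Almost sure vanishing passes from [X 0] to every [X i] through the integral of the square, which
   depends on the law alone; a single null set then serves all indices. *)
have spi i : {ae P, forall w, sigma (X i w) * p k (X i w) = 0}.
  apply: ae_zero_of_sqr => //.
  rewrite -(sqr_integral_zero_ae (mt 0) sp0).
  pose q x := ((sigma x * p k x) ^+ 2)%:E : \bar R.
  have mq : measurable_fun setT q.
    by apply/measurable_EFinP; apply: measurable_funX; exact: measurable_funM.
  have q0 x : (0 <= q x)%E by rewrite lee_fin sqr_ge0.
  have E j : (\int[P]_w q (X j w) = \int[distribution P (X j)]_x q x)%E.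
    by rewrite ge0_integral_distribution.
  rewrite -/(q _) (E i) (E 0%N); apply: eq_measure_integral => A mA _.
  exact: (proj2 hX).
have [N [mN N0 subN]] := ae_foralln spi.
have cst0 : vanishes_in_prob P (fun _ _ => 0 : R).
  by apply: vanishes_in_prob_cvg; exact: cvg_cst.
apply: vanishes_in_probW cst0 => ep ep0; apply: nearW => n; exists N; split => //.
  move=> w /= h1; apply: subN => /= h2; apply: h1.
  rewrite /noise_error big1 ?mulr0// => i _.
  by rewrite h2 mul0r mulr0.
by rewrite N0 lee_fin ltW.
Qed.

Let Z n w := Num.sqrt n%:R *: (beta_hat X Y K h psi n w - beta_of psi g).

(** The leading term: the noise average with the true density in place of its estimate, hence a
    normalized sum of i.i.d. vectors. *)
Let V n w := (Num.sqrt n%:R)^-1 *: \sum_(i < n)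
  ((sigma (X i w) * e i w / f (X i w)) *: gradient psi (X i w)).

Let row_subE (x y : rV) k : (x - y) 0 k = x 0 k - y 0 k.
Proof. by rewrite !mxE. Qed.

Let ZE n w k : Z n w 0 k = Num.sqrt n%:R *
  (n%:R^-1 * \sum_(i < n) (Y i w / m i w * p k (X i w)) - beta_of psi g 0 k).
Proof.
rewrite /Z mxE; congr (_ * _); rewrite row_subE; congr (_ - _).
rewrite /beta_hat mxE summxE; congr (_ * _); apply: eq_bigr => i _.
by rewrite mxE gradE.
Qed.

Let VE n w k : V n w 0 k = (Num.sqrt n%:R)^-1 *
  \sum_(i < n) (sigma (X i w) * e i w / f (X i w) * p k (X i w)).
Proof.
rewrite /V mxE summxE; congr (_ * _); apply: eq_bigr => i _.
by rewrite mxE gradE.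
Qed.

Let ZV_coord n w k : (0 < n)%N ->
  (Z n w - V n w) 0 k = estimation_error k n w + noise_error k n w.
Proof.
move=> n0; have s0 : Num.sqrt n%:R != 0 :> R by rewrite gt_eqF// sqrtr_gt0 ltr0n.
have nE : n%:R^-1 = Num.sqrt n%:R ^- 2 :> R by rewrite sqr_sqrtr.
rewrite row_subE ZE VE /estimation_error /noise_error nE.
have -> : \sum_(i < n) (Y i w / m i w * p k (X i w)) =
    \sum_(i < n) (g (X i w) * p k (X i w) / m i w) +
    \sum_(i < n) (sigma (X i w) * e i w * p k (X i w) / m i w).
  by rewrite -big_split/=; apply: eq_bigr => i _; rewrite hY; ring.
have -> : \sum_(i < n) e i w * (sigma (X i w) * p k (X i w) * ((m i w)^-1 - (f (X i w))^-1)) =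
    \sum_(i < n) (sigma (X i w) * e i w * p k (X i w) / m i w) -
    \sum_(i < n) (sigma (X i w) * e i w / f (X i w) * p k (X i w)).
  by rewrite -sumrB; apply: eq_bigr => i _; ring.
set A := \sum_(i < n) _; set B := \sum_(i < n) _; set D := \sum_(i < n) _.
by move: (Num.sqrt _) s0 (beta_of _ _ _ _) => q q0 bt; field.
Qed.

Let mYi i : measurable_fun setT (Y i).
Proof.
rewrite (_ : Y i = fun w => g (X i w) + sigma (X i w) * e i w); last exact/funext/hY.
apply: measurable_funD; first exact: measurableT_comp.
by apply: measurable_funM => //; exact: measurableT_comp.
Qed.

Let mZ n : measurable_fun setT (Z n).
Proof.
apply: measurable_row => k; under eq_fun do rewrite ZE.
apply: measurable_funM => //; apply: measurable_funB => //.
apply: measurable_funM => //; apply: measurable_sum => i.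
apply: measurable_funM; last exact: measurableT_comp.
apply: measurable_funM => //; apply: measurable_funV.
exact: measurable_loo_kde.
Qed.

Let mV n : measurable_fun setT (V n).
Proof.
apply: measurable_row => k; under eq_fun do rewrite VE.
apply: measurable_funM => //; apply: measurable_sum => i.
apply: measurable_funM; last exact: measurableT_comp.
apply: measurable_funM; last by apply: measurable_funV; exact: measurableT_comp.
by apply: measurable_funM => //; exact: measurableT_comp.
Qed.

Let VZ (dl ep : R) : 0 < dl -> 0 < ep ->
  \forall n \near \oo, (P [set w | (dl < `|Z n w - V n w|)%R] <= ep%:E)%E.
Proof.
move=> dl0 ep0.
have null : asymptotically_null P (fun n => [set w | dl < `|Z n w - V n w|]).
  apply: asymptotically_null_le (asymptotically_null_exists (A := fun k n =>
    [set w | dl < `|estimation_error k n w + noise_error k n w|]) _).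
    exists 1%N => // n /= n0 w /= lt; apply: contrapT => nex.
    move: lt; rewrite ltNge => /negP; apply.
    apply: row_norm_le => [|k]; first exact: ltW.
    rewrite ZV_coord// leNgt; apply/negP => lt; apply: nex; by exists k.
  move=> k; exact: (vanishes_in_probD (estimation_error_vanishes k) (noise_error_vanishes k) dl0).
apply: filterS (null ep ep0) => n [S [mS subS]]; apply: le_trans.
apply: le_measure; rewrite ?inE//.
have mD : measurable_fun setT (fun w => `|Z n w - V n w|).
  apply: measurableT_comp.
    by apply: continuous_measurable_row; exact: norm_continuous.
  apply: measurable_row => i; under eq_fun do rewrite row_subE.
  by apply: measurable_funB; exact: (measurableT_comp (measurable_coord i)).
rewrite -[X in measurable X]setTI.
by have := measurable_fun_ltr (measurable_cst dl) mD measurableT; exact.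
Qed.

(** The scalar product of [u] with one summand, as a function of the pair [(X i, e i)]: the limit
    theorem is proved for real variables and applied in each direction [u]. *)
Let omega (u : rV) (z : rV * R) : R :=
  sigma z.1 * z.2 / f z.1 * \sum_k u 0 k * p k z.1.

Let momega u : measurable_fun setT (omega u).
Proof.
have m1 (k : rV -> R) : measurable_fun setT k ->
    measurable_fun setT (fun z : rV * R => k z.1).
  by move=> mk; exact: (measurableT_comp mk measurable_fst).
apply: measurable_funM; last by apply: measurable_sum => k; apply: measurable_funM => //; exact: m1.
apply: measurable_funM; last by apply: measurable_funV; exact: m1.
by apply: measurable_funM; [exact: m1|exact: measurable_snd].
Qed.

Let omegaW u w : omega u (X 0%N w, e 0%N w) = (u *m (W w)^T) 0 0.
Proof.
rewrite row_mulmx_tr /omega mulr_sumr; apply: eq_bigr => k _.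
rewrite WE /c /=; ring.
Qed.

Let omegaV u n w : (u *m (V n w)^T) 0 0 =
  (Num.sqrt n%:R)^-1 * \sum_(i < n) omega u (X i w, e i w).
Proof.
rewrite row_mulmx_tr; under eq_bigr do rewrite VE mulrCA.
rewrite -mulr_sumr; congr (_ * _); under eq_bigr do rewrite mulr_sumr.
rewrite exchange_big/=; apply: eq_bigr => i _; rewrite /omega /= mulr_sumr.
by apply: eq_bigr => k _; ring.
Qed.

Let omega_mean u : \int[P]_w omega u (X 0%N w, e 0%N w) = 0.
Proof.
under eq_Rintegral do rewrite omegaW row_mulmx_tr.
have iW k : P.-integrable setT (EFin \o (fun w => W w 0 k)).
  by have [mk ik] := hW2 k; exact: integrable_of_sqr.
have h1 (s : seq 'I_d) :
    P.-integrable setT (EFin \o (fun w => \sum_(k <- s) u 0 k * W w 0 k)) /\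
    \int[P]_w (\sum_(k <- s) u 0 k * W w 0 k) = 0.
  elim: s => [|k s [IH1 IH2]].
    split; last by under eq_Rintegral do rewrite big_nil; rewrite expect_cst.
    rewrite (_ : _ \o _ = cst 0%E); first exact: integrable0.
    by apply/funext => w; rewrite /= big_nil.
  have ik := integrableZl measurableT (u 0 k) (iW k).
  have E w : \sum_(j <- k :: s) u 0 j * W w 0 j =
    u 0 k * W w 0 k + \sum_(j <- s) u 0 j * W w 0 j by rewrite big_cons.
  split.
    have := integrableD measurableT ik IH1; apply: eq_integrable => // w _ /=.
    by rewrite E.
  under eq_Rintegral do rewrite E.
  by rewrite (RintegralD measurableT ik IH1) IH2 (RintegralZl _ measurableT (iW k)) W0 mulr0 addr0.
by case: (h1 (index_enum 'I_d)).
Qed.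

Lemma weighted_average_normality : exists N : probability rV R,
  is_normal N 0 (covariance_mx P W) /\ cvg_in_distribution P Z N.
Proof.
have psd := psd_covariance hW2 W0.
have [N hN] := normal_exists psd; exists N; split => //; split => // phi cphi bphi.
apply: (slutsky_cvg mV mZ _ VZ cphi bphi) => u th.
rewrite (is_normal_cf u th hN psd) covariance_quadratic//.
under eq_fun do under eq_Rintegral do rewrite omegaV.
under eq_Rintegral do rewrite -omegaW.
apply: (clt_cos hX he hXe (momega u) _ (omega_mean u)).
have := square_integrable_linear hW2 u; apply: eq_integrable => // w _ /=.
by rewrite omegaW.
Qed.

End weighted_average.

Theorem corollary3 (R : realType) (dO : measure_display)
    (O : measurableType dO) (P : probability O R)
    (d : nat) (hd : (0 < d)%N) (r : nat) (hr : (0 < r)%N)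
    (X : nat -> {RV P >-> 'rV[R]_d}) (e : nat -> {RV P >-> R})
    (hX : iid X) (he : iid e) (hXe : independent_seqs X e)
    (g sigma : 'rV[R]_d -> R)
    (hgm : measurable_fun [set: 'rV[R]_d] g)
    (hsm : measurable_fun [set: 'rV[R]_d] sigma)
    (Y : nat -> O -> R)
    (hY : forall i w, Y i w = g (X i w) + sigma (X i w) * e i w)
    (hg : regression_function (X 0%N) (Y 0%N) g)
    (p : nat) (hpd : (p <= d)%N)
    (g0 : 'rV[R]_p -> R) (beta : 'M[R]_(d, p))
    (hgbeta : multiple_index g g0 beta)
    (psi : 'rV[R]_d -> R) (hpsi : forall x, differentiable psi x)
    (Q : set 'rV[R]_d) (hQ : compact Q)
    (h : nat -> R) (hh : forall n, (0 < n)%N -> 0 < h n)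
    (* (i) *)
    (f : 'rV[R]_d -> R) (hf : has_density (X 0%N) f)
    (hfb : bounded_fun f) (hfr : bounded_order_derivatives r f)
    (* (ii) *)
    (b : R) (hb : 0 < b) (hfQ : forall x, Q x -> b <= f x)
    (* (iii) *)
    (K : 'rV[R]_d -> R) (hKs : forall x, K (- x) = K x)
    (hKr : kernel_order r K)
    (s : R) (hs : 0 < s) (hsr : s <= r%:R)
    (C1 C2 : R) (hC1 : 0 < C1) (hC2 : 0 < C2)
    (hKexp : forall x, `|K x| <= C1 * expR (- (C2 * `|x|)))
    (* (iv) *)
    (hpsiQ : Q = closure [set x | gradient psi x != 0])
    (hQ0 : Q !=set0) (hQb : bounded_set Q)
    (hQc : convex_set (Q : set (convex_lmodType 'rV[R]_d)))
    (hpsiH : hoelder_on (gradient psi) Q)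
    (* (v) *)
    (hgH : hoelder_on (g : 'rV[R]_d -> R^o) Q) (hsb : bounded_fun sigma)
    (* (vi) *)
    (hh0 : (fun n => Num.sqrt n%:R * h n ^+ r) @ \oo --> (0 : R))
    (hhoo : (fun n => Num.sqrt n%:R * h n ^+ d) @ \oo --> +oo)
    (W : O -> 'rV[R]_d)
    (hW : forall w, W w =
      ((Y 0%N w - g (X 0%N w)) / f (X 0%N w)) *: gradient psi (X 0%N w))
    (hW2 : square_integrable P W) :
  exists N : probability 'rV[R]_d R,
    is_normal N 0 (covariance_mx P W) /\
    cvg_in_distribution P
      (fun n w => Num.sqrt n%:R *: (beta_hat X Y K h psi n w - beta_of psi g))
      N.
Proof.

exact: (weighted_average_normality hr hX he hXe hgm hsm hY hg hpsi hh hf hfb hfr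
  hb hfQ hKs hKr hC1 hC2 hKexp hpsiQ hQb hQc hpsiH hgH hsb hh0 hhoo hW hW2).
Qed.
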